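(* Let $d,N\ge1$ be integers. There is a constant $c(d)$ depending only on $d$ such that the following holds for every $\varepsilon>0$. Let $\mu$ be a Borel probability measure on $(\mathbb{R}^d)^N$ such that $\mu_j\in\mathcal{P}^{1,2}(\mathbb{R}^d)$ for every $j=1,\dots,N$. Then $$\mathcal{E}^{1,2}(\Theta^\varepsilon[\mu])\le\sum_{j=1}^N\mathcal{E}^{1,2}(\mu_j)+\frac{N c(d)}{\varepsilon}.$$ If in addition $\mu\in\mathcal{P}^{1,2}((\mathbb{R}^d)^N)$, then $$\mathcal{E}^{1,2}(\Theta^\varepsilon[\mu])\le\sum_{j=1}^N\left(\left\|\nabla_{x_j}\sqrt{\Lambda^\varepsilon[\mu]}\right\|_2+\Delta_j(\varepsilon,\mu)\right)^2,\qquad \Delta_j(\varepsilon,\mu)=\sqrt{\mathcal{E}^{1,2}(\mu_j)-\mathcal{E}^{1,2}(\mu_j*\eta^\varepsilon)}.$$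
   Context: $\mathcal{P}(\mathbb{R}^m)$ is the set of Borel probability measures on $\mathbb{R}^m$. $\mathcal{P}^{1,2}(\mathbb{R}^m)$ is the set of $\mu\in\mathcal{P}(\mathbb{R}^m)$ that are absolutely continuous with respect to Lebesgue measure, with density (also denoted $\mu$) satisfying $\mu^{1/2}\in W^{1,2}(\mathbb{R}^m)$. The energy of $\mu\in\mathcal{P}^{1,2}(\mathbb{R}^m)$ is $\mathcal{E}^{1,2}(\mu)=\int_{\mathbb{R}^m}|\nabla\mu^{1/2}|^2\,dx$. The space $(\mathbb{R}^d)^N$ is identified with $\mathbb{R}^{dN}$. $\mu_j=\pi^j_\#\mu$ is the $j$-th marginal of $\mu\in\mathcal{P}((\mathbb{R}^d)^N)$, $\pi^j(x_1,\dots,x_N)=x_j$. $\nabla_{x_j}$ is the (weak) gradient with respect to the $j$-th $\mathbb{R}^d$-variable. Smoothing operator: for $\varepsilon>0$ let $\eta^\varepsilon(z)=(2\pi\varepsilon)^{-d/2}\exp(-|z|^2/(2\varepsilon))$ for $z\in\mathbb{R}^d$ (Euclidean norm). For $\mu\in\mathcal{P}((\mathbb{R}^d)^N)$ let $\Lambda^\varepsilon[\mu]$ be the probability measure with Lebesgue density $\Lambda^\varepsilon[\mu](Y)=\int\prod_{k=1}^N\eta^\varepsilon(y_k-x_k)\,d\mu(X)$. Let $\mu_k*\eta^\varepsilon$ be the probability measure with density $(\mu_k*\eta^\varepsilon)(y)=\int\eta^\varepsilon(y-x)\,d\mu_k(x)$. Then $\Theta^\varepsilon[\mu]\in\mathcal{P}((\mathbb{R}^d)^N)$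 is defined by $$\int\psi\,d\Theta^\varepsilon[\mu]=\iint\psi(X)\prod_{k=1}^N\left(\frac{\eta^\varepsilon(y_k-x_k)}{(\mu_k*\eta^\varepsilon)(y_k)}\,d\mu_k(x_k)\right)d\Lambda^\varepsilon[\mu](Y)\quad\text{for all }\psi\in C_b((\mathbb{R}^d)^N).$$ (It is a fact that $\Theta^\varepsilon[\mu]\in\mathcal{P}^{1,2}((\mathbb{R}^d)^N)$ when all marginals are in $\mathcal{P}^{1,2}(\mathbb{R}^d)$, and that $\mathcal{E}^{1,2}(\mu_j*\eta^\varepsilon)\le\mathcal{E}^{1,2}(\mu_j)$.) *)

(* Defs.v *)
From HB Require Import structures.
From mathcomp Require Import all_boot all_order all_algebra.
From mathcomp Require Import all_classical all_reals all_analysis.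
From mathcomp Require Import measurable_realfun.

Set Implicit Arguments.
Unset Strict Implicit.
Unset Printing Implicit Defensive.

Import Order.TTheory GRing.Theory Num.Theory.
Import numFieldTopology.Exports numFieldNormedType.Exports.

Local Open Scope classical_set_scope.
Local Open Scope ring_scope.

(* R^(m n) is modelled by 'M[R]_(m, n): R^d is 'rV[R]_d, and (R^d)^N is
   'M[R]_(N, d), the k-th R^d-variable of X being row k X. The library norm on
   matrices is the sup norm; it is only used for the topology. *)

Section mx_borel.
Context {R : realType} (m n : nat).
Local Notation E := 'M[R]_(m, n).

Let mx_set0 : <<s @open E >> set0.
Proof. exact: sigma_algebra0. Qed.

Let mx_setC A : <<s @open E >> A -> <<s @open E >> (~` A).
Proof. exact: sigma_algebraC. Qed.

Let mx_bigcup (F : (set E)^nat) :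
  (forall i, <<s @open E >> (F i)) -> <<s @open E >> (\bigcup_i F i).
Proof. exact: sigma_algebra_bigcup. Qed.

HB.instance Definition _ := @isMeasurable.Build (sigma_display (@open E))
  E <<s @open E >> mx_set0 mx_setC mx_bigcup.

Lemma measurable_mx_open (U : set E) : open U -> measurable U.
Proof. by move=> oU; apply: sub_sigma_algebra. Qed.

Lemma measurable_mx_coord (i : 'I_m) (j : 'I_n) :
  measurable_fun [set: E] (fun X : E => X i j).
Proof.
apply: (measurability _ (RGenOpens.measurableE R)).
move=> _ [_ [a [b ->]] <-]; rewrite setTI; apply: measurable_mx_open.
apply: open_comp; last exact: interval_open.
by move=> X _; exact: coord_continuous.
Qed.

Lemma measurable_fun_mxP d (T : measurableType d) (f : T -> E) :
  measurable_fun [set: T] f <->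
  forall i j, measurable_fun [set: T] (fun t => f t i j).
Proof.
split=> [mf i j|mf].
  exact: (measurableT_comp (measurable_mx_coord i j) mf).
apply: (measurability (@open E)) => //.
move=> _ [U oU <-]; rewrite setTI.
pose c (q : 'M[rat]_(m, n) * nat) : E := \matrix_(i, j) ratr (q.1 i j).
pose B (q : 'M[rat]_(m, n) * nat) : set E :=
  ball (c q) (q.2.+1%:R^-1).
pose D := [set q | B q `<=` U].
have -> : U = \bigcup_q (if q \in D then B q else set0).
  apply/seteqP; split=> [X UX|X [q _]]; last first.
    by case: ifPn => // /set_mem; apply.
  have /nbhs_ballP[e /= e0 eU] : nbhs X U.
    by rewrite nbhsE; exists U => //.
  have [k ke] : exists k : nat, k.+1%:R^-1 < e / 2.
    have /ltr_add_invr[k] : 0 < e / 2 by rewrite divr_gt0.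
    by rewrite add0r => ?; exists k.
  set r : R := k.+1%:R^-1 in ke.
  have r0 : 0 < r by rewrite invr_gt0.
  have H i j : exists q : rat, ball (ratr q : R) r (X i j).
    have /rat_in_itvoo[q] : X i j - r < X i j + r.
      by rewrite ltrBlDr -addrA ltrDl addr_gt0.
    rewrite in_itv/= => /andP[qa qb]; exists q.
    by rewrite /ball/= /ball_ distrC ltr_distlC qa qb.
  pose q : 'M[rat]_(m, n) * nat := (\matrix_(i, j) sval (cid (H i j)), k).
  have Bq : B q X by split=> // i j; rewrite !mxE; case: cid.
  exists q => //; rewrite ifT//; apply/mem_set => Y qY; apply: eU.
  have -> : e = e / 2 + e / 2 by rewrite -splitr.
  apply: (@ball_triangle _ _ (c q)).
    by apply: (le_ball (ltW ke)); exact/ball_sym.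
  exact: (le_ball (ltW ke)).
rewrite preimage_bigcup; apply: countable_bigcupT_measurable => // q.
case: ifPn => _; last by rewrite preimage_set0.
rewrite (_ : _ @^-1` _ = \bigcap_(ij in [set: 'I_m * 'I_n])
  ((fun t => f t ij.1 ij.2) @^-1`
     ball (ratr (q.1 ij.1 ij.2) : R) (q.2.+1%:R^-1))).
  apply: fin_bigcap_measurable => //= ij _.
  rewrite -[X in measurable X]setTI; apply: mf => //.
  by apply: open_measurable; apply: ball_open; rewrite invr_gt0.
apply/seteqP; split=> [t [_ Bt] ij _|t Bt].
  by have := Bt ij.1 ij.2; rewrite mxE.
by split=> [|i j]; [rewrite invr_gt0|have := Bt (i, j) I; rewrite mxE].
Qed.

End mx_borel.

Lemma pushforward_semi_sigma_additive d1 d2 (T1 : measurableType d1)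
    (T2 : measurableType d2) (R : realType) (m : {measure set T1 -> \bar R})
    (f : T1 -> T2) :
  measurable_fun [set: T1] f -> semi_sigma_additive (pushforward m f).
Proof. by move=> mf; exact: measure_semi_sigma_additive. Qed.

Lemma pushforward_sigma_finite d1 d2 (T1 : measurableType d1)
    (T2 : measurableType d2) (R : realType)
    (m : set T1 -> \bar R) (f : T1 -> T2) (g : T2 -> T1) :
  sigma_finite [set: T1] m -> measurable_fun [set: T2] g -> cancel f g ->
  sigma_finite [set: T2] (pushforward m f).
Proof.
move=> [F FT Foo] mg fK.
exists (fun i => g @^-1` F i).
  by rewrite -preimage_bigcup -FT preimage_setT.
move=> i; have [mF mFoo] := Foo i; split.
  by rewrite -[X in measurable X]setTI; exact: mg.
rewrite /pushforward (_ : _ @^-1` _ = F i)//.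
by apply/seteqP; split=> x /=; rewrite fK.
Qed.

Lemma product_measure1_sigma_finite d1 d2 (T1 : measurableType d1)
    (T2 : measurableType d2) (R : realType)
    (m1 : {sigma_finite_measure set T1 -> \bar R})
    (m2 : {sigma_finite_measure set T2 -> \bar R}) :
  sigma_finite [set: T1 * T2] (m1 \x m2)%E.
Proof.
have /sigma_finiteP[F [TF ndF Foo]] := sigma_finiteT m1.
have /sigma_finiteP[G [TG ndG Goo]] := sigma_finiteT m2.
exists (fun n => F n `*` G n).
  rewrite -setXTT TF TG predeqE => -[x y]; split.
    move=> [/= [n _ Fnx] [k _ Gky]]; exists (maxn n k) => //; split.
    - by move: x Fnx; exact/subsetPset/ndF/leq_maxl.
    - by move: y Gky; exact/subsetPset/ndG/leq_maxr.
  by move=> [n _ []/= ? ?]; split; exists n.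
move=> k; have [? ?] := Foo k; have [? ?] := Goo k.
split; first exact: measurableX.
by rewrite product_measure1E// lte_mul_pinfty// ge0_fin_numE.
Qed.

Section prod_measure.
Local Open Scope ereal_scope.
Context d (T : measurableType d) (R : realType).

Section cons_measure.
Variables (n : nat) (m1 : {sigma_finite_measure set T -> \bar R})
  (m2 : {sigma_finite_measure set (n.-tuple T) -> \bar R}).

Let consp (xt : T * n.-tuple T) : n.+1.-tuple T := [tuple of xt.1 :: xt.2].

Let measurable_consp : measurable_fun [set: T * n.-tuple T] consp.
Proof. by apply: measurable_cons. Qed.

Definition cons_measure : set (n.+1.-tuple T) -> \bar R :=
  pushforward (m1 \x m2) (fun xt => [tuple of xt.1 :: xt.2]).

Let cons_measure0 : cons_measure set0 = 0.
Proof. by rewrite /cons_measure /pushforward preimage_set0 measure0. Qed.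

Let cons_measure_ge0 A : 0 <= cons_measure A.
Proof. exact: measure_ge0. Qed.

Let cons_measure_sigma_additive : semi_sigma_additive cons_measure.
Proof.
by apply: pushforward_semi_sigma_additive; exact: measurable_consp.
Qed.

HB.instance Definition _ := isMeasure.Build _ _ _ cons_measure
  cons_measure0 cons_measure_ge0 cons_measure_sigma_additive.

Let cons_measure_sigma_finite : sigma_finite [set: n.+1.-tuple T] cons_measure.
Proof.
apply: (pushforward_sigma_finite
  (g := fun t : n.+1.-tuple T => (thead t, [tuple of behead t]))).
- exact: product_measure1_sigma_finite.
- apply: measurable_fun_pair; first exact: (measurable_tnth ord0).
  exact: measurable_behead.
- by move=> [x t] /=; rewrite theadE; congr pair; exact: val_inj.
Qed.

HB.instance Definition _ := Measure_isSigmaFinite.Build _ _ _ cons_measure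
  cons_measure_sigma_finite.

Lemma integral_cons_measure (f : n.+1.-tuple T -> \bar R) :
  measurable_fun [set: n.+1.-tuple T] f -> (forall t, 0 <= f t) ->
  \int[cons_measure]_t f t = \int[m1]_x \int[m2]_t f [tuple of x :: t].
Proof.
move=> mf f0; rewrite ge0_integral_pushforward//.
rewrite preimage_setT fubini_tonelli1//.
- by apply: measurableT_comp => //; exact: measurable_consp.
- by move=> x; exact: f0.
Qed.

End cons_measure.

Fixpoint prod_measure n : ('I_n -> {sigma_finite_measure set T -> \bar R}) ->
    {sigma_finite_measure set (n.-tuple T) -> \bar R} :=
  if n is n'.+1
  then fun m => cons_measure (m ord0) (prod_measure (fun i => m (lift ord0 i)))
  else fun=> \d_([tuple] : 0.-tuple T).

Lemma integral_prod_measure1 n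
    (m : 'I_n -> {sigma_finite_measure set T -> \bar R})
    (f : 'I_n -> T -> R) :
  (forall i, measurable_fun [set: T] (f i)) -> (forall i x, (0 <= f i x)%R) ->
  (forall i, \int[m i]_x (f i x)%:E = 1) ->
  \int[prod_measure m]_t (\prod_(i < n) f i (tnth t i))%:E = 1.
Proof.
elim: n m f => [|n IH] m f mf f0 f1 /=.
  under eq_integral do rewrite big_ord0.
  by rewrite integral_dirac//= diracT mul1e.
rewrite integral_cons_measure; last 2 first.
- apply/measurable_EFinP; apply: measurable_prod => i _.
  exact: (measurableT_comp (mf i) (measurable_tnth i)).
- by move=> t; rewrite lee_fin prodr_ge0.
rewrite -(f1 ord0); apply: eq_integral => x _.
under eq_integral.
  move=> t _; rewrite big_ord_recl tnth0 EFinM.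
  under eq_bigr do rewrite tnthS.
  over.
rewrite ge0_integralZl_EFin//; last 2 first.
- by move=> t _; rewrite lee_fin prodr_ge0.
- apply/measurable_EFinP; apply: measurable_prod => i _.
  exact: (measurableT_comp (mf _) (measurable_tnth i)).
by rewrite (IH _ (fun i => f (lift ord0 i))) ?mule1.
Qed.

End prod_measure.

Section mx_of_tuple.
Context {R : realType} (m n : nat).

Definition mx_of_tuple (t : (m * n).-tuple R) : 'M[R]_(m, n) :=
  \matrix_(i, j) tnth t (mxvec_index i j).

Let pos (k : 'I_(m * n)) : 'I_m * 'I_n :=
  enum_val (cast_ord (esym (mxvec_cast m n)) k).

Let tuple_of_mx (X : 'M[R]_(m, n)) : (m * n).-tuple R :=
  [tuple X (pos k).1 (pos k).2 | k < m * n].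

Lemma measurable_mx_of_tuple :
  measurable_fun [set: (m * n).-tuple R] mx_of_tuple.
Proof.
apply/measurable_fun_mxP => i j.
rewrite (_ : (fun _ => _) =
    fun t : (m * n).-tuple R => tnth t (mxvec_index i j)).
  exact: measurable_tnth.
by apply/funext => t; rewrite mxE.
Qed.

Definition lebesgue_mx : set 'M[R]_(m, n) -> \bar R :=
  pushforward (prod_measure (fun _ : 'I_(m * n) => @lebesgue_measure R))
    mx_of_tuple.

Let lebesgue_mx0 : lebesgue_mx set0 = 0%E.
Proof. by rewrite /lebesgue_mx /pushforward preimage_set0 measure0. Qed.

Let lebesgue_mx_ge0 A : (0 <= lebesgue_mx A)%E.
Proof. by rewrite /lebesgue_mx /pushforward measure_ge0. Qed.

Let lebesgue_mx_sigma_additive : semi_sigma_additive lebesgue_mx.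
Proof.
by apply: pushforward_semi_sigma_additive; exact: measurable_mx_of_tuple.
Qed.

HB.instance Definition _ := isMeasure.Build _ _ _ lebesgue_mx
  lebesgue_mx0 lebesgue_mx_ge0 lebesgue_mx_sigma_additive.

Let lebesgue_mx_sigma_finite : sigma_finite [set: 'M[R]_(m, n)] lebesgue_mx.
Proof.
apply: (pushforward_sigma_finite (g := tuple_of_mx)).
- exact: (sigma_finiteT (prod_measure (fun=> lebesgue_measure))).
- apply/measurable_fun_tnthP => k.
  rewrite (_ : _ \o _ = fun X : 'M[R]_(m, n) => X (pos k).1 (pos k).2).
    exact: measurable_mx_coord.
  by apply/funext => X /=; rewrite tnth_mktuple.
- move=> t; apply: eq_from_tnth => k; rewrite tnth_mktuple.
  case/mxvec_indexP: k => i j.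
  by rewrite mxE /pos /mxvec_index cast_ordK enum_rankK.
Qed.

HB.instance Definition _ := Measure_isSigmaFinite.Build _ _ _ lebesgue_mx
  lebesgue_mx_sigma_finite.

End mx_of_tuple.

Arguments lebesgue_mx {R m n}.

Section mx_of_rows.
Context {R : realType} (N d : nat).

Definition mx_of_rows (t : N.-tuple 'rV[R]_d) : 'M[R]_(N, d) :=
  \matrix_(k, i) tnth t k 0 i.

Lemma measurable_mx_of_rows :
  measurable_fun [set: N.-tuple 'rV[R]_d] mx_of_rows.
Proof.
apply/measurable_fun_mxP => k i.
rewrite (_ : (fun _ => _) = fun t : N.-tuple 'rV[R]_d => tnth t k 0 i).
  exact: (measurableT_comp (measurable_mx_coord 0 i) (measurable_tnth k)).
by apply/funext => t; rewrite mxE.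
Qed.

(* nu_1 (x) ... (x) nu_N *)
Definition prod_rows (nu : 'I_N -> probability 'rV[R]_d R) :
    set 'M[R]_(N, d) -> \bar R :=
  pushforward (prod_measure (fun k => nu k)) mx_of_rows.

Variable nu : 'I_N -> probability 'rV[R]_d R.

Let prod_rows0 : prod_rows nu set0 = 0%E.
Proof. by rewrite /prod_rows /pushforward preimage_set0 measure0. Qed.

Let prod_rows_ge0 A : (0 <= prod_rows nu A)%E.
Proof. by rewrite /prod_rows /pushforward measure_ge0. Qed.

Let prod_rows_sigma_additive : semi_sigma_additive (prod_rows nu).
Proof.
by apply: pushforward_semi_sigma_additive; exact: measurable_mx_of_rows.
Qed.

HB.instance Definition _ := isMeasure.Build _ _ _ (prod_rows nu)
  prod_rows0 prod_rows_ge0 prod_rows_sigma_additive.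

End mx_of_rows.

Section row_mfun.
Context {R : realType} (N d : nat) (j : 'I_N).

Let measurable_row : measurable_fun [set: 'M[R]_(N, d)] (row j).
Proof.
apply/measurable_fun_mxP => i k.
rewrite (_ : (fun _ => _) = fun X : 'M[R]_(N, d) => X j k).
  exact: measurable_mx_coord.
by apply/funext => X; rewrite mxE.
Qed.

HB.instance Definition _ := isMeasurableFun.Build _ _ 'M[R]_(N, d) 'rV[R]_d
  (row j : 'M[R]_(N, d) -> 'rV[R]_d) measurable_row.

End row_mfun.

Definition marginal {R : realType} N d (mu : probability 'M[R]_(N, d) R)
  (j : 'I_N) : probability 'rV[R]_d R := distribution mu (row j).

Section density_measure.
Local Open Scope ereal_scope.
Context d (T : measurableType d) (R : realType).
Variables (m : {measure set T -> \bar R}) (p : T -> R).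
Hypotheses (mp : measurable_fun [set: T] p) (p0 : forall x, (0 <= p x)%R)
  (p1 : \int[m]_x (p x)%:E = 1).

Definition density_measure of measurable_fun [set: T] p &
    (forall x, (0 <= p x)%R) & \int[m]_x (p x)%:E = 1 :=
  fun A : set T => \int[m]_(x in A) (p x)%:E.

Local Notation nu := (density_measure mp p0 p1).

Let density_measure0 : nu set0 = 0.
Proof. exact: integral_set0. Qed.

Let density_measure_ge0 A : 0 <= nu A.
Proof. by apply: integral_ge0 => x _; rewrite lee_fin. Qed.

Let density_measure_sigma_additive : semi_sigma_additive nu.
Proof.
move=> F mF tF mUF; rewrite /density_measure ge0_integral_bigcup//.
- apply: is_cvg_ereal_nneg_natsum_cond => k _ _.
  by apply: integral_ge0 => x _; rewrite lee_fin.
- by apply/measurable_EFinP; exact: measurable_funTS.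
- by move=> x _; rewrite lee_fin.
Qed.

HB.instance Definition _ := isMeasure.Build _ _ _ nu
  density_measure0 density_measure_ge0 density_measure_sigma_additive.

HB.instance Definition _ := Measure_isProbability.Build _ _ _ nu p1.

End density_measure.

Section mixture.
Local Open Scope ereal_scope.
Context d1 d2 (T1 : measurableType d1) (T2 : measurableType d2) (R : realType).
Variables (P : probability T1 R) (m : {sigma_finite_measure set T2 -> \bar R}).
Variables (K : T1 -> T2 -> R) (C : R).
Hypotheses (mK : measurable_fun [set: T1 * T2] (fun z => K z.1 z.2))
  (K0 : forall x y, (0 <= K x y)%R) (KC : forall x y, (K x y <= C)%R)
  (K1 : forall x, \int[m]_y (K x y)%:E = 1).

Let mEK : measurable_fun [set: T1 * T2] (fun z => (K z.1 z.2)%:E).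
Proof. exact/measurable_EFinP. Qed.

Lemma EFin_mixture y : (\int[P]_x K x y)%R%:E = \int[P]_x (K x y)%:E.
Proof.
rewrite /Rintegral fineK// ge0_fin_numE; last first.
  by apply: integral_ge0 => x _; rewrite lee_fin.
apply: (@le_lt_trans _ _ (\int[P]_x (cst C%:E) x)).
  apply: ge0_le_integral => //.
  - by move=> x _; rewrite lee_fin.
  - have mpair : measurable_fun [set: T1] (fun x : T1 => (x, y)).
      exact: measurable_fun_pair.
    exact: (measurableT_comp mEK mpair).
  - by move=> x _; rewrite lee_fin.
by rewrite integral_cst// [X in _ * X](probability_setT P) mule1 ltry.
Qed.

Lemma measurable_mixture :
  measurable_fun [set: T2] (fun y => \int[P]_x K x y)%R.
Proof.
apply/measurable_EFinP.
rewrite (_ : _ \o _ = fubini_G P (fun z => (K z.1 z.2)%:E)).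
  have E0 z : 0 <= (K z.1 z.2)%:E by rewrite lee_fin.
  exact (measurable_fun_fubini_tonelli_G (m1 := P) _ mEK E0).
by apply/funext => y /=; rewrite EFin_mixture.
Qed.

Lemma mixture_ge0 y : (0 <= \int[P]_x K x y)%R.
Proof. by apply: Rintegral_ge0. Qed.

Lemma integral_mixture : \int[m]_y (\int[P]_x K x y)%R%:E = 1.
Proof.
under eq_integral do rewrite EFin_mixture.
have E0 z : 0 <= (K z.1 z.2)%:E by rewrite lee_fin.
rewrite -(@fubini_tonelli _ _ _ _ _ P m _ mEK E0)/=.
under eq_integral do rewrite K1.
by rewrite integral_cst// [X in _ * X](probability_setT P) mule1.
Qed.

End mixture.

(* eta^eps on R^d; the exponent uses the Euclidean norm *)
Definition heat_kernel {R : realType} d (eps : R) (z : 'rV[R]_d) : R :=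
  (2 * pi * eps) `^ (- (d%:R / 2)) *
  expR (- (\sum_(i < d) z 0 i ^+ 2) / (2 * eps)).

Section heat_kernel_lemmas.
Context {R : realType} (d : nat) (eps : {posnum R}).

Lemma heat_kernelE (x y : 'rV[R]_d) : heat_kernel eps%:num (y - x) =
  \prod_(i < d) normal_pdf (x 0 i) (Num.sqrt eps%:num) (y 0 i).
Proof.
have s0 : Num.sqrt eps%:num != 0 :> R by rewrite gt_eqF// sqrtr_gt0.
under eq_bigr do rewrite normal_pdfE//.
rewrite big_split/= prodr_const card_ord /heat_kernel; congr (_ * _).
  rewrite /normal_peak sqr_sqrtr//.
  have -> : eps%:num * pi *+ 2 = 2 * pi * eps%:num :> R.
    by rewrite -[LHS]mulr_natl -mulrA [pi * _]mulrC.
  have c0 : 0 <= 2 * pi * eps%:num :> R by rewrite !mulr_ge0 ?pi_ge0.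
  rewrite powRN [X in _ `^ X]mulrC powRrM powR12_sqrt//.
  by rewrite powR_mulrn ?sqrtr_ge0// exprVn.
rewrite /normal_fun -expR_sum -big_distrl/= sumrN sqr_sqrtr// mulr_natl.
by congr (expR (- _ / _)); apply: eq_bigr => i _; rewrite !mxE.
Qed.

Lemma heat_kernel_ge0 (z : 'rV[R]_d) : 0 <= heat_kernel eps%:num z.
Proof. by rewrite mulr_ge0 ?powR_ge0 ?expR_ge0. Qed.

Lemma heat_kernel_le (z : 'rV[R]_d) :
  heat_kernel eps%:num z <= (2 * pi * eps%:num) `^ (- (d%:R / 2)).
Proof.
rewrite ler_piMr ?powR_ge0// -[leRHS]expR0 ler_expR mulNr oppr_le0.
by rewrite divr_ge0 ?mulr_ge0// sumr_ge0// => i _; exact: sqr_ge0.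
Qed.

End heat_kernel_lemmas.

Section gaussian_kernel.
Context {R : realType} (N d : nat) (eps : {posnum R}).
Local Notation E := 'M[R]_(N, d).

Let K (X Y : E) : R := \prod_(k < N) heat_kernel eps%:num (row k Y - row k X).

Let KE X Y : K X Y = \prod_(l < N * d)
  normal_pdf (mxvec X 0 l) (Num.sqrt eps%:num) (mxvec Y 0 l).
Proof.
rewrite (reindex _ (curry_mxvec_bij _ _))/= /K.
under [LHS]eq_bigr do rewrite heat_kernelE.
rewrite pair_bigA/=; apply: eq_bigr => -[k i] _ /=.
by rewrite !mxvecE !mxE.
Qed.

Lemma gaussian_kernel_ge0 X Y : 0 <= K X Y.
Proof. by apply: prodr_ge0 => k _; exact: heat_kernel_ge0. Qed.

Lemma gaussian_kernel_le X Y :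
  K X Y <= ((2 * pi * eps%:num) `^ (- (d%:R / 2))) ^+ N.
Proof.
rewrite -[in leRHS](card_ord N) -prodr_const; apply: ler_prod => k _.
by rewrite heat_kernel_ge0 heat_kernel_le.
Qed.

Lemma measurable_gaussian_kernel :
  measurable_fun [set: E * E] (fun Z => K Z.1 Z.2).
Proof.
apply: measurable_prod => k _; apply: measurable_funM => //.
apply: measurableT_comp => //; apply: measurable_funM => //.
apply: measurableT_comp => //; apply: measurable_sum => i.
apply: measurable_funX.
rewrite (_ : (fun _ => _) = fun Z : E * E => Z.2 k i - Z.1 k i); last first.
  by apply/funext => Z; rewrite !mxE.
apply: measurable_funB.
  exact: (measurableT_comp (measurable_mx_coord k i) measurable_snd).
exact: (measurableT_comp (measurable_mx_coord k i) measurable_fst).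
Qed.

Lemma integral_gaussian_kernel X : (\int[lebesgue_mx]_Y (K X Y)%:E = 1)%E.
Proof.
rewrite ge0_integral_pushforward//=; last 3 first.
- exact: measurable_mx_of_tuple.
- apply/measurable_EFinP.
  have mpair : measurable_fun [set: E] (fun Y : E => (X, Y)).
    exact: measurable_fun_pair.
  exact: (measurableT_comp measurable_gaussian_kernel mpair).
- by move=> Y _; rewrite lee_fin gaussian_kernel_ge0.
rewrite preimage_setT.
pose f (l : 'I_(N * d)) y := normal_pdf (mxvec X 0 l) (Num.sqrt eps%:num) y.
rewrite -[RHS](@integral_prod_measure1 _ _ R _ (fun=> lebesgue_measure) f).
- apply: eq_integral => t _ /=; rewrite KE; congr EFin; apply: eq_bigr => l _.
  by case/mxvec_indexP: l => i j; rewrite /f !mxvecE mxE.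
- by move=> l; exact: measurable_normal_pdf.
- by move=> l y; exact: normal_pdf_ge0.
- by move=> l; exact: integral_normal_pdf.
Qed.

End gaussian_kernel.

Section smoothing.
Context {R : realType} (N d : nat) (eps : {posnum R}).

(* the Lebesgue density of Lambda^eps[mu] *)
Definition smoothing_pdf (mu : probability 'M[R]_(N, d) R)
    (Y : 'M[R]_(N, d)) : R :=
  \int[mu]_X \prod_(k < N) heat_kernel eps%:num (row k Y - row k X).

Variable mu : probability 'M[R]_(N, d) R.

Lemma measurable_smoothing_pdf :
  measurable_fun [set: 'M[R]_(N, d)] (smoothing_pdf mu).
Proof.
exact: (measurable_mixture mu (measurable_gaussian_kernel eps)
  (gaussian_kernel_ge0 eps) (gaussian_kernel_le eps)).
Qed.

Lemma smoothing_pdf_ge0 Y : 0 <= smoothing_pdf mu Y.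
Proof. exact: (mixture_ge0 mu (gaussian_kernel_ge0 eps)). Qed.

Lemma integral_smoothing_pdf :
  (\int[lebesgue_mx]_Y (smoothing_pdf mu Y)%:E = 1)%E.
Proof.
exact: (integral_mixture mu (measurable_gaussian_kernel eps)
  (gaussian_kernel_ge0 eps) (gaussian_kernel_le eps)
  (integral_gaussian_kernel eps)).
Qed.

(* Lambda^eps[mu] *)
Definition smoothing : probability 'M[R]_(N, d) R :=
  density_measure measurable_smoothing_pdf smoothing_pdf_ge0
    integral_smoothing_pdf.

End smoothing.

Section heat_conv.
Context {R : realType} (d : nat) (eps : {posnum R}).

(* the Lebesgue density of nu * eta^eps *)
Definition heat_conv_pdf (nu : probability 'rV[R]_d R) (y : 'rV[R]_d) : R :=
  \int[nu]_x heat_kernel eps%:num (y - x).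

Variable nu : probability 'rV[R]_d R.

Let heat_conv_pdfE : heat_conv_pdf nu = smoothing_pdf eps nu.
Proof.
apply/funext => y; congr Rintegral; apply/funext => x.
by rewrite big_ord1 !row_id.
Qed.

Lemma measurable_heat_conv_pdf :
  measurable_fun [set: 'rV[R]_d] (heat_conv_pdf nu).
Proof. by rewrite heat_conv_pdfE; exact: measurable_smoothing_pdf. Qed.

Lemma heat_conv_pdf_ge0 y : 0 <= heat_conv_pdf nu y.
Proof. by rewrite heat_conv_pdfE smoothing_pdf_ge0. Qed.

Lemma integral_heat_conv_pdf :
  (\int[lebesgue_mx]_y (heat_conv_pdf nu y)%:E = 1)%E.
Proof. by rewrite heat_conv_pdfE integral_smoothing_pdf. Qed.

Definition heat_conv : probability 'rV[R]_d R :=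
  density_measure measurable_heat_conv_pdf heat_conv_pdf_ge0
    integral_heat_conv_pdf.

End heat_conv.

Section Theta.
Local Open Scope ereal_scope.
Context {R : realType} (N d : nat) (eps : {posnum R}).

Definition Theta_spec (mu theta : probability 'M[R]_(N, d) R) : Prop :=
  forall psi : 'M[R]_(N, d) -> R, continuous psi -> bounded_fun psi ->
  \int[theta]_X (psi X)%:E =
  \int[smoothing eps mu]_Y \int[prod_rows (marginal mu)]_X
    (psi X * \prod_(k < N) (heat_kernel eps%:num (row k Y - row k X) /
                            heat_conv_pdf eps (marginal mu k) (row k Y)))%R%:E.

(* Theta^eps[mu]: Theta_spec mu determines a unique probability measure, so
   get picks that one. *)
Definition Theta (mu : probability 'M[R]_(N, d) R) :
  probability 'M[R]_(N, d) R := get (Theta_spec mu).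

End Theta.

Section sobolev.
Local Open Scope charge_scope.
Context {R : realType} {m n : nat}.
Local Notation E := 'M[R]_(m, n).
Implicit Types (f g u phi : E -> R) (ij : 'I_m * 'I_n).

Definition partial ij f : E -> R := 'D_(delta_mx ij.1 ij.2) f.

Definition smooth f := forall s : seq ('I_m * 'I_n),
  continuous (foldr partial f s) /\
  forall ij x, derivable (foldr partial f s) x (delta_mx ij.1 ij.2).

Definition test_function f :=
  smooth f /\ compact (closure [set x | f x != 0]).

Definition mx_locally_integrable f :=
  measurable_fun [set: E] f /\
  forall K : set E, compact K -> lebesgue_mx.-integrable K (EFin \o f).

Definition is_weak_partial u ij g :=
  [/\ mx_locally_integrable u, mx_locally_integrable g &
   forall phi, test_function phi ->
     \int[lebesgue_mx]_x (u x * partial ij phi x) =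
     - \int[lebesgue_mx]_x (g x * phi x)].

(* get picks a representative of the weak derivative, which is unique up to
   null sets when it exists. *)
Definition weak_partial u ij : E -> R := get (is_weak_partial u ij).

Definition W12 u :=
  u \in Lfun lebesgue_mx 2%:E /\
  forall ij, exists2 g, g \in Lfun lebesgue_mx 2%:E & is_weak_partial u ij g.

(* fine loses nothing: if mu is dominated by the Lebesgue measure, then the
   library's Radon-Nikodym derivative is finite everywhere. *)
Definition density (mu : probability E R) (x : E) : R :=
  fine ('d (charge_of_finite_measure mu) '/d lebesgue_mx x).

Definition sqrt_density (mu : probability E R) (x : E) : R :=
  Num.sqrt (density mu x).

Definition P12 (mu : probability E R) : Prop :=
  mu `<< lebesgue_mx /\ W12 (sqrt_density mu).

(* The energy is set to +oo outside P12; hence energy mu <= r%:E contains the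
   fact that mu is in P12. *)
Definition energy (mu : probability E R) : \bar R :=
  if `[< P12 mu >] then
    (\int[lebesgue_mx]_x
      (\sum_ij weak_partial (sqrt_density mu) ij x ^+ 2)%:E)%E
  else +oo%E.

Definition row_grad_norm u (j : 'I_m) (x : E) : R :=
  Num.sqrt (\sum_(i < n) weak_partial u (j, i) x ^+ 2).

End sobolev.

Definition Delta {R : realType} N d (eps : {posnum R})
    (mu : probability 'M[R]_(N, d) R) (j : 'I_N) : \bar R :=
  sqrte (energy (marginal mu j) - energy (heat_conv eps (marginal mu j)))%E.

(* Main.v *)
Require Import Defs.
From HB Require Import structures.
From mathcomp Require Import all_boot all_order all_algebra.
From mathcomp Require Import all_classical all_reals all_analysis.
From mathcomp Require Import measurable_realfun ring lra.
Set Implicit Arguments.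
Unset Strict Implicit.
Unset Printing Implicit Defensive.
Import Order.TTheory GRing.Theory Num.Theory.
Import numFieldTopology.Exports numFieldNormedType.Exports.
Local Open Scope classical_set_scope.
Local Open Scope ring_scope.

(** Let m_k be the density of mu_k * eta^eps, Lambda that of the smoothing of mu,
    K(X, Y) the Gaussian kernel on N rows, u_k the root of the density of mu_k and
    w_{k,i} its weak partial derivatives. Exchanging the integrals in the
    definition of Theta shows that Theta has the density
    prod_k u_k(x_k)^2 H(X), where H(X) = int K(X, Y) G(Y) dY and
    G(Y) = Lambda(Y) / prod_k m_k(y_k) ([Theta_density]; smooth bumps that
    approximate indicator functions of boxes show that no other measure satisfies
    the definition). Since Lambda is bounded by a multiple of each m_k, and m_k
    decays hardly faster than the kernel, G grows more slowly than the inverse of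
    the kernel ([likelihood_ratio_le]). Hence H is smooth and positive, and the
    root prod_k u_k(x_k) sqrt H(X) is differentiated by the product rule, checked
    on slices ([is_weak_partial_row_prod]). In the direction of the i-th
    coordinate of the j-th row the derivative is
      prod_(k != j) u_k(x_k) (w_{j,i}(x_j) H + u_j(x_j) dH / 2) / sqrt H.

    Whenever the bracket is written as int K G Phi dY, the Cauchy-Schwarz
    inequality bounds the square of the derivative by
    prod_(k != j) u_k(x_k)^2 int K G Phi^2 dY ([root_theta'_sqr_le]). The integral
    over X of this bound only involves Y and x_j, the other rows being integrated
    out ([tonelli_kernel]). The two inequalities come from two choices of Phi.

    - The first choice is Phi = w_{j,i}(x_j) + u_j(x_j) (y_j - x_j)_i / (2 eps),
      obtained by differentiating the kernel. The cross term vanishes because the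
      kernel is centred, and its variance leaves int w_{j,i}^2 + 1 / (4 eps)
      ([integral_root_theta'_le1]). Summing over i gives c(d) = d / 4.

    - The second choice comes from an integration by parts in Y
      ([mixing'_half_scores]): Phi = u_j(x_j) alpha(Y) + (w_{j,i}(x_j) -
      u_j(x_j) beta(y_j)), where alpha and beta are half of the logarithmic
      derivatives of Lambda and m_j. The square of the first summand integrates
      to int |d sqrt Lambda|^2. The second is a conditional variance, since beta
      is the conditional mean of w_{j,i} / u_j given y_j
      ([gtrans_mul_weak_partial]); it integrates to
      int w_{j,i}^2 - int |d sqrt m_j|^2, the i-th part of Delta_j^2
      ([integral_conditional_gap]). Minkowski's inequality enters as
      (a + b)^2 <= (1 + t) a^2 + (1 + 1/t) b^2 for all t > 0 ([le_sqr_sqrteD]).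

    That beta is this conditional mean means that the derivative of m_j is twice
    the Gaussian transform of u_j w_{j,i}; this follows from the difference
    quotients of u_j, which are averages of w_{j,i} along segments
    ([weak_increment], [gtrans_sqr_derivative]). *)

(** * Boxes and product measures *)

Section boxes.
Context {R : realType} (m n : nat).
Local Notation E := 'M[R]_(m, n).

Definition box (a b : E) : set E := [set X | forall i j, a i j < X i j < b i j].

Definition boxes : set (set E) := [set B | exists a b, B = box a b].

Lemma measurable_rect (A : 'I_m -> 'I_n -> set R) :
  (forall i j, measurable (A i j)) ->
  measurable [set X : E | forall i j, A i j (X i j)].
Proof.
move=> mA.
rewrite (_ : [set _ | _] = \bigcap_(ij in [set: 'I_m * 'I_n])
  ((fun X : E => X ij.1 ij.2) @^-1` A ij.1 ij.2)).
  apply: fin_bigcap_measurable => //= ij _.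
  rewrite -[X in measurable X]setTI.
  exact: (measurable_mx_coord ij.1 ij.2 measurableT (mA _ _)).
by apply/seteqP; split=> [X AX [i j] _ |X AX i j]; [exact: AX|exact: (AX (i, j))].
Qed.

Lemma measurable_box a b : measurable (box a b).
Proof.
rewrite (_ : box a b = [set X | forall i j, `]a i j, b i j[%classic (X i j)]).
  apply: (measurable_rect (A := fun i j => `]a i j, b i j[%classic)) => i j.
  exact: measurable_itv.
by apply/seteqP; split=> X AX i j; have := AX i j; rewrite /= ?in_itv.
Qed.

Lemma ball_box (c : E) (r : R) : 0 < r ->
  ball c r = box (c - const_mx r) (c + const_mx r).
Proof.
move=> r0; apply/seteqP; split=> X.
  move=> [_ cX] i j; have := cX i j; rewrite /ball/= !mxE.
  by rewrite ltr_distl => /andP[? ?]; apply/andP; split; lra.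
move=> bX; split=> // i j; have := bX i j; rewrite /ball/= !mxE.
by move=> /andP[? ?]; rewrite ltr_distl; apply/andP; split; lra.
Qed.

(** The balls of the supremum norm with rational centre and radius 1/(k+1) are
    boxes. *)
Lemma open_bigcup_boxes (U : set E) : open U ->
  exists F : (set E)^nat, (forall k, F k = set0 \/ boxes (F k)) /\
    U = \bigcup_k F k.
Proof.
move=> oU.
pose c (q : 'M[rat]_(m, n) * nat) : E := \matrix_(i, j) ratr (q.1 i j).
pose B (q : 'M[rat]_(m, n) * nat) : set E := ball (c q) (q.2.+1%:R^-1).
pose F k := if (unpickle k : option ('M[rat]_(m, n) * nat)) is Some q
  then (if `[< B q `<=` U >] then B q else set0) else set0.
exists F; split.
  move=> k; rewrite /F; case: unpickle => [q|]; last by left.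
  case: ifP => _; last by left.
  by right; do 2 eexists; rewrite /B ball_box// invr_gt0.
apply/seteqP; split=> [X UX|X [k _]]; last first.
  rewrite /F; case: unpickle => // q; case: ifPn => // /asboolP; apply.
have /nbhs_ballP[e /= e0 eU] : nbhs X U by rewrite nbhsE; exists U => //.
have [k ke] : exists k : nat, k.+1%:R^-1 < e / 2.
  have /ltr_add_invr[k] : 0 < e / 2 by rewrite divr_gt0.
  by rewrite add0r => ?; exists k.
set r : R := k.+1%:R^-1 in ke.
have r0 : 0 < r by rewrite invr_gt0.
have H i j : exists q : rat, ball (ratr q : R) r (X i j).
  have /rat_in_itvoo[q] : X i j - r < X i j + r.
    by rewrite ltrBlDr -addrA ltrDl addr_gt0.
  rewrite in_itv/= => /andP[qa qb]; exists q.
  by rewrite /ball/= /ball_ distrC ltr_distlC qa qb.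
pose q : 'M[rat]_(m, n) * nat := (\matrix_(i, j) sval (cid (H i j)), k).
have Bq : B q X by split=> // i j; rewrite !mxE; case: cid.
exists (pickle q) => //; rewrite /F pickleK ifT//; apply/asboolP => Y qY; apply: eU.
have -> : e = e / 2 + e / 2 by rewrite -splitr.
apply: (@ball_triangle _ _ (c q)).
  by apply: (le_ball (ltW ke)); exact/ball_sym.
exact: (le_ball (ltW ke)).
Qed.

Lemma measurable_boxesE : (@measurable _ E) = <<s boxes >>.
Proof.
apply/seteqP; split=> A.
  apply: smallest_sub; first exact: smallest_sigma_algebra.
  move=> U oU; have [F [FB ->]] := open_bigcup_boxes oU.
  apply: sigma_algebra_bigcup => k.
  by have [->|] := FB k; [exact: sigma_algebra0|exact: sub_sigma_algebra].
apply: smallest_sub; first exact: sigma_algebra_measurable.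
by move=> _ [a [b ->]]; exact: measurable_box.
Qed.

Lemma boxI a b a' b' : box a b `&` box a' b' =
  box (\matrix_(i, j) Num.max (a i j) (a' i j))
      (\matrix_(i, j) Num.min (b i j) (b' i j)).
Proof.
apply/seteqP; split=> X.
  move=> [X1 X2] i j; rewrite !mxE gt_max lt_min.
  by have /andP[-> ->] := X1 i j; have /andP[-> ->] := X2 i j.
move=> XB; split=> i j; have := XB i j; rewrite !mxE gt_max lt_min.
  by move=> /andP[/andP[-> _] /andP[-> _]].
by move=> /andP[/andP[_ ->] /andP[_ ->]].
Qed.

Lemma bigcup_box : \bigcup_k box (const_mx (- k%:R)) (const_mx k%:R) = [set: E].
Proof.
apply/seteqP; split=> // X _.
pose M := \sum_i \sum_j `|X i j|.
have [k kM] : exists k : nat, M < k%:R.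
  by exists (Num.truncn M).+1; exact: truncnS_gt.
exists k => // i j; rewrite !mxE -ltr_norml; apply: le_lt_trans kM.
rewrite /M (bigD1 i)//= (bigD1 j)//= -addrA lerDl addr_ge0//.
  by rewrite sumr_ge0.
by rewrite sumr_ge0// => ? _; rewrite sumr_ge0.
Qed.

(** Boxes are stable under intersection, generate the Borel sets and exhaust the
    space. *)
Lemma measure_eq_box (m1 m2 : {measure set E -> \bar R}) :
  (forall a b, m1 (box a b) = m2 (box a b)) ->
  (forall a b, (m1 (box a b) < +oo)%E) ->
  forall A, measurable A -> m1 A = m2 A.
Proof.
move=> m12 m1oo; move=> A mA; apply: (@measure_unique _ R E boxes
  (fun k => box (const_mx (- k%:R)) (const_mx k%:R)) measurable_boxesE) => //.
- by move=> _ _ [a [b ->]] [a' [b' ->]]; rewrite boxI; do 2 eexists.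
- by move=> k; do 2 eexists.
- exact: bigcup_box.
- by move=> _ [a [b ->]].
Qed.

End boxes.

Section prod_measure_lemmas.
Local Open Scope ereal_scope.
Context d (T : measurableType d) (R : realType).

Lemma emeasurable_prod d' (U : measurableType d') (I : Type) (s : seq I)
    (f : I -> U -> \bar R) :
  (forall i, measurable_fun [set: U] (f i)) ->
  measurable_fun [set: U] (fun u => \prod_(i <- s) f i u).
Proof.
move=> mf; elim: s => [|i s IH].
  by under eq_fun do rewrite big_nil; exact: measurable_cst.
by under eq_fun do rewrite big_cons; exact: emeasurable_funM.
Qed.

Lemma integral_prod_measure n
    (m : 'I_n -> {sigma_finite_measure set T -> \bar R})
    (f : 'I_n -> T -> \bar R) :
  (forall i, measurable_fun [set: T] (f i)) -> (forall i x, 0 <= f i x) ->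
  \int[prod_measure m]_t \prod_(i < n) f i (tnth t i) =
  \prod_(i < n) \int[m i]_x f i x.
Proof.
elim: n m f => [|n IH] m f mf f0 /=.
  under eq_integral do rewrite big_ord0.
  by rewrite integral_dirac//= diracT mul1e big_ord0.
have mft k (g : 'I_k -> T -> \bar R) : (forall i, measurable_fun [set: T] (g i)) ->
    measurable_fun [set: k.-tuple T] (fun t => \prod_(i < k) g i (tnth t i)).
  move=> mg; apply: emeasurable_prod => i.
  exact: (measurableT_comp (mg i) (measurable_tnth i)).
rewrite integral_cons_measure; last 2 first.
- exact: mft.
- by move=> t; apply: prode_ge0.
rewrite big_ord_recl -IH//.
rewrite -ge0_integralZr//; last first.
  by apply: integral_ge0 => t _; apply: prode_ge0.
apply: eq_integral => x _; rewrite -ge0_integralZl//; last 2 first.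
- exact: (mft _ (fun i => f (lift ord0 i))).
- by move=> t _; apply: prode_ge0.
by apply: eq_integral => t _; rewrite big_ord_recl tnth0; congr (_ * _);
  apply: eq_bigr => i _; rewrite tnthS.
Qed.

End prod_measure_lemmas.

(** * Lebesgue measure on matrices *)

Section pushforward_integral.
Local Open Scope ereal_scope.
Context d1 d2 (T1 : measurableType d1) (T2 : measurableType d2) (R : realType).

(** Equality of the measures on sets turns into a change of variables formula. *)
Lemma ge0_integral_image (m : {measure set T1 -> \bar R})
    (m2 : {measure set T2 -> \bar R}) (f : T1 -> T2) :
  measurable_fun [set: T1] f ->
  (forall A, measurable A -> m2 A = pushforward m f A) ->
  forall g : T2 -> \bar R, measurable_fun [set: T2] g -> (forall y, 0 <= g y) ->
  \int[m2]_y g y = \int[m]_x g (f x).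
Proof.
move=> mf m2E g mg g0.
pose F : {mfun T1 >-> T2} := HB.pack f (isMeasurableFun.Build _ _ _ _ _ mf).
rewrite (@eq_measure_integral _ _ _ _ (pushforward m F))//; last first.
  by move=> A mA _; rewrite m2E.
by rewrite ge0_integral_pushforward ?preimage_setT.
Qed.

Lemma integral_image (m : {measure set T1 -> \bar R})
    (m2 : {measure set T2 -> \bar R}) (f : T1 -> T2) :
  measurable_fun [set: T1] f ->
  (forall A, measurable A -> m2 A = pushforward m f A) ->
  forall g : T2 -> \bar R, m2.-integrable [set: T2] g ->
  m.-integrable [set: T1] (g \o f) /\
  \int[m2]_y g y = \int[m]_x g (f x).
Proof.
move=> mf m2E g ig.
have mg := measurable_int _ ig.
pose F : {mfun T1 >-> T2} := HB.pack f (isMeasurableFun.Build _ _ _ _ _ mf).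
have igf : m.-integrable [set: T1] (g \o f).
  apply/integrableP; split; first exact: measurableT_comp.
  move/integrableP : ig => [_].
  rewrite (ge0_integral_image mf m2E (g := fun y => `|g y|))//.
  exact: measurableT_comp.
split=> //.
rewrite (@eq_measure_integral _ _ _ _ (pushforward m F))//; last first.
  by move=> A mA _; rewrite m2E.
by rewrite integral_pushforward ?preimage_setT.
Qed.

End pushforward_integral.

Section lebesgue_coords.
Local Open Scope ereal_scope.
Context {R : realType} (m n : nat).
Local Notation E := 'M[R]_(m, n).
Local Notation L := (@lebesgue_mx R m n).

Lemma integral_lebesgue_mx_prod (f : 'I_m -> 'I_n -> R -> \bar R) :
  (forall i j, measurable_fun [set: R] (f i j)) -> (forall i j x, 0 <= f i j x) ->
  \int[L]_X \prod_i \prod_j f i j (X i j) =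
  \prod_i \prod_j \int[lebesgue_measure]_x f i j x.
Proof.
move=> mf f0; rewrite ge0_integral_pushforward//=; last 3 first.
- exact: measurable_mx_of_tuple.
- apply: emeasurable_prod => i; apply: emeasurable_prod => j.
  exact: (measurableT_comp (mf i j) (measurable_mx_coord i j)).
- by move=> X _; apply: prode_ge0 => i _; apply: prode_ge0.
pose g l : R -> \bar R := let p := enum_val (cast_ord (esym (mxvec_cast m n)) l) in
  f p.1 p.2.
have gE i j : g (mxvec_index i j) = f i j.
  by rewrite /g /mxvec_index cast_ordK enum_rankK.
rewrite preimage_setT pair_bigA/=.
transitivity (\prod_(l < m * n) \int[lebesgue_measure]_x g l x).
  rewrite -(@integral_prod_measure _ _ R _ (fun=> lebesgue_measure))//; last 2 first.
  - by move=> l; exact: mf.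
  - by move=> l x; exact: f0.
  apply: eq_integral => t _ /=.
  rewrite pair_bigA/= [RHS](reindex _ (curry_mxvec_bij _ _))/=.
  by apply: eq_bigr => -[i j] _ /=; rewrite gE mxE.
rewrite (reindex _ (curry_mxvec_bij _ _))/=.
by apply: eq_bigr => -[i j] _ /=; rewrite gE.
Qed.

Lemma indic_box (a b : E) X :
  (\1_(box a b) X)%:E = \prod_i \prod_j (\1_(`]a i j, b i j[) (X i j) : R)%:E.
Proof.
under eq_bigr do rewrite prodEFin; rewrite prodEFin; congr EFin.
rewrite indicE; case: (boolP (X \in box a b)) => [/set_mem XB|/negP XB].
  rewrite big1// => i _; rewrite big1// => j _.
  by rewrite indicE mem_set//= in_itv/=; exact: XB.
have [i [j XN]] : exists i j, ~~ (a i j < X i j < b i j)%R.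
  apply: contrapT => NX; apply: XB; apply/mem_set => i j; apply/negP => /negP h.
  by apply: NX; exists i, j.
rewrite (bigD1 i)//= (bigD1 j)//= indicE memNset/= ?mul0r//.
by rewrite in_itv/=; exact/negP.
Qed.

Lemma lebesgue_mx_box (a b : E) : L (box a b) =
  \prod_i \prod_j lebesgue_measure (`]a i j, b i j[%classic : set R).
Proof.
rewrite -[box a b]setIT -integral_indic ?setIT//; last exact: measurable_box.
under eq_integral do rewrite indic_box.
rewrite (@integral_lebesgue_mx_prod (fun i j x => (\1_(`]a i j, b i j[) x)%:E))//.
- by apply: eq_bigr => i _; apply: eq_bigr => j _; rewrite integral_indic// setIT.
- by move=> i j; apply/measurable_EFinP; exact: measurable_indic.
Qed.

Lemma lebesgue_mx_box_lty (a b : E) : L (box a b) < +oo.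
Proof.
rewrite lebesgue_mx_box -ge0_fin_numE; last by apply: prode_ge0 => i _; apply: prode_ge0.
apply: prode_fin_num => i _; apply: prode_fin_num => j _.
by rewrite lebesgue_measure_itv/=; case: ifP.
Qed.

Lemma measurable_addmx (c : E) : measurable_fun [set: E] (fun X => X + c)%R.
Proof.
apply/measurable_fun_mxP => i j; under eq_fun do rewrite mxE.
by apply: measurable_funD => //; exact: measurable_mx_coord.
Qed.

Lemma lebesgue_mx_translate (c : E) (A : set E) : measurable A ->
  L A = pushforward L (fun X => X + c)%R A.
Proof.
pose F : {mfun E >-> E} := HB.pack (fun X => X + c)%R
  (isMeasurableFun.Build _ _ _ _ _ (measurable_addmx c)).
apply: (measure_eq_box (m1 := L) (m2 := pushforward L F)).
  move=> a b; have FE : F @^-1` box a b = box (a - c)%R (b - c)%R.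
    apply/seteqP; split=> X /= XB i j; have := XB i j; rewrite !mxE => /andP[? ?];
      by apply/andP; split; lra.
  transitivity (L (box (a - c)%R (b - c)%R)); last by rewrite -FE.
  rewrite [LHS]lebesgue_mx_box [RHS]lebesgue_mx_box; apply: eq_bigr => i _; apply: eq_bigr => j _.
  rewrite !lebesgue_measure_itv/= !mxE !lte_fin ltrD2r; case: ifP => // _.
  by rewrite -!EFinB; congr EFin; ring.
by move=> a b; exact: lebesgue_mx_box_lty.
Qed.

Lemma ge0_integral_translate (c : E) (f : E -> \bar R) :
  measurable_fun [set: E] f -> (forall X, 0 <= f X) ->
  \int[L]_X f (X + c)%R = \int[L]_X f X.
Proof.
move=> mf f0; apply/esym; apply: ge0_integral_image => //.
  exact: measurable_addmx.
by move=> A mA; exact: lebesgue_mx_translate.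
Qed.

Lemma integral_translate (c : E) (f : E -> \bar R) :
  L.-integrable [set: E] f ->
  L.-integrable [set: E] (fun X => f (X + c)%R) /\
  \int[L]_X f (X + c)%R = \int[L]_X f X.
Proof.
move=> intf.
have [] := integral_image (measurable_addmx c)
  (fun A mA => lebesgue_mx_translate c mA) intf.
by move=> ? ->.
Qed.

End lebesgue_coords.

Section rows.
Local Open Scope ereal_scope.
Context {R : realType} (N d : nat).
Local Notation E := 'M[R]_(N, d).
Local Notation V := 'rV[R]_d.
Local Notation L := (@lebesgue_mx R N d).
Local Notation L1 := (@lebesgue_mx R 1 d).

Let mor_mfun : {mfun N.-tuple V >-> E} := HB.pack (@mx_of_rows R N d)
  (isMeasurableFun.Build _ _ _ _ _ (@measurable_mx_of_rows R N d)).

Lemma row_mx_of_rows (t : N.-tuple V) k : row k (mx_of_rows t) = tnth t k.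
Proof. by apply/rowP => i; rewrite !mxE. Qed.

Lemma measurable_row (k : 'I_N) : measurable_fun [set: E] (row k).
Proof.
apply/measurable_fun_mxP => i j; under eq_fun do rewrite mxE.
exact: measurable_mx_coord.
Qed.

Lemma integral_rows_prod (nu : 'I_N -> {sigma_finite_measure set V -> \bar R})
    (f : 'I_N -> V -> \bar R) :
  (forall k, measurable_fun [set: V] (f k)) -> (forall k x, 0 <= f k x) ->
  \int[pushforward (prod_measure nu) (@mx_of_rows R N d)]_X
     \prod_k f k (row k X) = \prod_k \int[nu k]_x f k x.
Proof.
move=> mf f0; rewrite ge0_integral_pushforward//=; last 3 first.
- exact: measurable_mx_of_rows.
- by apply: emeasurable_prod => k; exact: (measurableT_comp (mf k) (measurable_row k)).
- by move=> X _; apply: prode_ge0.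
rewrite preimage_setT -integral_prod_measure//; apply: eq_integral => t _ /=.
by apply: eq_bigr => k _; rewrite row_mx_of_rows.
Qed.

Lemma indic_box_rows (a b : E) X :
  (\1_(box a b) X)%:E = \prod_k (\1_(box (row k a) (row k b)) (row k X))%:E :> \bar R.
Proof.
rewrite indic_box; apply: eq_bigr => k _; rewrite indic_box big_ord1.
by apply: eq_bigr => i _; rewrite !mxE.
Qed.

Lemma measurable_indic_box m (a b : 'M[R]_(m, d)) :
  measurable_fun [set: 'M[R]_(m, d)] (fun x => (\1_(box a b) x)%:E : \bar R).
Proof. by apply/measurable_EFinP; apply: measurable_indic; exact: measurable_box. Qed.

Lemma rows_prod_box (nu : 'I_N -> {sigma_finite_measure set V -> \bar R}) (a b : E) :
  pushforward (prod_measure nu) (@mx_of_rows R N d) (box a b) =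
  \prod_k nu k (box (row k a) (row k b)).
Proof.
rewrite -[box a b]setIT -(@integral_indic _ _ _ (pushforward _ mor_mfun)) ?setIT//;
  last exact: measurable_box.
under eq_integral do rewrite indic_box_rows.
rewrite (@integral_rows_prod nu (fun k x => (\1_(box (row k a) (row k b)) x)%:E)).
- by apply: eq_bigr => k _; rewrite integral_indic ?setIT//; exact: measurable_box.
- by move=> k; exact: measurable_indic_box.
- by move=> k x; rewrite lee_fin.
Qed.

Lemma lebesgue_mx_box_rows (a b : E) :
  L (box a b) = \prod_k L1 (box (row k a) (row k b)).
Proof.
rewrite lebesgue_mx_box; apply: eq_bigr => k _; rewrite lebesgue_mx_box big_ord1.
by apply: eq_bigr => i _; rewrite !mxE.
Qed.

(** Both measures give a box the product of the measures of its rows. *)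
Lemma lebesgue_mx_rows (A : set E) : measurable A ->
  L A = pushforward (prod_measure (fun=> L1)) (@mx_of_rows R N d) A.
Proof.
apply: (measure_eq_box (m1 := L)
  (m2 := pushforward (prod_measure (fun=> L1)) mor_mfun)).
  by move=> a b; rewrite [LHS]lebesgue_mx_box_rows [RHS]rows_prod_box.
by move=> a b; exact: lebesgue_mx_box_lty.
Qed.

Lemma integral_lebesgue_rows_prod (f : 'I_N -> V -> \bar R) :
  (forall k, measurable_fun [set: V] (f k)) -> (forall k x, 0 <= f k x) ->
  \int[L]_X \prod_k f k (row k X) = \prod_k \int[L1]_x f k x.
Proof.
move=> mf f0; rewrite (@eq_measure_integral _ _ _ _
  (pushforward (prod_measure (fun=> L1)) mor_mfun))//.
  exact: (@integral_rows_prod (fun=> L1)).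
by move=> A mA _; exact: lebesgue_mx_rows.
Qed.

Definition set_row (X : E) (j : 'I_N) (z : V) : E :=
  \matrix_(k, i) if k == j then z ord0 i else X k i.

Lemma row_set_row X j z k : row k (set_row X j z) = if k == j then z else row k X.
Proof.
by apply/rowP => i; rewrite !mxE; case: ifP => _ //; rewrite mxE.
Qed.

Lemma row_set_row_id X j z : row j (set_row X j z) = z.
Proof. by rewrite row_set_row eqxx. Qed.

(** The j-th factor carries a Dirac mass: the base measure only has to supply the
    other rows, the j-th one being overwritten by set_row. *)
Let base (j k : 'I_N) : {sigma_finite_measure set V -> \bar R} :=
  if k == j then (\d_(0%R : V) : {sigma_finite_measure set V -> \bar R})
  else (L1 : {sigma_finite_measure set V -> \bar R}).

Let resample (j : 'I_N) (tz : N.-tuple V * V) : E :=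
  set_row (mx_of_rows tz.1) j tz.2.

Let measurable_resample j : measurable_fun [set: N.-tuple V * V] (resample j).
Proof.
apply/measurable_fun_mxP => k i.
case: (eqVneq k j) => kj.
  rewrite (_ : (fun _ => _) = fun tz : N.-tuple V * V => tz.2 ord0 i).
    exact: (measurableT_comp (measurable_mx_coord _ i) measurable_snd).
  by apply/funext => tz; rewrite mxE kj eqxx.
rewrite (_ : (fun _ => _) = fun tz : N.-tuple V * V => tnth tz.1 k ord0 i).
  apply: (measurableT_comp (measurable_mx_coord ord0 i)).
  exact: (measurableT_comp (measurable_tnth k) measurable_fst).
by apply/funext => tz; rewrite mxE (negbTE kj) mxE.
Qed.

Let lebesgue_mx_resample j (A : set E) : measurable A ->
  L A = pushforward (prod_measure (base j) \x L1) (resample j) A.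
Proof.
pose F : {mfun (N.-tuple V * V)%type >-> E} := HB.pack (resample j)
  (isMeasurableFun.Build _ _ _ _ _ (@measurable_resample j)).
apply: (measure_eq_box (m1 := L)
  (m2 := pushforward (prod_measure (base j) \x L1) F)).
  2: by move=> a b; exact: lebesgue_mx_box_lty.
move=> a b.
pose B k : set V := box (row k a) (row k b).
pose g k (x : V) : \bar R := if k == j then 1 else (\1_(B k) x)%:E.
have mg k : measurable_fun [set: V] (g k).
  by rewrite /g; case: (k == j); [exact: measurable_cst|exact: measurable_indic_box].
have g0 k x : 0 <= g k x by rewrite /g; case: ifP.
have mG : measurable_fun [set: N.-tuple V] (fun t => \prod_k g k (tnth t k)).
  by apply: emeasurable_prod => k; exact: (measurableT_comp (mg k) (measurable_tnth k)).
have mI : measurable_fun [set: N.-tuple V * V]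
    (fun tz => (\1_(box a b) (resample j tz))%:E : \bar R).
  exact: (measurableT_comp (measurable_indic_box a b) (@measurable_resample j)).
transitivity (\int[pushforward (prod_measure (base j) \x L1) F]_X
    (\1_(box a b) X)%:E); last first.
  by rewrite integral_indic ?setIT//; exact: measurable_box.
rewrite (ge0_integral_pushforward (@measurable_resample j))//=; last first.
  exact: measurable_indic_box.
rewrite preimage_setT fubini_tonelli1//=.
transitivity (\int[prod_measure (base j)]_t ((\prod_k g k (tnth t k)) * L1 (B j))).
  rewrite ge0_integralZr//; last by move=> t _; exact: prode_ge0.
  rewrite integral_prod_measure// lebesgue_mx_box_rows (bigD1 j)//=.
  rewrite [in RHS](bigD1 j)//= muleC; congr (_ * _).
  have -> : \int[base j j]_x g j x = 1.
    rewrite /base eqxx; under eq_integral do rewrite /g eqxx.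
    by rewrite integral_cst// mul1e; exact: diracT.
  rewrite mul1e /base /g.
  apply: eq_bigr => k kj; rewrite (negbTE kj) integral_indic ?setIT//.
  exact: measurable_box.
apply: eq_integral => t _; rewrite /fubini_F.
rewrite -[B j]setIT -integral_indic ?setIT//; last exact: measurable_box.
rewrite -ge0_integralZl//; [|exact: measurable_indic_box|exact: prode_ge0].
apply: eq_integral => z _; rewrite indic_box_rows (bigD1 j)//= [in RHS](bigD1 j)//=.
rewrite row_set_row_id [LHS]muleC {1}/g eqxx mul1e; congr (_ * _).
by apply: eq_bigr => k kj; rewrite /g row_set_row (negbTE kj) row_mx_of_rows.
Qed.

(** Fubini's theorem in the form needed to integrate by parts in one row. *)
Lemma integral_slices_eq0 (j : 'I_N) (F : E -> R) :
  L.-integrable [set: E] (EFin \o F) ->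
  (forall X, \int[L1]_z (F (set_row X j z))%:E = 0) ->
  \int[L]_X (F X)%:E = 0.
Proof.
move=> iF F0.
have [iFr ->] := integral_image (@measurable_resample j)
  (fun A mA => lebesgue_mx_resample j mA) iF.
have := integral12_prod_meas1 iFr; rewrite /fubini_F /= => <-.
by apply: integral0_eq => t _; exact: (F0 (mx_of_rows t)).
Qed.

End rows.

(** * Directional derivatives and smoothness classes *)

Section directional.
Context {R : realType} {V : normedModType R}.
Implicit Types (f g : V -> R) (x v : V).

(** A derivative along v only sees the restriction to a line, which reduces it to
    the calculus of one variable. *)
Lemma is_derive_lineP f x v df :
  is_derive x v f df <-> is_derive (0 : R) 1 (fun t : R => f (t *: v + x)) df.
Proof.
have E : (fun h : R => h^-1 *: ((f \o shift x) (h *: v) - f x)) =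
  (fun h : R => h^-1 *: (((fun t : R => f (t *: v + x)) \o shift 0) (h *: 1)
     - f (0 *: v + x))).
  by apply/funext => h /=; rewrite addr0 scale0r add0r [h *: 1]mulr1.
by split=> -[fx dx]; split; rewrite /derivable /derive ?E// -?E.
Qed.

Lemma is_derive_mul f g x v df dg : is_derive x v f df -> is_derive x v g dg ->
  is_derive x v (fun y => f y * g y) (f x * dg + g x * df).
Proof. exact: is_deriveM. Qed.

(** For functions given by integrals, a second-order remainder is easier to bound
    than the limit of a difference quotient is to compute. *)
Lemma is_derive_quadratic f x v (df C r : R) : 0 < r ->
  (forall h, `|h| < r -> `|f (h *: v + x) - f x - h * df| <= C * h ^+ 2) ->
  is_derive x v f df.
Proof.
move=> r0 HC.
have lim : (fun h : R => h^-1 *: (f (h *: v + x) - f x)) @ 0^' --> df.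
  apply/subr_cvg0.
  apply: (cvg_to_0_linear (k := r) (K := C)) => // h /andP[h0 hr].
  have hn0 : h != 0 by rewrite -normr_gt0.
  rewrite /= (_ : _ - df = h^-1 * (f (h *: v + x) - f x - h * df)); last first.
    by rewrite mulrBr mulKf.
  rewrite normrM normfV mulrC ler_pdivrMr// (le_trans (HC h hr))//.
  by rewrite -mulrA -normrM -expr2 normrX real_normK// num_real.
split; first by apply/cvg_ex; exists df.
exact: (cvg_lim _ lim).
Qed.

Lemma is_derive_add f g x v df dg : is_derive x v f df -> is_derive x v g dg ->
  is_derive x v (fun y => f y + g y) (df + dg).
Proof. exact: is_deriveD. Qed.

Lemma is_derive_pow f x v df l : is_derive x v f df ->
  is_derive x v (fun y => f y ^+ l) (l%:R * f x ^+ l.-1 * df).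
Proof.
move=> dfx; have := is_deriveX l dfx.
by rewrite (_ : f ^+ l = fun y => f y ^+ l)// exprfctE.
Qed.

Lemma is_derive_compR (F : R -> R) f x v a df :
  is_derive (f x) 1 F a -> is_derive x v f df ->
  is_derive x v (fun y => F (f y)) (a * df).
Proof.
move=> dF /is_derive_lineP df'; apply/is_derive_lineP.
apply: (is_derive1_comp (f := F) (g := fun t => f (t *: v + x))) => //.
by rewrite scale0r add0r.
Qed.

End directional.

Lemma is_derive_along {R : realType} {V : normedModType R} (f f' : V -> R) (x v : V) : (forall y, is_derive y v f (f' y)) ->
  forall t : R, is_derive t 1 (fun t : R => f (t *: v + x)) (f' (t *: v + x)).
Proof.
move=> df t; have /is_derive_lineP := df (t *: v + x).
move=> h; apply/(@is_derive_lineP R R).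
rewrite (_ : (fun s => _) = fun t0 : R => f (t0 *: v + (t *: v + x))) //.
by apply/funext => s; rewrite [s *: 1]mulr1 scalerDl addrA.
Qed.

Lemma derivable1_continuous {R : realType} (F : R -> R) (t a : R) :
  is_derive t 1 F a -> {for t, continuous F}.
Proof. by move=> dF; apply: differentiable_continuous; apply/derivable1_diffP. Qed.

Lemma continuous_line {R : realType} {V : normedModType R} (f : V -> R) (v x : V) :
  continuous f -> continuous (fun t : R => f (t *: v + x)).
Proof.
move=> cf t; have c : {for t, continuous (fun t : R => t *: v + x)}.
  exact: (cvgD (cvgZr_tmp cvg_id) (cvg_cst _)).
exact: (continuous_comp c (cf _)).
Qed.

Section smooth_functions.
Context {R : realType} {m n : nat}.
Local Notation E := 'M[R]_(m, n).
Implicit Types (f g : E -> R) (ij : 'I_m * 'I_n).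

Definition mxdir ij : E := delta_mx ij.1 ij.2.

(** The derivatives are witnesses, so that closure properties follow by induction
    on the order. *)
Fixpoint Ck (k : nat) f : Prop := continuous f /\
  match k with
  | 0 => True
  | k'.+1 => forall ij,
      exists2 f' : E -> R, (forall x, is_derive x (mxdir ij) f (f' x)) & Ck k' f'
  end.

Lemma Ck_continuous k f : Ck k f -> continuous f.
Proof. by case: k => [[]|k []]. Qed.

Lemma partialE ij f f' : (forall x, is_derive x (mxdir ij) f (f' x)) ->
  partial ij f = f'.
Proof. by move=> df; apply/funext => x; rewrite /partial; case: (df x). Qed.

Lemma CkS k f : Ck k.+1 f -> Ck k f.
Proof.
elim: k f => [|k IH] f [cf df]; first by split.
by split=> // ij; have [f' ? ?] := df ij; exists f' => //; exact: IH.
Qed.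

Lemma smoothP f : smooth f <-> forall k, Ck k f.
Proof.
split=> [sf k|cf].
  elim: k f sf => [|k IH] f sf; split => //; try exact: (sf [::]).1.
  move=> ij; exists (partial ij f) => [x|].
    by split => //; exact: ((sf [::]).2 ij x).
  apply: IH => s; have := sf (rcons s ij).
  by rewrite foldr_rcons.
move=> s; have : forall k, Ck k (foldr partial f s).
  elim: s => [//|ij s IH] k /=; have [_ /(_ ij) [g dg cg]] := IH k.+1.
  by rewrite (partialE dg).
move: (foldr _ _ _) => g cg; split; first exact: (Ck_continuous (cg 0%N)).
by move=> ij x; have [_ /(_ ij) [h dh _]] := cg 1%N; case: (dh x).
Qed.

Lemma Ck_add k f g : Ck k f -> Ck k g -> Ck k (fun x => f x + g x).
Proof.
elim: k f g => [|k IH] f g [cf df] [cg dg]; split => //; try by move=> x; apply: (@continuousD _ _ _ f g); [exact: cf|exact: cg].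
move=> ij; have [f' df' cf'] := df ij; have [g' dg' cg'] := dg ij.
by exists (fun x => f' x + g' x) => [x|]; [exact: is_derive_add|exact: IH].
Qed.

Lemma Ck_cst k (c : R) : Ck k (fun=> c).
Proof.
elim: k c => [|k IH] c; split => //; try exact: cst_continuous.
by move=> ij; exists (fun=> 0) => // x; exact: is_derive_cst.
Qed.

Lemma Ck_mul k f g : Ck k f -> Ck k g -> Ck k (fun x => f x * g x).
Proof.
elim: k f g => [|k IH] f g Cf Cg; split => //;
  try by move=> x; apply: (@continuousM _ _ f g); [exact: (Ck_continuous Cf)|exact: (Ck_continuous Cg)].
move=> ij; have [f' df' cf'] := Cf.2 ij; have [g' dg' cg'] := Cg.2 ij.
exists (fun x => f x * g' x + g x * f' x) => [x|]; first exact: is_derive_mul.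
by apply: Ck_add; apply: IH => //; exact: CkS.
Qed.

Lemma is_derive_coord (x : E) ij i j :
  is_derive x (mxdir ij) (fun X : E => X i j) ((i == ij.1) && (j == ij.2))%:R.
Proof.
apply/is_derive_lineP.
rewrite (_ : (fun t : R => _) =
    fun t : R => t * ((i == ij.1) && (j == ij.2))%:R + x i j); last first.
  by apply/funext => t; rewrite !mxE.
set c := _%:R; rewrite [X in is_derive _ _ _ X](_ : _ = (0 * 0 + c * 1) + 0); last by ring.
exact: (is_derive_add (is_derive_mul (is_derive_id (0 : R) 1) (is_derive_cst c (0 : R) 1))
  (is_derive_cst (x i j) (0 : R) 1)).
Qed.

Lemma Ck_coord k i j : Ck k (fun X : E => X i j).
Proof.
case: k => [|k]; split => //; try exact: coord_continuous.
move=> ij; exists (fun=> ((i == ij.1) && (j == ij.2))%:R) => [x|]; last exact: Ck_cst.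
exact: is_derive_coord.
Qed.

Lemma Ck_sum k (I : Type) (s : seq I) (f : I -> E -> R) :
  (forall i, Ck k (f i)) -> Ck k (fun x => \sum_(i <- s) f i x).
Proof.
move=> cf; elim: s => [|i s IH].
  by under eq_fun do rewrite big_nil; exact: Ck_cst.
by under eq_fun do rewrite big_cons; exact: Ck_add.
Qed.

Lemma Ck_prod k (I : Type) (s : seq I) (f : I -> E -> R) :
  (forall i, Ck k (f i)) -> Ck k (fun x => \prod_(i <- s) f i x).
Proof.
move=> cf; elim: s => [|i s IH].
  by under eq_fun do rewrite big_nil; exact: Ck_cst.
by under eq_fun do rewrite big_cons; exact: Ck_mul.
Qed.

(** The induction on the order applies to the derivatives of F, hence the family S
    that is closed under differentiation. *)
Lemma Ck_comp (S : (R -> R) -> Prop) (D : set R) :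
  (forall F, S F -> exists2 F', S F' & forall t, D t -> is_derive t 1 F (F' t)) ->
  forall k F f, S F -> (forall x, D (f x)) -> Ck k f -> Ck k (fun x => F (f x)).
Proof.
move=> SD; elim=> [|k IH] F f SF Df Cf; have [F' SF' dF] := SD F SF; split => //;
  try by move=> x; apply: continuous_comp;
    [exact: (Ck_continuous Cf)|exact: (derivable1_continuous (dF _ (Df x)))].
move=> ij; have [f' df' cf'] := Cf.2 ij.
exists (fun x => F' (f x) * f' x) => [x|].
  by apply: is_derive_compR => //; exact: dF.
apply: Ck_mul => //; apply: IH => //; exact: CkS.
Qed.

Lemma is_derive_sqrt (t : R) : 0 < t ->
  is_derive t 1 (@Num.sqrt R) (2 * Num.sqrt t)^-1.
Proof. exact: is_derive1_sqrt. Qed.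

Lemma Ck_sqrt k f : (forall x, 0 < f x) -> Ck k f -> Ck k (fun x => Num.sqrt (f x)).
Proof.
move=> f0.
(* up to constants, the derivatives of sqrt are sqrt t / t^l *)
pose S (F : R -> R) := exists c (l : nat), F = fun t => c * (Num.sqrt t * t^-1 ^+ l).
apply: (Ck_comp (S := S) (D := [set t | 0 < t])) => //; last first.
  by exists 1, 0%N; apply/funext => t; rewrite mul1r expr0 mulr1.
move=> _ [c [l ->]]; exists (fun t => (c * (2^-1 - l%:R)) * (Num.sqrt t * t^-1 ^+ l.+1)).
  by exists (c * (2^-1 - l%:R)), l.+1.
move=> t /= t0.
have tn0 : t != 0 by rewrite gt_eqF.
have di := is_deriveV tn0 (is_derive_id t 1).
apply: (is_derive_eq (is_derive_mul (is_derive_cst c t 1)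
  (is_derive_mul (is_derive_sqrt t0) (is_derive_pow l di)))).
have s0 : Num.sqrt t != 0 by rewrite gt_eqF// sqrtr_gt0.
have -> : (2 * Num.sqrt t)^-1 = Num.sqrt t * t^-1 / 2.
  have tE := sqr_sqrtr (ltW t0); move: s0 tE; set s := Num.sqrt t => s0 <-.
  by field.
rewrite -exprVn [_ *: 1]mulr1.
by case: l => [|l] /=; rewrite !exprS; ring.
Qed.

End smooth_functions.

(** * Smooth bumps *)

Section flat_functions.
Context {R : realType}.
Implicit Types (p : {poly R}) (t : R).

(** The functions p(1/t) exp(-1/t), extended by 0: differentiation only changes the
    polynomial p, so that they are smooth. *)
Definition flat p t : R := if 0 < t then p.[t^-1] * expR (- t^-1) else 0.

(** exp(-1/t) is O(t^l) for every l, in particular for l two more than the order of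
    the pole of p(1/t) at 0. *)
Lemma flat_small p : exists2 C : R, 0 <= C & forall t, 0 < t <= 1 -> `|flat p t| <= C * t ^+ 2.
Proof.
pose A := \sum_(i < size p) `|p`_i|.
pose k := size p.
exists (A * (k.+2)`!%:R); first by rewrite mulr_ge0// sumr_ge0.
move=> t /andP[t0 t1]; rewrite /flat t0.
have s1 : 1 <= t^-1 by rewrite invf_ge1.
have s0 : 0 < t^-1 by rewrite invr_gt0.
have pA : `|p.[t^-1]| <= A * t^-1 ^+ k.
  rewrite horner_coef (le_trans (ler_norm_sum _ _ _))// mulr_suml.
  apply: ler_sum => i _; rewrite normrM ler_wpM2l// ger0_norm; last exact/exprn_ge0/ltW.
  by apply: ler_weXn2l => //; exact/ltnW.
have eA : expR (- t^-1) <= (k.+2)`!%:R * t ^+ k.+2.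
  rewrite expRN -[leRHS]invrK lef_pV2 ?posrE ?expR_gt0//; last first.
    by rewrite invr_gt0 mulr_gt0 ?exprn_gt0// ltr0n fact_gt0.
  rewrite invfM -exprVn mulrC.
  by apply: le_trans (expR_ge1Dxn k.+1 (ltW s0)); rewrite lerDr.
rewrite normrM (ger0_norm (expR_ge0 _)).
apply: (le_trans (ler_pM _ _ pA eA)); rewrite ?expR_ge0//.
rewrite mulrACA (_ : t^-1 ^+ k * t ^+ k.+2 = t ^+ 2)//.
by rewrite -addn2 exprD mulrA -exprMn mulVf ?gt_eqF// expr1n mul1r.
Qed.

Lemma is_derive_flat p t :
  is_derive t 1 (flat p) (flat ((p - p^`()) * 'X^2) t).
Proof.
have [t0|t0|t0] := ltrgtP t 0.
- rewrite {2}/flat ltNge ltW//=.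
  apply: (near_eq_is_derive (f := fun=> 0)).
  by near=> s; rewrite /flat ltNge ltW//; near: s; exact: lt_nbhsl.
- have tn0 : t != 0 by rewrite gt_eqF.
  have di := is_deriveV tn0 (is_derive_id t 1).
  have dp := is_derive_compR (is_derive_poly p t^-1) di.
  have de := is_derive_compR (F := expR) (f := fun s : R => - s^-1)
    (is_derive_expR (- t^-1)) (is_deriveN di).
  have D := is_derive_mul dp de.
  apply: (near_eq_is_derive _ (is_derive_eq D _)).
    by near=> s; rewrite /flat ifT//; near: s; exact: lt_nbhsr.
  rewrite /flat t0 !hornerE /= [_ *: 1]mulr1 -exprVn; ring.
- rewrite t0 {2}/flat ltxx.
  have [C C0 HC] := flat_small p.
  have f0 : flat p 0 = 0 by rewrite /flat ltxx.
  apply: (is_derive_quadratic (V := R) (C := C) (r := 1)) => // h h1.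
  rewrite addr0 [h *: 1]mulr1 f0 mulr0 !subr0.
  have [h0|h0] := ltP 0 h; first by apply: HC; rewrite h0 ltW// -(ger0_norm (ltW h0)).
  by rewrite /flat ltNge h0/= normr0 mulr_ge0// sqr_ge0.
Unshelve. all: by end_near. Qed.

Lemma flat1_ge0 t : 0 <= flat 1 t.
Proof. by rewrite /flat; case: ifP => // _; rewrite hornerC mul1r expR_ge0. Qed.

Lemma flat1_le1 t : flat 1 t <= 1.
Proof.
rewrite /flat; case: ifP => [t0|//]; rewrite hornerC mul1r -[leRHS]expR0 ler_expR.
by rewrite oppr_le0 invr_ge0 ltW.
Qed.

Lemma cvg_flat1 t : (fun k => flat 1 (k.+1%:R * t)) @ \oo --> ((0 < t)%R%:R : R).
Proof.
case: ltP => t0.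
  rewrite (_ : (fun k => _) = (fun k => expR (- (t^-1 * k.+1%:R^-1)))).
    rewrite -[X in _ --> X]expR0 -oppr0 -(mulr0 t^-1).
    apply: continuous_cvg; first exact: continuous_expR.
    by apply: cvgN; apply: cvgMr; exact: cvg_harmonic.
  apply/funext => k; rewrite /flat pmulr_rgt0// t0 hornerC mul1r.
  by rewrite invfM mulrC.
rewrite (_ : (fun k => _) = fun=> 0); first exact: cvg_cst.
by apply/funext => k; rewrite /flat pmulr_rgt0// ltNge t0.
Qed.

End flat_functions.

Section matrix_topology.
Context {R : realType} {m n : nat}.
Local Notation E := 'M[R]_(m, n).

Lemma cvg_mxP (T : Type) (F : set_system T) {FF : Filter F} (f : T -> E) (X : E) :
  (forall i j, (fun t => f t i j) @ F --> X i j) -> f @ F --> X.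
Proof.
move=> fX A [P PX PA]; rewrite /nbhs/=.
have : \forall t \near F, forall ij : 'I_m * 'I_n, P ij.1 ij.2 (f t ij.1 ij.2).
  by apply: filter_forall => -[i j] /=; exact: (fX i j _ (PX i j)).
by apply: filterS => t H; apply: PA => i j; exact: (H (i, j)).
Qed.

Lemma compact_box (a b : E) : compact [set X : E | forall i j, a i j <= X i j <= b i j].
Proof.
pose K : set 'rV[R]_(m * n) := [set v | forall l, `[mxvec a 0 l, mxvec b 0 l]%classic (v ord0 l)].
have cK : compact K.
  apply: (rV_compact (A := fun l => `[mxvec a 0 l, mxvec b 0 l]%classic)) => l.
  exact: segment_compact.
rewrite (_ : [set _ | _] = vec_mx @` K).
  apply: continuous_compact => //; apply: continuous_subspaceT => v.
  apply: (@cvg_mxP _ (nbhs v)) => i j.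
  rewrite (_ : (fun _ => _) = fun v : 'rV[R]_(m * n) => v 0 (mxvec_index i j)).
    by rewrite mxE; exact: coord_continuous.
  by apply/funext => w; rewrite mxE.
apply/seteqP; split=> [X aXb|_ [v Kv <-] i j].
  exists (mxvec X); last exact: mxvecK.
  by move=> l; case/mxvec_indexP: l => i j; rewrite /= !mxvecE in_itv/=.
by have := Kv (mxvec_index i j); rewrite /= !mxvecE in_itv/= mxE.
Qed.

Lemma compact_subset_box (K : set E) : compact K ->
  exists a b : E, (forall i j, a i j < b i j) /\ K `<=` box a b.
Proof.
move=> /compact_bounded [M [_ HM]].
pose B := `|M| + 1.
have MB : M < B by rewrite /B (le_lt_trans (ler_norm M))// ltrDl.
exists (const_mx (- (B + 1))), (const_mx (B + 1)); split.
  by move=> i j; rewrite !mxE /B; have := normr_ge0 M; lra.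
move=> X KX i j; rewrite !mxE -ltr_norml.
apply: (@le_lt_trans _ _ `|X|); last first.
  by rewrite (le_lt_trans (HM B MB X KX))// ltrDl.
rewrite (_ : `|X| = mx_norm X)// mx_normrE.
by apply: (le_bigmax _ (fun ij : 'I_m * 'I_n => `|X ij.1 ij.2|) (i, j)).
Qed.

Lemma measurable_continuous (f : E -> R) : continuous f -> measurable_fun [set: E] f.
Proof.
move=> cf; apply: (measurability _ (RGenOpens.measurableE R)).
move=> _ [_ [a [b ->]] <-]; rewrite setTI; apply: measurable_mx_open.
by apply: open_comp; [move=> X _; exact: cf|exact: interval_open].
Qed.

Lemma closed_mx_compact (K : set E) : compact K -> closed K.
Proof. by apply: compact_closed; exact: norm_hausdorff. Qed.

Lemma test_functionW (f : E -> R) (K : set E) : (forall k, Ck k f) -> compact K ->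
  (forall X, f X != 0 -> K X) -> test_function f.
Proof.
move=> sf cK fK; split; first exact/smoothP.
apply: (subclosed_compact _ cK); first exact: closed_closure.
have cl : closed K := closed_mx_compact cK.
by rewrite [X in _ `<=` X](closure_id K).1//; exact: closure_subset.
Qed.

End matrix_topology.

Section bump.
Context {R : realType} {m n : nat}.
Local Notation E := 'M[R]_(m, n).

(** When a < b, the argument of flat is positive exactly for the coordinates that
    lie between their bounds, and then tends to infinity with k. *)
Definition bump (a b : E) (k : nat) (X : E) : R :=
  \prod_i \prod_j flat 1 (k.+1%:R * ((X i j - a i j) * (b i j - X i j))).

Lemma bump_ge0 a b k X : 0 <= bump a b k X.
Proof. by apply: prodr_ge0 => i _; apply: prodr_ge0 => j _; exact: flat1_ge0. Qed.

Lemma prodr_le1 (I : finType) (f : I -> R) :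
  (forall i, 0 <= f i <= 1) -> \prod_i f i <= 1.
Proof.
move=> f01; rewrite -[leRHS](@big1_eq _ 1 *%R I (index_enum I) predT).
by apply: ler_prod => i _; exact: f01.
Qed.

Lemma bump_le1 a b k X : bump a b k X <= 1.
Proof.
apply: prodr_le1 => i; rewrite prodr_ge0/= => [|j _]; last exact: flat1_ge0.
by apply: prodr_le1 => j; rewrite flat1_ge0 flat1_le1.
Qed.

Lemma Ck_bump a b k l : Ck l (bump a b k).
Proof.
apply: Ck_prod => i; apply: Ck_prod => j.
apply: (Ck_comp (S := [set flat p | p in [set: {poly R}]]) (D := setT)).
- move=> _ [p _ <-]; exists (flat ((p - p^`()) * 'X^2)); first by exists ((p - p^`()) * 'X^2).
  by move=> t _; exact: is_derive_flat.
- by exists 1.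
- by [].
apply: Ck_mul; first exact: Ck_cst.
by apply: Ck_mul; apply: Ck_add; [exact: Ck_coord|exact: Ck_cst|exact: Ck_cst|
  under eq_fun do rewrite -mulN1r; apply: Ck_mul; [exact: Ck_cst|exact: Ck_coord]].
Qed.

Lemma bump_neq0_box (a b X : E) k : (forall i j, a i j < b i j) ->
  bump a b k X != 0 -> box a b X.
Proof.
move=> ab bX i j; apply: contraNT bX => Xij.
rewrite /bump (bigD1 i)//= (bigD1 j)//=.
suff -> : flat 1 (k.+1%:R * ((X i j - a i j) * (b i j - X i j))) = 0 by rewrite !mul0r.
rewrite /flat pmulr_rgt0// ifF//; apply/negbTE; rewrite -leNgt.
have := ab i j; move: Xij; rewrite negb_and -!leNgt => /orP[h|h] abij.
  by rewrite mulr_le0_ge0; lra.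
by rewrite mulr_ge0_le0; lra.
Qed.

Lemma test_function_bump (a b : E) k : (forall i j, a i j < b i j) ->
  test_function (bump a b k).
Proof.
move=> ab; apply: (test_functionW (Ck_bump a b k) (@compact_box R m n a b)).
move=> X /(bump_neq0_box ab) aXb i j.
by have /andP[/ltW -> /ltW ->] := aXb i j.
Qed.

Lemma cvg_bump (a b X : E) : (forall i j, a i j < b i j) ->
  bump a b ^~ X @ \oo --> (\1_(box a b) X : R).
Proof.
move=> ab.
have -> : (\1_(box a b) X : R) = \prod_i \prod_j
    (0 < (X i j - a i j) * (b i j - X i j))%R%:R.
  have E i j : (0 < (X i j - a i j) * (b i j - X i j))%R%:R = \1_(`]a i j, b i j[) (X i j) :> R.
    rewrite indicE; congr (nat_of_bool _)%:R; rewrite mem_setE in_itv/=.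
    have := ab i j; case: (ltP (a i j) (X i j)) => /= [h1|h1] h2.
      by rewrite pmulr_rgt0 subr_gt0.
    by apply/negbTE; rewrite -leNgt mulr_le0_ge0; lra.
  under eq_bigr do under eq_bigr do rewrite E.
  have := indic_box a b X; under [X in _ = X -> _]eq_bigr do rewrite prodEFin.
  by rewrite prodEFin => -[].
have mulc : continuous (fun z : R * R => z.1 * z.2) := @mul_continuous R.
apply: (cvg_big mulc) => i _; apply: (cvg_big mulc) => j _.
exact: cvg_flat1.
Qed.

End bump.

(** * The integral of a derivative *)

Section fubini_itv.
Local Open Scope ereal_scope.
Context d (T : measurableType d) (R : realType).
Variable mu : {sigma_finite_measure set T -> \bar R}.
Local Notation leb := (@lebesgue_measure R).

Lemma fubini_itv (a b : R) (F : T -> R -> R) :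
  measurable_fun [set: T * R] (fun z => F z.1 z.2) ->
  \int[leb]_(t in `[a, b]) \int[mu]_x `|(F x t)%:E| < +oo ->
  [/\ mu.-integrable [set: T] (fun x => \int[leb]_(t in `[a, b]) (F x t)%:E),
    leb.-integrable `[a, b] (fun t => \int[mu]_x (F x t)%:E) &
    \int[mu]_x \int[leb]_(t in `[a, b]) (F x t)%:E =
    \int[leb]_(t in `[a, b]) \int[mu]_x (F x t)%:E].
Proof.
move=> mF Foo; set D := `[a, b]%classic in Foo *.
have mD : measurable D by exact: measurable_itv.
pose G (z : T * R) := (F z.1 z.2 * \1_D z.2)%:E.
have mI : measurable_fun [set: T * R] (fun z => \1_D z.2 : R).
  apply: (measurableT_comp (f := \1_D : R -> R)); last exact: measurable_snd.
  exact: measurable_indic.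
have mG : measurable_fun [set: T * R] G.
  by apply/measurable_EFinP; exact: measurable_funM.
have iG : (mu \x leb).-integrable [set: T * R] G.
  apply/(integrable21ltyP mu leb mG); apply: le_lt_trans Foo.
  rewrite [leRHS]integral_mkcond le_eqVlt; apply/orP; left; apply/eqP.
  apply: eq_integral => t _; rewrite patchE /G /=.
  case: ifPn => tD.
    by apply: eq_integral => x _; rewrite indicE tD mulr1.
  by apply: integral0_eq => x _; rewrite indicE (negbTE tD) mulr0 /= normr0.
have FE x : \int[leb]_(t in D) (F x t)%:E = fubini_F leb G x.
  rewrite integral_mkcond epatch_indic; apply: eq_integral => t _.
  by rewrite /G EFinM.
have GD t : t \in D -> fubini_G mu G t = \int[mu]_x (F x t)%:E.
  by move=> tD; apply: eq_integral => x _; rewrite /G /= indicE tD mulr1.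
split.
- by rewrite (_ : (fun x => _) = fubini_F leb G); [exact: integrable_fubini_F|exact/funext].
- have mFt t : measurable_fun [set: T] (fun x => (F x t)%:E).
    have mp : measurable_fun [set: T] (fun x : T => (x, t)) by exact: measurable_fun_pair.
    by apply/measurable_EFinP; exact: (measurableT_comp mF mp).
  have mGD : measurable_fun D (fun t => \int[mu]_x (F x t)%:E).
    apply: (eq_measurable_fun (fubini_G mu G)) => //.
    by apply: measurable_funTS; exact: (measurable_fubini_G iG).
  apply/integrableP; split => //; apply: le_lt_trans Foo.
  apply: ge0_le_integral => //; first exact: measurableT_comp.
  + have mA : measurable_fun [set: T * R] (fun z => `|(F z.1 z.2)%:E|).
      by apply: measurableT_comp => //; exact/measurable_EFinP.
    apply: measurable_funTS.
    exact: (measurable_fun_fubini_tonelli_G (m1 := mu) (fun z => `|(F z.1 z.2)%:E|) mA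
      (fun z => abse_ge0 _)).
  + by move=> t tD; exact: le_abse_integral.
under eq_integral do rewrite FE.
rewrite integral12_prod_meas1// -integral21_prod_meas1// [RHS]integral_mkcond.
apply: eq_integral => t _; rewrite patchE /fubini_G /G /=; case: ifPn => tD.
  by apply: eq_integral => x _; rewrite indicE tD mulr1.
by apply: integral0_eq => x _; rewrite indicE (negbTE tD) mulr0.
Qed.

End fubini_itv.

Lemma integral_derivative_itv (R : realType) (F F' : R -> R) (h : R) : 0 < h ->
  (forall t : R, is_derive t 1 F (F' t)) -> continuous F' ->
  (\int[lebesgue_measure]_(t in `[0%R, h]) (F' t)%:E = (F h - F 0)%:E)%E.
Proof.
move=> h0 dF cF; have cont t : {for t, continuous F} := derivable1_continuous (dF t).
rewrite EFinB; apply: continuous_FTC2 => //.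
- exact: continuous_subspaceT.
- split.
  + by move=> t _; case: (dF t).
  + by apply: cvg_at_right_filter; exact: cont.
  + by apply: cvg_at_left_filter; exact: cont.
- by move=> t _; rewrite derive1E; case: (dF t).
Qed.

Section integration_by_parts.
Context {R : realType} {m n : nat}.
Local Notation E := 'M[R]_(m, n).
Local Notation L := (@lebesgue_mx R m n).

Lemma measurable_shift_dir (v : E) :
  measurable_fun [set: E * R] (fun z : E * R => z.2 *: v + z.1).
Proof.
apply/measurable_fun_mxP => i j; under eq_fun do rewrite !mxE.
apply: measurable_funD; last exact: (measurableT_comp (measurable_mx_coord i j) measurable_fst).
by apply: measurable_funM => //; exact: measurable_snd.
Qed.

(** The integral over X of f(X + v) - f(X) vanishes by translation invariance, and
    it is also that of f' over X and over the segment from X to X + v. *)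
Lemma integral_derivative_eq0 (v : E) (f f' : E -> R) :
  (forall X, is_derive X v f (f' X)) -> (forall X, continuous (fun t : R => f' (t *: v + X))) ->
  L.-integrable [set: E] (EFin \o f) -> L.-integrable [set: E] (EFin \o f') ->
  (\int[L]_X (f' X)%:E = 0)%E.
Proof.
move=> df cf' intf intf'.
have mf' : measurable_fun [set: E] f' by apply/measurable_EFinP; exact: measurable_int intf'.
have tr (g : E -> \bar R) X c : g (c + X) = (fun Y => g (Y + c)) X by rewrite addrC.
have leb01 : (lebesgue_measure (`[0%R, 1%R]%classic : set R) = 1)%E.
  by rewrite lebesgue_measure_itv/= lte_fin ltr01 oppr0 adde0.
have [] := @fubini_itv _ _ R L 0 1 (fun X t => f' (t *: v + X)).
- exact: (measurableT_comp mf' (measurable_shift_dir v)).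
- have -> : (\int[lebesgue_measure]_(t in `[0%R, 1%R]) \int[L]_X `|(f' (t *: v + X))%:E| =
      \int[lebesgue_measure]_(t in `[0%R, 1%R]) \int[L]_X `|(f' X)%:E|)%E.
    apply: eq_integral => t _.
    under eq_integral do rewrite addrC.
    apply: (ge0_integral_translate _ (f := fun X => `|(f' X)%:E|%E)) => //.
    by apply: measurableT_comp => //; exact: measurable_int intf'.
  have -> : (\int[L]_X `|(f' X)%:E| = (fine (\int[L]_X `|(f' X)%:E|))%:E)%E.
    rewrite fineK// ge0_fin_numE; last exact: integral_ge0.
    by have /integrableP[] := intf'.
  by rewrite integral_cst// [X in (_ * X)%E]leb01 mule1 ltry.
move=> _ _; have -> : (\int[lebesgue_measure]_(t in `[0%R, 1%R]) \int[L]_X (f' (t *: v + X))%:E =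
    \int[L]_X (f' X)%:E)%E.
  have [_ <-] := integral_translate 0 intf'.
  transitivity (\int[lebesgue_measure]_(t in `[0%R, 1%R]) (\int[L]_X (f' X)%:E))%E.
    apply: eq_integral => t _; under eq_integral do rewrite addrC.
    by have [_ ->] := integral_translate (t *: v) intf'.
  have -> : (\int[L]_X (f' X)%:E = (fine (\int[L]_X (f' X)%:E))%:E)%E.
    by rewrite fineK//; exact: (integrable_fin_num _ intf').
  rewrite integral_cst// [X in (_ * X)%E]leb01 mule1.
  by have [_ ->] := integral_translate 0 intf'; rewrite fineK//; exact: (integrable_fin_num _ intf').
move=> <-.
transitivity (\int[L]_X ((f (X + v))%:E - (f X)%:E))%E.
  apply: eq_integral => X _.
  rewrite (@integral_derivative_itv R (fun t => f (t *: v + X))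
    (fun t => f' (t *: v + X)) 1 ltr01 (is_derive_along X df) (cf' X)).
  by rewrite scale1r scale0r add0r [v + X]addrC EFinB.
have [iv Ev] := integral_translate v intf.
by rewrite integralB// [X in (X - _)%E]Ev subee// (integrable_fin_num _ intf).
Qed.

End integration_by_parts.

(** * Local integrability and the fundamental lemma *)

Section weighted_measure.
Local Open Scope ereal_scope.
Context d (T : measurableType d) (R : realType).
Variables (mu : {measure set T -> \bar R}) (f : T -> \bar R).

Definition weighted of measurable_fun [set: T] f & (forall x, 0 <= f x) :=
  fun A : set T => \int[mu]_(x in A) f x.

Hypotheses (mf : measurable_fun [set: T] f) (f0 : forall x, 0 <= f x).

Let weighted0 : weighted mf f0 set0 = 0.
Proof. exact: integral_set0. Qed.

Let weighted_ge0 A : 0 <= weighted mf f0 A.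
Proof. by apply: integral_ge0. Qed.

Let weighted_sigma_additive : semi_sigma_additive (weighted mf f0).
Proof.
move=> F mF tF mUF; rewrite /weighted ge0_integral_bigcup//.
- by apply: is_cvg_ereal_nneg_natsum_cond => k _ _; exact: integral_ge0.
- exact: measurable_funTS.
Qed.

HB.instance Definition _ := isMeasure.Build _ _ _ (weighted mf f0)
  weighted0 weighted_ge0 weighted_sigma_additive.

End weighted_measure.

Section local_integrability.
Context {R : realType} {m n : nat}.
Local Notation E := 'M[R]_(m, n).
Local Notation L := (@lebesgue_mx R m n).
Implicit Types (f g : E -> R) (K : set E).

Lemma measurable_compact K : compact K -> measurable K.
Proof.
move=> cK; rewrite -(setCK K); apply: measurableC; apply: measurable_mx_open.
by apply: closed_openC; exact: closed_mx_compact.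
Qed.

Lemma lebesgue_compact_lty K : compact K -> (L K < +oo)%E.
Proof.
move=> cK; have [a [b [_ Kab]]] := compact_subset_box cK.
apply: le_lt_trans (lebesgue_mx_box_lty a b); apply: le_measure => //.
  by rewrite inE; exact: measurable_compact.
by rewrite inE; exact: measurable_box.
Qed.

Lemma continuous_compact_bounded K f : compact K -> continuous f ->
  exists M, forall X, K X -> `|f X| <= M.
Proof.
move=> cK cf.
have /compact_bounded [M [_ HM]] : compact (f @` K).
  by apply: continuous_compact => //; exact: continuous_subspaceT.
exists (M + 1) => X KX; apply: (HM (M + 1)); first by rewrite ltrDl.
by exists X.
Qed.

Lemma integrable_le d (T : measurableType d) (mu : {measure set T -> \bar R})
    (f g : T -> R) :
  measurable_fun [set: T] f -> (forall x, `|f x| <= g x) ->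
  mu.-integrable [set: T] (EFin \o g) -> mu.-integrable [set: T] (EFin \o f).
Proof.
move=> mf fg; apply: le_integrable => //; first exact/measurable_EFinP.
by move=> x _; rewrite lee_fin (le_trans (fg x))// ler_norm.
Qed.

Lemma integrable_bounded_compact K f M : compact K -> measurable_fun [set: E] f ->
  (forall X, K X -> `|f X| <= M) -> L.-integrable K (EFin \o f).
Proof.
move=> cK mf fM; have mK := measurable_compact cK.
apply/integrableP; split; first by apply/measurable_EFinP; exact: measurable_funTS.
apply: (@le_lt_trans _ _ (\int[L]_(x in K) (cst `|M|%:E x))%E).
  apply: ge0_le_integral => //.
  - by apply: measurableT_comp => //; apply/measurable_EFinP; exact: measurable_funTS.
  - by move=> X KX; rewrite lee_fin (le_trans (fM X KX))// ler_norm.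
by rewrite integral_cst// lte_mul_pinfty//; exact: lebesgue_compact_lty.
Qed.

Lemma integrable_supported K (f : E -> R) : measurable K ->
  L.-integrable K (EFin \o f) -> (forall X, ~ K X -> f X = 0) ->
  L.-integrable [set: E] (EFin \o f).
Proof.
move=> mK iK f0; rewrite (_ : EFin \o f = (EFin \o f) \_ K); first exact: (proj1 (integrable_mkcond _ mK)).
apply/funext => X; rewrite patchE; case: ifPn => // /negP XK.
by rewrite /= f0// => KX; apply: XK; exact/mem_set.
Qed.

Lemma continuous_locally_integrable f : continuous f -> mx_locally_integrable f.
Proof.
move=> cf; split; first exact: measurable_continuous.
move=> K cK; have [M HM] := continuous_compact_bounded cK cf.
exact: (integrable_bounded_compact cK (measurable_continuous cf) HM).
Qed.

Lemma test_functionE phi : test_function phi ->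
  [/\ continuous phi, forall k, Ck k phi & exists2 K : set E, compact K &
    forall X, ~ K X -> phi X = 0].
Proof.
move=> [/smoothP sp cp]; split=> //; first exact: (Ck_continuous (sp 0%N)).
exists (closure [set x | phi x != 0]) => // X NX; apply/eqP; apply: contrapT => /negP h.
by apply: NX; exact: subset_closure.
Qed.

Lemma test_function_partial phi ij : test_function phi ->
  [/\ (forall X, is_derive X (mxdir ij) phi (partial ij phi X)),
    continuous (partial ij phi) &
    exists2 K : set E, compact K & forall X, ~ K X -> phi X = 0 /\ partial ij phi X = 0].
Proof.
move=> tp; have [cp sp [K cK K0]] := test_functionE tp.
have [_ /(_ ij) [p dp cdp]] := sp 1%N; rewrite (partialE dp).
split; [exact: dp|exact: (@Ck_continuous _ _ _ 0%N p cdp)|].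
exists K => // X NX; split; first exact: K0.
have oN : open (~` K) by apply: closed_openC; exact: closed_mx_compact.
have [_ <-] := dp X.
rewrite (@near_eq_derive _ _ _ phi (fun=> 0)).
  exact: derive_cst.
have : nbhs X (~` K) by apply: open_nbhs_nbhs; split.
by apply: filterS => Y /K0.
Qed.

Lemma integrable_loc_mul g phi K : mx_locally_integrable g -> continuous phi ->
  compact K -> (forall X, ~ K X -> phi X = 0) ->
  L.-integrable [set: E] (fun X => (g X * phi X)%:E).
Proof.
move=> [mg ig] cp cK K0; have mK := measurable_compact cK.
have [M HM] := continuous_compact_bounded cK cp.
apply: (@integrable_supported K (fun X => g X * phi X)) => //; last first.
  by move=> X /K0 ->; rewrite mulr0.
apply: (@le_integrable _ _ _ L K mK _ (fun X => `|M|%:E * (g X)%:E)%E) => //.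
- apply/measurable_EFinP/measurable_funM; apply: measurable_funTS => //.
  exact: measurable_continuous.
- move=> X KX; rewrite -EFinM lee_fin !normrM mulrC normr_id ler_wpM2r//.
  by rewrite (le_trans (HM X KX))// ler_norm.
- exact/integrableZl/ig.
Qed.

Lemma Rintegral_eq0 d (T : measurableType d) (mu : {measure set T -> \bar R}) (f : T -> R) :
  mu.-integrable [set: T] (EFin \o f) -> (\int[mu]_x f x = 0)%R ->
  (\int[mu]_x (f x)%:E = 0)%E.
Proof.
by move=> intf f0; rewrite -(fineK (integrable_fin_num _ intf))//; congr EFin.
Qed.

Let box_integral_eq0 g : mx_locally_integrable g ->
  (forall phi, test_function phi -> (\int[L]_x (g x * phi x) = 0)%R) ->
  forall a b, (\int[L]_(x in box a b) (g x)%:E = 0)%E.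
Proof.
move=> lg g0 a b.
case: (pselect (forall i j, a i j < b i j)) => [ab|nab]; last first.
  rewrite (_ : box a b = set0) ?integral_set0// -subset0 => X aXb; apply: nab => i j.
  by have /andP[] := aXb i j; exact: lt_trans.
have [mg ig] := lg.
have mB : measurable (box a b) := measurable_box a b.
have cK := @compact_box R m n a b; set K := [set X : E | _] in cK.
have mK := measurable_compact cK.
have BK : box a b `<=` K by move=> X aXb i j; have /andP[/ltW -> /ltW ->] := aXb i j.
have mb k : measurable_fun [set: E] (bump a b k).
  by apply: measurable_continuous; exact: (Ck_continuous (Ck_bump a b k 0%N)).
have := @dominated_convergence _ _ _ L setT measurableT
  (fun k X => (g X * bump a b k X)%:E) (fun X => (g X * \1_(box a b) X)%:E)
  (fun X => (`|g X| * \1_K X)%:E).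
case.
- by move=> k; apply/measurable_EFinP; exact: measurable_funM.
- by apply/measurable_EFinP; apply: measurable_funM => //; exact: measurable_indic.
- apply: aeW => X _; apply: cvg_EFin; first by near=> k.
  by apply: cvgMr; exact: cvg_bump.
- apply: (@integrable_supported K (fun X => `|g X| * \1_K X)) => //; last first.
    by move=> X NK; rewrite indicE memNset// mulr0.
  apply: (eq_integrable mK (abse \o (EFin \o g))); last exact/integrable_abse/ig.
  by move=> X /set_mem KX; rewrite /= indicE mem_set// mulr1.
- apply: aeW => X k _; rewrite lee_fin normrM ler_wpM2l//.
  rewrite ger0_norm ?bump_ge0//; case: (eqVneq (bump a b k X) 0) => [->//|].
  by move=> /(bump_neq0_box ab) /BK KX; rewrite indicE mem_set// bump_le1.
move=> _ _; rewrite (_ : [sequence _]_ _ = fun=> 0%E); last first.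
  apply/funext => k; apply: Rintegral_eq0; last exact/g0/test_function_bump.
  have [cb _ [K' cK' K'0]] := test_functionE (test_function_bump k ab).
  exact: (integrable_loc_mul lg cb cK' K'0).
move=> h; rewrite integral_mkcond epatch_indic.
by apply: (cvg_unique _ h) => //; exact: cvg_cst.
Unshelve. all: by end_near. Qed.

(** Fundamental lemma of the calculus of variations: bumps increase to the indicator
    functions of boxes, and the integrals over boxes determine the function. *)
Lemma locally_integrable_ae0 g : mx_locally_integrable g ->
  (forall phi, test_function phi -> (\int[L]_x (g x * phi x) = 0)%R) ->
  {ae L, forall x, g x = 0}.
Proof.
move=> lg g0; have [mg ig] := lg; have B0 := box_integral_eq0 lg g0.
pose B k : set E := box (const_mx (- k%:R)) (const_mx k%:R).
suff H k : ae_eq L (B k) (EFin \o g) (cst 0%E).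
  have /ae_foralln : forall k, {ae L, forall x, B k x -> (g x)%:E = 0%E} by exact: H.
  apply: filterS => x Hx.
  have : (\bigcup_k B k) x by rewrite bigcup_box.
  by move=> [k _ /Hx []].
have mB : measurable (B k) by exact: measurable_box.
have iB (A : set E) : measurable A -> A `<=` B k -> L.-integrable A (EFin \o g).
  move=> mA AB; have cK := @compact_box R m n (const_mx (- k%:R)) (const_mx k%:R).
  apply: (integrableS _ _ _ (ig _ cK)) => //; first exact: measurable_compact.
  by move=> X /AB aXb i j; have /andP[/ltW -> /ltW ->] := aXb i j.
have mp : measurable_fun [set: E] ((EFin \o g)^\+ \_ (B k))%E.
  apply: (proj1 (measurable_restrictT _ mB)); apply: measurable_funTS.
  by apply: measurable_funepos; exact/measurable_EFinP.
have mn : measurable_fun [set: E] ((EFin \o g)^\- \_ (B k))%E.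
  apply: (proj1 (measurable_restrictT _ mB)); apply: measurable_funTS.
  by apply: measurable_funeneg; exact/measurable_EFinP.
have p0 x : (0 <= ((EFin \o g)^\+ \_ (B k)) x)%E by rewrite patchE; case: ifP.
have n0 x : (0 <= ((EFin \o g)^\- \_ (B k)) x)%E by rewrite patchE; case: ifP.
have eqv (A : set E) : measurable A -> A `<=` B k ->
    ((\int[L]_(x in A) (g x)%:E = 0)%E <->
     (\int[L]_(x in A) ((EFin \o g)^\+ x) = \int[L]_(x in A) ((EFin \o g)^\- x))%E).
  move=> mA AB; have iA := iB A mA AB.
  have fp := integrable_pos_fin_num mA iA; have fn := integrable_neg_fin_num mA iA.
  rewrite (integralE L A (EFin \o g)); split=> [/eqP|->]; last by rewrite subee.
  by rewrite sube_eq// add0e => /eqP.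
have mBI (a b : E) : measurable (box a b `&` B k).
  by apply: measurableI => //; exact: measurable_box.
have mpos A : measurable A -> weighted L mp p0 A = weighted L mn n0 A.
  apply: measure_eq_box => a b; rewrite /= /weighted -integral_mkcondr.
  - rewrite -integral_mkcondr; apply: (proj1 (eqv _ (mBI a b) _)); first exact: subIsetr.
    by rewrite boxI; exact: B0.
  - rewrite -ge0_fin_numE; last by apply: integral_ge0.
    apply: (integrable_pos_fin_num (mBI a b)); apply: iB; [exact: mBI|exact: subIsetr].
apply: integral_ae_eq => //.
  exact: iB.
move=> A AB mA; rewrite integral0; apply/(eqv _ mA AB).
by have := mpos A mA; rewrite /weighted -!integral_mkcondr setIidl.
Qed.

End local_integrability.

(** * Square integrability and weak derivatives *)

Section square_integrable.
Local Open Scope ereal_scope.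
Context d (T : measurableType d) (R : realType).
Variable mu : {measure set T -> \bar R}.
Implicit Types f g : T -> R.

Definition sqint f := measurable_fun [set: T] f /\ \int[mu]_x (f x ^+ 2)%:E < +oo.

Lemma integrable_sqr f : sqint f -> mu.-integrable [set: T] (EFin \o (fun x => f x ^+ 2)%R).
Proof.
move=> [mf f2]; apply/integrableP; split; first by apply/measurable_EFinP; exact: measurable_funX.
by under eq_integral do rewrite gee0_abs ?lee_fin ?sqr_ge0//.
Qed.

Lemma Lnorm2E f : 'N[mu]_2%:E [EFin \o f] = sqrte (\int[mu]_x (f x ^+ 2)%:E).
Proof.
rewrite Lnorm.unlock /= -poweR12_sqrt; last first.
  by apply: integral_ge0 => x _; rewrite lee_fin sqr_ge0.
congr (_ `^ _); apply: eq_integral => x _ /=.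
by rewrite powR_mulrn// real_normK// num_real.
Qed.

Lemma Lfun2P f : f \in Lfun mu 2%:E <-> sqint f.
Proof.
have fE : (f \in finLfun mu 2%:E) = (\int[mu]_x (f x ^+ 2)%:E < +oo).
  rewrite -[LHS]/(f \in [set f | finite_norm mu 2%:E f]) mem_setE.
  rewrite [LHS]/(finite_norm _ _ _) Lnorm2E.
  by case: (\int[mu]_x _) => [r||]//=; rewrite !ltry.
split=> [/andP[/= mf]|[mf f2]]; first by rewrite fE; split => //; exact/set_mem.
by apply/andP; split => /=; [exact/mem_set|rewrite fE].
Qed.

Lemma integrable_mul_sqint f g : sqint f -> sqint g ->
  mu.-integrable [set: T] (fun x => (f x * g x)%:E).
Proof.
move=> [mf f2] [mg g2].
pose h x := (f x ^+ 2 + g x ^+ 2)%R.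
have h0 x : (0 <= h x)%R by rewrite /h addr_ge0 ?sqr_ge0.
apply: (@integrable_le _ _ _ mu (fun x => f x * g x)%R h).
- exact: measurable_funM.
- move=> x; rewrite /h normrM -(real_normK (num_real (f x))) -(real_normK (num_real (g x))).
  have := sqr_ge0 (`|f x| - `|g x|)%R; have := normr_ge0 (f x); have := normr_ge0 (g x).
  nra.
apply/integrableP; split.
  apply/measurable_EFinP; rewrite /h; apply: measurable_funD; exact: measurable_funX.
under eq_integral do rewrite /= ger0_norm// EFinD.
rewrite ge0_integralD//; first exact: lte_add_pinfty.
- by move=> x _; rewrite lee_fin sqr_ge0.
- by apply/measurable_EFinP; exact: measurable_funX.
- by move=> x _; rewrite lee_fin sqr_ge0.
- by apply/measurable_EFinP; exact: measurable_funX.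
Qed.

End square_integrable.

Section weak_partial_theory.
Context {R : realType} {m n : nat}.
Local Notation E := 'M[R]_(m, n).
Local Notation L := (@lebesgue_mx R m n).
Implicit Types (u g : E -> R) (ij : 'I_m * 'I_n).

Lemma sqint_locally_integrable u : sqint L u -> mx_locally_integrable u.
Proof.
move=> [mu u2]; split=> // K cK; have mK := measurable_compact cK.
have cst1 : L.-integrable K (EFin \o cst 1).
  apply: (@integrable_bounded_compact _ _ _ K (cst 1) 1) => // X _ /=.
  by rewrite normr1.
have iu2 : L.-integrable K (fun X => (u X ^+ 2)%:E).
  apply: (integrableS measurableT) => //; apply/integrableP; split.
    by apply/measurable_EFinP; exact: measurable_funX.
  by under eq_integral do rewrite /= ger0_norm ?sqr_ge0//.
apply: (le_integrable mK _ _ (integrableD mK cst1 iu2)).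
  by apply/measurable_EFinP; exact: measurable_funTS.
move=> X _; rewrite /= lee_fin [leRHS]ger0_norm ?addr_ge0 ?sqr_ge0//.
rewrite -(real_normK (num_real (u X))); have := sqr_ge0 (`|u X| - 1); have := normr_ge0 (u X).
nra.
Qed.

Lemma locally_integrableB g1 g2 : mx_locally_integrable g1 -> mx_locally_integrable g2 ->
  mx_locally_integrable (fun X => g1 X - g2 X).
Proof.
move=> [m1 i1] [m2 i2]; split; first exact: measurable_funB.
move=> K cK; have mK := measurable_compact cK.
exact: (integrableB mK (i1 K cK) (i2 K cK)).
Qed.

Lemma integrable_test g phi : mx_locally_integrable g -> test_function phi ->
  L.-integrable [set: E] (fun X => (g X * phi X)%:E).
Proof.
move=> lg tphi; have [cp _ [K cK K0]] := test_functionE tphi.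
exact: integrable_loc_mul cK K0.
Qed.

Lemma integrable_test_partial g phi ij : mx_locally_integrable g -> test_function phi ->
  L.-integrable [set: E] (fun X => (g X * partial ij phi X)%:E).
Proof.
move=> lg tphi; have [_ cp [K cK K0]] := test_function_partial ij tphi.
by apply: (integrable_loc_mul lg cp cK) => X /K0[].
Qed.

Lemma weak_partial_unique u ij g1 g2 :
  is_weak_partial u ij g1 -> is_weak_partial u ij g2 -> {ae L, forall x, g1 x = g2 x}.
Proof.
move=> [lu lg1 h1] [_ lg2 h2].
have : {ae L, forall x, g1 x - g2 x = 0}.
  apply: locally_integrable_ae0; first exact: locally_integrableB.
  move=> phi tphi; under eq_Rintegral do rewrite mulrBl.
  rewrite RintegralB//; [|exact: integrable_test..].
  by apply/eqP; rewrite subr_eq0 -eqr_opp -h1// h2.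
by apply: filterS => x /eqP; rewrite subr_eq0 => /eqP.
Qed.

Lemma weak_partial_spec u ij g : is_weak_partial u ij g ->
  is_weak_partial u ij (weak_partial u ij) /\
  {ae L, forall x, weak_partial u ij x = g x}.
Proof.
move=> ug; have H : is_weak_partial u ij (weak_partial u ij) by apply: getPex; exists g.
by split => //; exact: (weak_partial_unique H ug).
Qed.

Lemma eq_ae_locally_integrable u u' : measurable_fun [set: E] u' ->
  {ae L, forall x, u x = u' x} -> mx_locally_integrable u -> mx_locally_integrable u'.
Proof.
move=> mu' uu' [mu iu]; split=> // K cK; have mK := measurable_compact cK.
have mu'K : measurable_fun K (EFin \o u') by apply/measurable_EFinP; exact: measurable_funTS.
apply/integrableP; split => //; have /integrableP[muK] := iu K cK.
rewrite (@ge0_ae_eq_integral _ _ _ L K (fun x => `|(EFin \o u) x|)%E (fun x => `|(EFin \o u') x|)%E)//.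
- exact: measurableT_comp.
- exact: measurableT_comp.
- by move: uu'; apply: filterS => x /= -> _.
Qed.

Lemma eq_ae_weak_partial u u' ij g : measurable_fun [set: E] u' ->
  {ae L, forall x, u x = u' x} -> is_weak_partial u ij g -> is_weak_partial u' ij g.
Proof.
move=> mu' uu' [lu lg h]; have lu' := eq_ae_locally_integrable mu' uu' lu.
split=> // phi tphi; rewrite -h//; congr fine; apply: ae_eq_integral => //.
- exact: (measurable_int _ (integrable_test_partial ij lu' tphi)).
- exact: (measurable_int _ (integrable_test_partial ij lu tphi)).
- by move: uu'; apply: filterS => x /= -> _.
Qed.

(** A continuously differentiable function: integrate the derivative of f phi. *)
Lemma is_weak_partial_classical (f f' : E -> R) ij :
  continuous f -> continuous f' -> (forall X, is_derive X (mxdir ij) f (f' X)) ->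
  is_weak_partial f ij f'.
Proof.
move=> cf cf' df.
have lf := continuous_locally_integrable cf.
have lf' := continuous_locally_integrable cf'.
split => // phi tphi.
have [cphi _ [K cK K0]] := test_functionE tphi.
have [dphi cdphi _] := test_function_partial ij tphi.
have i1 := integrable_test_partial ij lf tphi; have i2 := integrable_test lf' tphi.
have i0 := integrable_test lf tphi.
have : (\int[L]_X (f X * partial ij phi X + phi X * f' X)%:E = 0)%E.
  pose fp' X := f X * partial ij phi X + phi X * f' X.
  have dfp X : is_derive X (mxdir ij) (fun X => f X * phi X) (fp' X).
    exact: (is_derive_mul (df X) (dphi X)).
  apply: (integral_derivative_eq0 dfp).
  - move=> X; apply: continuous_line.
    move=> Y; apply: (@continuousD _ _ _ (fun X => f X * partial ij phi X)
      (fun X => phi X * f' X)).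
      by apply: (@continuousM _ _ f); [exact: cf|exact: cdphi].
    by apply: (@continuousM _ _ phi); [exact: cphi|exact: cf'].
  - exact: i0.
  - rewrite (_ : EFin \o _ = (fun X => (f X * partial ij phi X)%:E) \+
        (fun X => (f' X * phi X)%:E))%E; first exact: integrableD.
    by apply/funext => X /=; rewrite /fp' -EFinD [phi X * _]mulrC.
under eq_integral do rewrite EFinD [phi _ * _]mulrC.
rewrite integralD// => /eqP; rewrite /Rintegral.
rewrite -(fineK (integrable_fin_num _ i1))// -(fineK (integrable_fin_num _ i2))//.
by rewrite -EFinD eqe addr_eq0 => /eqP ->.
Qed.

End weak_partial_theory.

(** * Laplace transforms *)

Lemma expR_sub1_le (R : realType) (s : R) : `|expR s - 1| <= `|s| * expR `|s|.
Proof.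
have [s0|s0] := leP 0 s.
  have h : expR s * (1 - s) <= 1.
    rewrite -[leRHS](expRxMexpNx_1 s) ler_pM2l ?expR_gt0//.
    by have := expR_ge1Dx (- s).
  rewrite (ger0_norm s0) ger0_norm; first lra.
  by have := expR_ge1Dx s; lra.
have h : expR s <= 1 by rewrite -expR0 ler_expR ltW.
rewrite (ltr0_norm s0) ler0_norm ?subr_le0//.
have h1 := expR_ge1Dx s.
have h2 : 1 <= expR (- s) by rewrite -expR0 ler_expR; lra.
nra.
Qed.

Lemma expR_sub1sub_le (R : realType) (s : R) :
  `|expR s - 1 - s| <= s ^+ 2 * expR `|s|.
Proof.
have h := expR_ge1Dx s.
have h' : expR s * (1 - s) <= 1.
  rewrite -[leRHS](expRxMexpNx_1 s) ler_pM2l ?expR_gt0//.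
  by have := expR_ge1Dx (- s).
rewrite ger0_norm; last lra.
apply: (@le_trans _ _ (s * (expR s - 1))); first lra.
rewrite -(real_normK (num_real s)).
apply: (le_trans (ler_norm _)); rewrite normrM expr2 -mulrA ler_wpM2l//.
exact: expR_sub1_le.
Qed.

Section matrix_forms.
Context {R : realType} {m n : nat}.
Local Notation E := 'M[R]_(m, n).
Implicit Types X Y : E.

Definition mxdot X Y : R := \sum_i \sum_j X i j * Y i j.
Definition l1norm X : R := \sum_i \sum_j `|X i j|.
Definition sqnorm X : R := \sum_i \sum_j X i j ^+ 2.

Lemma l1norm_ge0 X : 0 <= l1norm X.
Proof. by apply: sumr_ge0 => i _; apply: sumr_ge0. Qed.

Lemma sqnorm_ge0 X : 0 <= sqnorm X.
Proof. by apply: sumr_ge0 => i _; apply: sumr_ge0 => j _; exact: sqr_ge0. Qed.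

Lemma le_coord_l1norm X i j : `|X i j| <= l1norm X.
Proof.
rewrite /l1norm (bigD1 i)//= (bigD1 j)//= -addrA lerDl addr_ge0//.
  by apply: sumr_ge0.
by apply: sumr_ge0 => k _; apply: sumr_ge0.
Qed.

Lemma le_coord_norm X i j : `|X i j| <= `|X|.
Proof.
rewrite (_ : `|X| = mx_norm X)// mx_normrE.
exact: (le_bigmax _ (fun ij : 'I_m * 'I_n => `|X ij.1 ij.2|) (i, j)).
Qed.

Lemma mxdot_le (b : R) X Y : (forall i j, `|X i j| <= b) -> `|mxdot X Y| <= b * l1norm Y.
Proof.
move=> Xb; rewrite /mxdot /l1norm (le_trans (ler_norm_sum _ _ _))// mulr_sumr.
apply: ler_sum => i _; rewrite (le_trans (ler_norm_sum _ _ _))// mulr_sumr.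
by apply: ler_sum => j _; rewrite normrM ler_wpM2r.
Qed.

Lemma mxdotDl X X' Y : mxdot (X + X') Y = mxdot X Y + mxdot X' Y.
Proof.
rewrite /mxdot -big_split; apply: eq_bigr => i _; rewrite -big_split.
by apply: eq_bigr => j _; rewrite !mxE mulrDl.
Qed.

Lemma mxdotZl (a : R) X Y : mxdot (a *: X) Y = a * mxdot X Y.
Proof.
rewrite /mxdot mulr_sumr; apply: eq_bigr => i _; rewrite mulr_sumr.
by apply: eq_bigr => j _; rewrite !mxE mulrA.
Qed.

Lemma mxdot_dir ij Y : mxdot (mxdir ij) Y = Y ij.1 ij.2.
Proof.
rewrite /mxdot (bigD1 ij.1)//= (bigD1 ij.2)//= !mxE !eqxx mul1r.
rewrite big1 ?addr0 => [|j jij]; last by rewrite !mxE (negbTE jij) andbF mul0r.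
rewrite big1 ?addr0// => i iij; rewrite big1// => j _.
by rewrite !mxE (negbTE iij) mul0r.
Qed.

Lemma sqnormB X Y : sqnorm (Y - X) = sqnorm Y - 2 * mxdot X Y + sqnorm X.
Proof.
rewrite /sqnorm /mxdot mulr_sumr -sumrB -big_split; apply: eq_bigr => i _.
rewrite mulr_sumr -sumrB -big_split; apply: eq_bigr => j _ /=.
by rewrite !mxE; ring.
Qed.

Lemma continuous_mxdot X : continuous (mxdot X).
Proof.
apply: (@Ck_continuous _ _ _ 0%N); apply: Ck_sum => i; apply: Ck_sum => j.
by apply: Ck_mul; [exact: Ck_cst|exact: Ck_coord].
Qed.

Lemma measurable_l1norm : measurable_fun [set: E] l1norm.
Proof.
apply: measurable_sum => i; apply: measurable_sum => j.
by apply: measurableT_comp => //; exact: measurable_mx_coord.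
Qed.

Lemma measurable_mxdot X : measurable_fun [set: E] (mxdot X).
Proof. by apply: measurable_continuous; exact: continuous_mxdot. Qed.

End matrix_forms.

Section laplace_transform.
Context {R : realType} {m n : nat}.
Local Notation E := 'M[R]_(m, n).
Variable nu : {measure set E -> \bar R}.
Variable lam : R.
Implicit Types (f : E -> R) (X Y : E).

(** Integrability against all exponentials is stable under multiplication by a
    coordinate, hence under the derivatives of the transform. *)
Definition expint f := measurable_fun [set: E] f /\
  forall c : R, nu.-integrable [set: E] (fun Y => (f Y * expR (c * l1norm Y))%:E).

Definition laplace f X : R := \int[nu]_Y (f Y * expR (lam * mxdot X Y)).

Lemma measurable_expR_fun (g : E -> R) : measurable_fun [set: E] g ->
  measurable_fun [set: E] (fun Y => expR (g Y)).
Proof. by move=> mg; apply: measurableT_comp. Qed.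

Lemma expint_le f (g : E -> R) (A c : R) : expint f -> measurable_fun [set: E] g ->
  (forall Y, `|g Y| <= A * (`|f Y| * expR (c * l1norm Y))) ->
  nu.-integrable [set: E] (EFin \o g).
Proof.
move=> [mf ef] mg gf.
apply: (@integrable_le _ _ _ nu g (fun Y => A * (`|f Y| * expR (c * l1norm Y)))) => //.
have H : nu.-integrable [set: E] (fun Y => (`|f Y| * expR (c * l1norm Y))%:E).
  have := integrable_abse (ef c).
  rewrite (_ : abse \o _ = fun Y => (`|f Y| * expR (c * l1norm Y))%:E)//.
  by apply/funext => Y /=; rewrite normrM (ger0_norm (expR_ge0 _)).
exact: (integrableZl measurableT A H).
Qed.

Lemma expint_dom f (g : E -> R) (A c : R) : expint f -> measurable_fun [set: E] g ->
  (forall Y, `|g Y| <= A * (`|f Y| * expR (c * l1norm Y))) -> expint g.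
Proof.
move=> ef mg gf; split => // c'.
apply: (@expint_le f _ A (c + c')) => //.
  by apply: measurable_funM => //; apply: measurable_expR_fun;
    apply: measurable_funM => //; exact: measurable_l1norm.
move=> Y; rewrite normrM (ger0_norm (expR_ge0 _)) mulrDl expRD mulrA [leRHS]mulrA.
by rewrite ler_wpM2r ?expR_ge0// -mulrA.
Qed.

Lemma expint_coord f i j : expint f -> expint (fun Y => Y i j * f Y).
Proof.
move=> ef; apply: (@expint_dom f _ 1 1) => //.
  by apply: measurable_funM; [exact: measurable_mx_coord|exact: ef.1].
move=> Y; rewrite normrM mul1r mulrC ler_wpM2l// mul1r.
apply: (le_trans (le_coord_l1norm Y i j)).
by apply: le_trans (expR_ge1Dx _); rewrite lerDr.
Qed.

Lemma expintZ f (a : R) : expint f -> expint (fun Y => a * f Y).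
Proof.
move=> ef; apply: (@expint_dom f _ `|a| 0) => //.
  by apply: measurable_funM => //; exact: ef.1.
by move=> Y; rewrite mul0r expR0 mulr1 normrM.
Qed.

Lemma measurable_expdot X : measurable_fun [set: E] (fun Y => expR (lam * mxdot X Y)).
Proof. by apply: measurable_expR_fun; apply: measurable_funM => //; exact: measurable_mxdot. Qed.

Lemma expdot_le X Y : expR (lam * mxdot X Y) <= expR (`|lam| * l1norm X * l1norm Y).
Proof.
rewrite ler_expR (le_trans (ler_norm _))// normrM -mulrA ler_wpM2l//.
by apply: mxdot_le => i j; exact: le_coord_l1norm.
Qed.

Lemma integrable_laplace f X : expint f ->
  nu.-integrable [set: E] (fun Y => (f Y * expR (lam * mxdot X Y))%:E).
Proof.
move=> ef; apply: (@expint_le f _ 1 (`|lam| * l1norm X)) => //.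
  by apply: measurable_funM; [exact: ef.1|exact: measurable_expdot].
move=> Y; rewrite normrM (ger0_norm (expR_ge0 _)) mul1r ler_wpM2l//.
exact: expdot_le.
Qed.

Lemma continuous_laplace f : expint f -> continuous (laplace f).
Proof.
move=> ef X; apply: (proj2 (@cvgrPdist_le _ _ _ (nbhs X) _ _ _)) => e e0.
pose c := `|lam| * l1norm X + `|lam| + 1.
pose g Y := `|lam| * (`|f Y| * expR (c * l1norm Y)).
have ig : nu.-integrable [set: E] (EFin \o g).
  apply: (@expint_le f _ `|lam| c) => //.
    apply: measurable_funM => //; apply: measurable_funM.
      by apply: measurableT_comp => //; exact: ef.1.
    by apply: measurable_expR_fun; apply: measurable_funM => //; exact: measurable_l1norm.
  by move=> Y; rewrite /g ger0_norm// !mulr_ge0 ?expR_ge0.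
set C := \int[nu]_Y g Y.
have C0 : 0 <= C by apply: Rintegral_ge0 => Y _; rewrite !mulr_ge0 ?expR_ge0.
have key X' : `|X' - X| <= 1 -> `|laplace f X - laplace f X'| <= `|X' - X| * C.
  move=> X1; rewrite -RintegralB//; [|exact: integrable_laplace..].
  have iB : nu.-integrable [set: E] (EFin \o (fun Y =>
      f Y * expR (lam * mxdot X Y) - f Y * expR (lam * mxdot X' Y))).
    exact: (integrableB measurableT (integrable_laplace X ef) (integrable_laplace X' ef)).
  apply: (le_trans (le_normr_Rintegral _ _)) => //.
  rewrite -RintegralZl//; apply: le_Rintegral => //.
  - exact: (integrable_norm iB).
  - exact: (integrableZl measurableT `|X' - X| ig).
  move=> Y _; rewrite -mulrBr normrM.
  have -> : mxdot X' Y = mxdot X Y + mxdot (X' - X) Y by rewrite -mxdotDl addrC subrK.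
  rewrite [lam * (_ + _)]mulrDr expRD -[X in `|X - _|]mulr1 -mulrBr normrM.
  rewrite (ger0_norm (expR_ge0 _)) distrC.
  set s := lam * mxdot (X' - X) Y.
  have sl : `|s| <= `|lam| * (`|X' - X| * l1norm Y).
    by rewrite /s normrM ler_wpM2l//; apply: mxdot_le => i j; exact: le_coord_norm.
  have sl' : `|s| <= `|lam| * l1norm Y.
    by rewrite (le_trans sl)// ler_wpM2l// ler_piMl// l1norm_ge0.
  have s1 := expR_sub1_le s.
  rewrite [leRHS](_ : _ = `|f Y| * (expR (`|lam| * l1norm X * l1norm Y) *
     ((`|lam| * `|X' - X|) * (expR (l1norm Y) * expR (`|lam| * l1norm Y))))); last first.
    by rewrite /g /c !mulrDl !expRD mul1r; ring.
  rewrite ler_wpM2l// ler_pM ?expR_ge0//; first exact: expdot_le.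
  apply: (le_trans s1); rewrite mulrA ler_pM ?expR_ge0 ?normr_ge0//; last by rewrite ler_expR.
  apply: (le_trans sl); rewrite mulrA ler_wpM2l ?mulr_ge0//.
  by apply: le_trans (expR_ge1Dx _); rewrite lerDr.
near=> X'.
have h1 : `|X' - X| <= 1 by rewrite distrC; near: X'; apply: cvgr_dist_le => //; exact: cvg_id.
have h2 : `|X' - X| <= e / (C + 1).
  by rewrite distrC; near: X'; apply: cvgr_dist_le; [exact: cvg_id|rewrite divr_gt0// ltr_wpDl].
apply: (le_trans (key X' h1)).
apply: (@le_trans _ _ (`|X' - X| * (C + 1))); first by rewrite ler_wpM2l// lerDl.
by rewrite -ler_pdivlMr// ltr_wpDl.
Unshelve. all: by end_near. Qed.

(** The second-order remainder of the exponential is dominated, uniformly in the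
    step, by an integrable function of Y. *)
Lemma is_derive_laplace f X ij : expint f ->
  is_derive X (mxdir ij) (laplace f)
    (laplace (fun Y => lam * (Y ij.1 ij.2 * f Y)) X).
Proof.
move=> ef.
have ef' : expint (fun Y => lam * (Y ij.1 ij.2 * f Y)) by exact/expintZ/expint_coord.
have ef2 : expint (fun Y => Y ij.1 ij.2 * (Y ij.1 ij.2 * f Y)) by do 2 apply: expint_coord.
pose c := `|lam| * l1norm X + `|lam|.
pose g Y := lam ^+ 2 * (`|Y ij.1 ij.2 * (Y ij.1 ij.2 * f Y)| * expR (c * l1norm Y)).
have ig : nu.-integrable [set: E] (EFin \o g).
  apply: (@expint_le _ _ (lam ^+ 2) c ef2) => //.
    apply: measurable_funM => //; apply: measurable_funM.
      by apply: measurableT_comp => //; exact: ef2.1.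
    by apply: measurable_expR_fun; apply: measurable_funM => //; exact: measurable_l1norm.
  by move=> Y; rewrite /g ger0_norm// mulr_ge0 ?sqr_ge0// mulr_ge0 ?expR_ge0.
apply: (is_derive_quadratic (C := \int[nu]_Y g Y) (r := 1)) => // h h1.
have i1 := integrable_laplace (h *: mxdir ij + X) ef.
have i2 := integrable_laplace X ef; have i3 := integrable_laplace X ef'.
pose fh Y := f Y * expR (lam * mxdot (h *: mxdir ij + X) Y).
pose f0 Y := f Y * expR (lam * mxdot X Y).
pose f1 Y := lam * (Y ij.1 ij.2 * f Y) * expR (lam * mxdot X Y).
have i12 : nu.-integrable [set: E] (EFin \o (fun Y => fh Y - f0 Y)).
  exact: (integrableB measurableT i1 i2).
have i4 : nu.-integrable [set: E] (EFin \o (fun Y => h * f1 Y)).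
  exact: (integrableZl measurableT h i3).
have iB : nu.-integrable [set: E] (EFin \o (fun Y => (fh Y - f0 Y) - h * f1 Y)).
  exact: (integrableB measurableT i12 i4).
rewrite /laplace -RintegralB// -RintegralZl// -RintegralB//.
apply: (le_trans (le_normr_Rintegral _ _)) => //.
rewrite mulrC -RintegralZl//; apply: le_Rintegral => //.
- exact: (integrable_norm iB).
- exact: (integrableZl measurableT (h ^+ 2) ig).
move=> Y _; set y := Y ij.1 ij.2.
rewrite mxdotDl mxdotZl mxdot_dir -/y mulrDr expRD.
set a := expR (lam * mxdot X Y); set s := lam * (h * y).
rewrite (_ : _ - _ = f Y * a * (expR s - 1 - s)); last by rewrite /s; ring.
rewrite !normrM (ger0_norm (expR_ge0 _ : 0 <= a)).
have sl : `|s| <= `|lam| * l1norm Y.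
  rewrite /s normrM ler_wpM2l// normrM (@le_trans _ _ `|y|)//.
    by rewrite ler_piMl// ltW.
  exact: le_coord_l1norm.
apply: (@le_trans _ _ (`|f Y| * a * (s ^+ 2 * expR `|s|))).
  by rewrite ler_wpM2l ?expR_sub1sub_le// mulr_ge0// expR_ge0.
rewrite [leRHS](_ : _ = `|f Y| * expR (`|lam| * l1norm X * l1norm Y) *
   (s ^+ 2 * expR (`|lam| * l1norm Y))); last first.
  rewrite /g -/y /c mulrDl expRD !normrM /s.
  by rewrite !exprMn -(real_normK (num_real y)); ring.
apply: ler_pM.
- by rewrite mulr_ge0// expR_ge0.
- by rewrite mulr_ge0 ?sqr_ge0// expR_ge0.
- by rewrite ler_wpM2l//; exact: expdot_le.
- by rewrite ler_wpM2l ?sqr_ge0// ler_expR.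
Qed.

Lemma Ck_laplace k f : expint f -> Ck k (laplace f).
Proof.
elim: k f => [|k IH] f ef; split => //; try exact: continuous_laplace.
move=> ij; exists (laplace (fun Y => lam * (Y ij.1 ij.2 * f Y))).
  by move=> X; exact: is_derive_laplace.
by apply: IH; exact/expintZ/expint_coord.
Qed.

End laplace_transform.

(** * Gaussian transforms *)

Lemma is_derive_cmul {R : realType} {V : normedModType R} (c : R) (f : V -> R)
    (x v : V) (df : R) :
  is_derive x v f df -> is_derive x v (fun y => c * f y) (c * df).
Proof. exact: is_deriveZ. Qed.

Section gaussian_transform.
Context {R : realType} {m n : nat} (eps : {posnum R}).
Local Notation E := 'M[R]_(m, n).
Local Notation L := (@lebesgue_mx R m n).
Local Notation e := (eps%:num).
Implicit Types (f : E -> R) (X Y : E).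

Definition gk X Y : R := \prod_(k < m) heat_kernel e (row k Y - row k X).

Definition gpeak : R := ((2 * pi * e) `^ (- (n%:R / 2))) ^+ m.

Lemma gpeak_gt0 : 0 < gpeak.
Proof. by rewrite exprn_gt0// powR_gt0// !mulr_gt0// pi_gt0. Qed.

Lemma gkE X Y : gk X Y = gpeak * expR (- sqnorm (Y - X) / (2 * e)).
Proof.
rewrite /gk /heat_kernel big_split/= prodr_const card_ord; congr (_ * _).
rewrite -expR_sum; congr expR; rewrite -big_distrl/= sumrN; congr (- _ / _).
by apply: eq_bigr => k _; apply: eq_bigr => i _; rewrite !mxE.
Qed.

Lemma gkC X Y : gk X Y = gk Y X.
Proof.
have sqC : sqnorm (Y - X) = sqnorm (X - Y).
  by apply: eq_bigr => i _; apply: eq_bigr => j _; rewrite !mxE -sqrrN opprB.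
by rewrite gkE sqC -gkE.
Qed.

Lemma gk_gt0 X Y : 0 < gk X Y.
Proof. by rewrite gkE mulr_gt0 ?gpeak_gt0// expR_gt0. Qed.

Lemma gk_le X Y : gk X Y <= gpeak.
Proof.
rewrite gkE ler_piMr ?(ltW gpeak_gt0)// -[leRHS]expR0 ler_expR mulNr oppr_le0.
by rewrite divr_ge0 ?sqnorm_ge0.
Qed.

(** Expanding the square turns Gaussian transforms into Laplace transforms. *)
Lemma gk_split X Y : gk X Y = gpeak * expR (- sqnorm X / (2 * e)) *
  (expR (- sqnorm Y / (2 * e)) * expR (e^-1 * mxdot X Y)).
Proof.
rewrite gkE sqnormB -mulrA -!expRD; congr (_ * expR _).
by field.
Qed.

Lemma measurable_sqnorm : measurable_fun [set: E] sqnorm.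
Proof.
apply: measurable_sum => i; apply: measurable_sum => j.
by apply: measurable_funX; exact: measurable_mx_coord.
Qed.

Lemma measurable_gk2 : measurable_fun [set: E * E] (fun Z => gk Z.1 Z.2).
Proof. exact: measurable_gaussian_kernel. Qed.

Lemma measurable_gk X : measurable_fun [set: E] (gk X).
Proof.
have mpair : measurable_fun [set: E] (fun Y : E => (X, Y)) by exact: measurable_fun_pair.
exact: (measurableT_comp measurable_gk2 mpair).
Qed.

Lemma integral_gk X : (\int[L]_Y (gk X Y)%:E = 1)%E.
Proof. exact: integral_gaussian_kernel. Qed.

Lemma Ck_sqnorm_exp k (a : R) : Ck k (fun X : E => expR (a * sqnorm X)).
Proof.
apply: (Ck_comp (S := [set expR]) (D := setT)) => //.
- by move=> _ ->; exists expR => // t _; exact: is_derive_expR.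
- apply: Ck_mul; first exact: Ck_cst.
  apply: Ck_sum => i; apply: Ck_sum => j.
  by under eq_fun do rewrite expr2; apply: Ck_mul; exact: Ck_coord.
Qed.

Lemma is_derive_sqnorm_exp (a : R) X ij :
  is_derive X (mxdir ij) (fun X : E => expR (a * sqnorm X))
   (2 * a * X ij.1 ij.2 * expR (a * sqnorm X)).
Proof.
have dq : is_derive X (mxdir ij) sqnorm (2 * X ij.1 ij.2).
  apply: (is_derive_quadratic (C := 1) (r := 1)) => // h _.
  have -> : sqnorm (h *: mxdir ij + X) = sqnorm X + 2 * (h * X ij.1 ij.2) + h ^+ 2.
    have sqnormE Y : sqnorm Y = mxdot Y Y.
      by apply: eq_bigr => i _; apply: eq_bigr => j _; rewrite expr2.
    rewrite sqnormE mxdotDl mxdotZl mxdot_dir !mxE !eqxx.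
    have mxdotC Y Z : mxdot Y Z = mxdot Z Y :> R.
      by apply: eq_bigr => i _; apply: eq_bigr => j _; rewrite mulrC.
    rewrite (mxdotC X) mxdotDl mxdotZl mxdot_dir -sqnormE /=; ring.
  rewrite (_ : _ - _ = h ^+ 2); last by ring.
  by rewrite mul1r ger0_norm ?sqr_ge0.
have h := is_derive_compR (f := fun X => a * sqnorm X) (is_derive_expR (a * sqnorm X))
  (is_derive_cmul a dq).
by apply: (is_derive_eq h); ring.
Qed.

Section measure.
Variable nu : {measure set E -> \bar R}.

(** Up to Gaussian factors, the Gaussian transform of f is then a smooth Laplace
    transform. *)
Definition gint f := expint nu (fun Y => f Y * expR (- sqnorm Y / (2 * e))).

Definition gtrans f X : R := \int[nu]_Y (f Y * gk X Y).

Lemma integrable_gtrans f X : gint f ->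
  nu.-integrable [set: E] (fun Y => (f Y * gk X Y)%:E).
Proof.
move=> gf; have H := integrable_laplace e^-1 X gf.
have := integrableZl measurableT (gpeak * expR (- sqnorm X / (2 * e))) H.
rewrite (_ : (fun _ => _) = fun Y => (f Y * gk X Y)%:E)//.
by apply/funext => Y; rewrite -EFinM gk_split; congr EFin; ring.
Qed.

Lemma gtransE f X : gint f -> gtrans f X =
  gpeak * expR (- sqnorm X / (2 * e)) *
  laplace nu e^-1 (fun Y => f Y * expR (- sqnorm Y / (2 * e))) X.
Proof.
move=> gf; rewrite /laplace -RintegralZl//; last exact: integrable_laplace.
by congr Rintegral; apply/funext => Y; rewrite gk_split; ring.
Qed.

Lemma gint_coord f i j : gint f -> gint (fun Y => Y i j * f Y).
Proof.
move=> gf; have := expint_coord i j gf; rewrite /gint.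
by under [X in expint _ X -> _]eq_fun do rewrite mulrA.
Qed.

Lemma gint_score f X i j : gint f -> gint (fun Y => f Y * ((Y i j - X i j) / e)).
Proof.
move=> gf; have g1 := gint_coord i j gf.
rewrite /gint.
have -> : (fun Y => f Y * ((Y i j - X i j) / e) * expR (- sqnorm Y / (2 * e))) =
   (fun Y => e^-1 * (Y i j * f Y * expR (- sqnorm Y / (2 * e))) +
      (- (X i j / e)) * (f Y * expR (- sqnorm Y / (2 * e)))).
  by apply/funext => Y; ring.
have [ma ia] := expintZ e^-1 g1; have [mb ib] := expintZ (- (X i j / e)) gf.
split; first exact: measurable_funD.
move=> c; rewrite (_ : (fun Y => _) = (fun Y =>
    ((e^-1 * (Y i j * f Y * expR (- sqnorm Y / (2 * e)))) * expR (c * l1norm Y))%:E) \+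
    (fun Y => ((- (X i j / e) * (f Y * expR (- sqnorm Y / (2 * e)))) *
      expR (c * l1norm Y))%:E))%E.
  exact: (integrableD measurableT (ia c) (ib c)).
by apply/funext => Y /=; rewrite -EFinD mulrDl.
Qed.

Lemma is_derive_gtrans f X ij : gint f ->
  is_derive X (mxdir ij) (gtrans f)
    (gtrans (fun Y => f Y * ((Y ij.1 ij.2 - X ij.1 ij.2) / e)) X).
Proof.
move=> gf; have gs := gint_score X ij.1 ij.2 gf.
have -> : gtrans f = fun X => gpeak * (expR (- (2 * e)^-1 * sqnorm X) *
    laplace nu e^-1 (fun Y => f Y * expR (- sqnorm Y / (2 * e))) X).
  apply/funext => Z; rewrite gtransE// mulrA; congr (_ * expR _ * _).
  by ring.
have dl := is_derive_laplace e^-1 X ij gf.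
have H := is_derive_cmul gpeak
  (is_derive_mul (is_derive_sqnorm_exp (- (2 * e)^-1) X ij) dl).
apply: (is_derive_eq H).
rewrite gtransE// -(_ : expR (- (2 * e)^-1 * sqnorm X) = expR (- sqnorm X / (2 * e))); last first.
  by congr expR; ring.
have g1 := gint_coord ij.1 ij.2 gf.
have -> : laplace nu e^-1 (fun Y => f Y * ((Y ij.1 ij.2 - X ij.1 ij.2) / e) *
     expR (- sqnorm Y / (2 * e))) X =
   laplace nu e^-1 (fun Y => e^-1 * (Y ij.1 ij.2 * (f Y * expR (- sqnorm Y / (2 * e))))) X -
   X ij.1 ij.2 / e * laplace nu e^-1 (fun Y => f Y * expR (- sqnorm Y / (2 * e))) X.
  have i1 := integrable_laplace e^-1 X (expintZ e^-1 (expint_coord ij.1 ij.2 gf)).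
  have i2 := integrable_laplace e^-1 X gf.
  rewrite /laplace -RintegralZl// -RintegralB//.
    by congr Rintegral; apply/funext => Y; ring.
  exact: (integrableZl measurableT (X ij.1 ij.2 / e) i2).
by field.
Qed.

Lemma Ck_gtrans k f : gint f -> Ck k (gtrans f).
Proof.
move=> gf; have -> : gtrans f = fun X => gpeak * (expR (- (2 * e)^-1 * sqnorm X) *
    laplace nu e^-1 (fun Y => f Y * expR (- sqnorm Y / (2 * e))) X).
  apply/funext => Z; rewrite gtransE// mulrA; congr (_ * expR _ * _).
  by ring.
apply: Ck_mul; first exact: Ck_cst.
by apply: Ck_mul; [exact: Ck_sqnorm_exp|exact: Ck_laplace].
Qed.

End measure.

End gaussian_transform.

(** * Positivity and moments of the Gaussian kernel *)

Section positivity.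
Context d (T : measurableType d) (R : realType) (mu : {measure set T -> \bar R}).

Lemma Rintegral_gt0 (f : T -> R) : mu.-integrable [set: T] (EFin \o f) ->
  (forall x, 0 < f x) -> mu [set: T] != 0%E -> (0 < \int[mu]_x f x)%R.
Proof.
move=> intf f0 muT; rewrite lt_neqAle Rintegral_ge0 ?andbT => [|x _]; last exact: ltW.
apply: contra muT => /eqP I0.
have mf := measurable_int _ intf.
have : (\int[mu]_x `|(f x)%:E| = 0)%E.
  under eq_integral do rewrite gee0_abs ?lee_fin ?(ltW (f0 _))//.
  exact: (Rintegral_eq0 intf).
move=> /(ae_eq_integral_abs mu measurableT mf) [A [mA A0 HA]].
rewrite -measure_le0 -A0; apply: le_measure; rewrite ?inE//.
by move=> x _; apply: HA => /(_ I) [] /eqP; rewrite gt_eqF.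
Qed.

End positivity.

Section gaussian_bounds.
Context {R : realType} {m n : nat} (eps : {posnum R}).
Local Notation E := 'M[R]_(m, n).
Local Notation L := (@lebesgue_mx R m n).
Local Notation e := (eps%:num).
Implicit Types (f : E -> R) (X Y : E).

(** Young's inequality in each coordinate: a Gaussian absorbs all exponentials. *)
Lemma l1norm_le_sqnorm (c k : R) Y : 0 < k ->
  c * l1norm Y <= k * sqnorm Y + (m * n)%:R * (c ^+ 2 / (4 * k)).
Proof.
move=> k0.
have -> : (m * n)%:R * (c ^+ 2 / (4 * k)) = \sum_(i < m) \sum_(j < n) (c ^+ 2 / (4 * k)).
  by rewrite !sumr_const !card_ord -mulrnA mulr_natl mulnC.
rewrite /l1norm /sqnorm !mulr_sumr -big_split; apply: ler_sum => i _.
rewrite !mulr_sumr -big_split; apply: ler_sum => j _ /=.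
rewrite -(real_normK (num_real (Y i j))) -subr_ge0.
rewrite (_ : _ - _ = k * (`|Y i j| - c / (2 * k)) ^+ 2); last first.
  by field; rewrite gt_eqF.
by rewrite mulr_ge0 ?sqr_ge0// ltW.
Qed.

Lemma gint_integrable (nu : {measure set E -> \bar R}) f :
  nu.-integrable [set: E] (EFin \o f) -> gint eps nu f.
Proof.
move=> intf; have mf : measurable_fun [set: E] f.
  by apply/measurable_EFinP; exact: measurable_int intf.
have mq (a : R) : measurable_fun [set: E] (fun Y : E => expR (- sqnorm Y / a)).
  apply: measurableT_comp => //; apply: measurable_funM => //.
  by apply: measurableT_comp => //; exact: measurable_sqnorm.
split; first exact: measurable_funM.
move=> c; pose C := expR ((m * n)%:R * (c ^+ 2 / (4 * (2 * e)^-1))).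
have H := integrableZl measurableT C (integrable_abse intf).
apply: (@integrable_le _ _ _ nu _ (fun Y => C * `|f Y|)) => //.
  apply: measurable_funM; first exact: measurable_funM.
  by apply: measurable_expR_fun; apply: measurable_funM => //; exact: measurable_l1norm.
move=> Y; rewrite !normrM (ger0_norm (expR_ge0 _)) (ger0_norm (expR_ge0 _)).
rewrite -mulrA -expRD mulrC ler_wpM2r// ler_expR.
have := @l1norm_le_sqnorm c (2 * e)^-1 Y; rewrite invr_gt0 mulr_gt0// => /(_ isT).
by rewrite mulNr mulrC; lra.
Qed.

Lemma integrable_expNsqnorm (k : R) : 0 < k ->
  L.-integrable [set: E] (fun Y => (expR (- k * sqnorm Y))%:E).
Proof.
move=> k0.
have e0 : 0 < (2 * k)^-1 by rewrite invr_gt0 mulr_gt0.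
pose e' : {posnum R} := PosNum e0.
have H : L.-integrable [set: E] (fun Y => (gk e' 0 Y)%:E).
  apply/integrableP; split; first by apply/measurable_EFinP; exact: measurable_gk.
  under eq_integral do rewrite /= ger0_norm ?(ltW (gk_gt0 _ _ _))//.
  by rewrite integral_gk ltry.
have := integrableZl measurableT (gpeak (m := m) (n := n) e')^-1 H.
rewrite (_ : (fun _ => _) = fun Y => (expR (- k * sqnorm Y))%:E)//.
apply/funext => Y; rewrite -EFinM gkE subr0 mulKf ?gt_eqF ?gpeak_gt0//.
by congr (expR _)%:E; rewrite /e' /=; field; rewrite gt_eqF.
Qed.

(** The growth of f leaves a Gaussian factor, which makes the product integrable. *)
Lemma gint_lebesgue f (A a : R) : measurable_fun [set: E] f -> a < (2 * e)^-1 ->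
  (forall Y, `|f Y| <= A * expR (a * sqnorm Y)) -> gint eps L f.
Proof.
move=> mf ae fA.
have mq (b : R) : measurable_fun [set: E] (fun Y : E => expR (- sqnorm Y / b)).
  apply: measurableT_comp => //; apply: measurable_funM => //.
  by apply: measurableT_comp => //; exact: measurable_sqnorm.
split; first exact: measurable_funM.
move=> c; pose k := ((2 * e)^-1 - a) / 2.
have k0 : 0 < k by rewrite /k divr_gt0// subr_gt0.
pose C := A * expR ((m * n)%:R * (c ^+ 2 / (4 * k))).
have H := integrableZl measurableT C (integrable_expNsqnorm k0).
apply: (@integrable_le _ _ _ L _ (fun Y => C * expR (- k * sqnorm Y))) => //.
  apply: measurable_funM; first exact: measurable_funM.
  by apply: measurable_expR_fun; apply: measurable_funM => //; exact: measurable_l1norm.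
move=> Y; rewrite !normrM (ger0_norm (expR_ge0 _)) (ger0_norm (expR_ge0 _)).
have A0 : 0 <= A.
  by have := le_trans (normr_ge0 _) (fA Y); rewrite pmulr_lge0 ?expR_gt0.
rewrite -mulrA -expRD.
apply: (@le_trans _ _ (A * expR (a * sqnorm Y) * expR (- sqnorm Y / (2 * e) + c * l1norm Y))).
  by rewrite ler_wpM2r ?expR_ge0.
rewrite /C -!mulrA -!expRD ler_wpM2l// ler_expR.
have := l1norm_le_sqnorm c Y k0.
have -> : - sqnorm Y / (2 * e) = - ((2 * k + a) * sqnorm Y).
  by rewrite /k; field.
by lra.
Qed.

Lemma gint_cst_lebesgue (a : R) : gint eps L (fun=> a).
Proof.
apply: (@gint_lebesgue _ `|a| 0) => //.
by move=> Y; rewrite mul0r expR0 mulr1.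
Qed.

Lemma lebesgue_mx_neq0 : L [set: E] != 0%E.
Proof.
apply/eqP => L0.
have := @integral_gk R m n eps 0; rewrite -[X in _ = X -> _]/(1%:E).
have -> : (\int[L]_Y (gk eps 0 Y)%:E = 0)%E.
  apply/eqP; rewrite eq_le integral_ge0 ?andbT => [|Y _]; last by rewrite lee_fin ltW ?gk_gt0.
  apply: (@le_trans _ _ (\int[L]_(Y in [set: E]) (cst (gpeak (m:=m) (n:=n) eps)%:E Y))%E).
    apply: ge0_le_integral => //.
    - by move=> Y _; rewrite lee_fin ltW ?gk_gt0.
    - by apply/measurable_EFinP; exact: measurable_gk.
    - by move=> Y _; rewrite lee_fin gk_le.
  by rewrite integral_cst// [X in (_ * X)%E]L0 mule0.
by move=> [] /eqP; rewrite eq_sym oner_eq0.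
Qed.

Lemma gtrans_gt0 (nu : {measure set E -> \bar R}) f X : nu [set: E] != 0%E -> gint eps nu f ->
  (forall Y, 0 < f Y) -> 0 < gtrans eps nu f X.
Proof.
move=> nu0 gf f0; apply: Rintegral_gt0 => //; first exact: integrable_gtrans.
by move=> Y; rewrite mulr_gt0 ?gk_gt0.
Qed.

Lemma gtrans_lebesgue1 X : gtrans eps L (fun=> 1) X = 1.
Proof.
rewrite /gtrans; under eq_Rintegral do rewrite mul1r.
by rewrite /Rintegral integral_gk.
Qed.

(** Differentiate the total mass, a constant, in the centre of the kernel. *)
Lemma gk_mean X i j : \int[L]_Y ((Y i j - X i j) / e * gk eps X Y) = 0.
Proof.
have D := is_derive_gtrans X (i, j) (gint_cst_lebesgue 1).
rewrite (funext gtrans_lebesgue1) in D; have [_] := D; rewrite derive_cst /gtrans /= => ->.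
by apply: eq_Rintegral => Y _; rewrite mul1r.
Qed.

(** Differentiate the mean in the centre of the kernel. *)
Lemma gk_second_moment X i j : \int[L]_Y ((Y i j - X i j) ^+ 2 * gk eps X Y) = e.
Proof.
have g1 := gint_cst_lebesgue 1; have gs Z := gint_score Z i j g1.
have gy : gint eps L (fun Y => Y i j).
  have := gint_coord i j g1; rewrite (_ : (fun Y : E => Y i j * 1) = fun Y => Y i j)//.
  by apply: funext => Y; rewrite mulr1.
have gyE Z : gtrans eps L (fun Y => Y i j) Z = Z i j.
  have := gk_mean Z i j.
  have -> : (fun Y => (Y i j - Z i j) / e * gk eps Z Y) =
      (fun Y => e^-1 * (Y i j * gk eps Z Y) - Z i j / e * (1 * gk eps Z Y)).
    by apply/funext => Y; ring.
  have i1 := integrable_gtrans Z gy; have i2 := integrable_gtrans Z g1.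
  rewrite RintegralB//; [|exact: (integrableZl measurableT e^-1 i1)
    |exact: (integrableZl measurableT (Z i j / e) i2)].
  have g1E : \int[L]_Y (1 * gk eps Z Y) = 1 := gtrans_lebesgue1 Z.
  rewrite [X in X - _]RintegralZl// [X in _ - X]RintegralZl// g1E mulr1 => h.
  have en0 : e != 0 by rewrite gt_eqF.
  have : e^-1 * (gtrans eps L (fun Y => Y i j) Z - Z i j) = 0.
    by rewrite mulrBr -h /gtrans; ring.
  by move/eqP; rewrite mulf_eq0 invr_eq0 (negbTE en0)/= subr_eq0 => /eqP.
have [_] := is_derive_gtrans X (i, j) gy.
rewrite (_ : gtrans eps L (fun Y => Y i j) = fun Z => Z i j); last by apply/funext => Z; exact: gyE.
have [_ ->] := is_derive_coord X (i, j) i j; rewrite !eqxx /= => /esym.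
have gys := gint_score X i j gy.
have -> : (fun Y => (Y i j - X i j) ^+ 2 * gk eps X Y) =
    (fun Y => e * (Y i j * ((Y i j - X i j) / e) * gk eps X Y)
       - e * (X i j) * (1 * ((Y i j - X i j) / e) * gk eps X Y)).
  by apply/funext => Y; field.
have i1 := integrable_gtrans X gys; have i2 := integrable_gtrans X (gs X).
rewrite RintegralB//; [|exact: (integrableZl measurableT e i1)
    |exact: (integrableZl measurableT (e * X i j) i2)].
rewrite !RintegralZl// /gtrans => ->.
have -> : \int[L]_Y (1 * ((Y i j - X i j) / e) * gk eps X Y) = 0.
  by rewrite -[RHS](gk_mean X i j); apply: eq_Rintegral => Y _; rewrite mul1r.
by rewrite mulr0 subr0 mulr1.
Qed.

End gaussian_bounds.

(** * Weighted Cauchy-Schwarz inequality, translated tests *)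

Section cauchy_schwarz.
Context d (T : measurableType d) (R : realType) (mu : {measure set T -> \bar R}).

(** The variance of f around its weighted mean is nonnegative. An infinite second
    moment is allowed, and makes the inequality trivial. *)
Lemma cauchy_schwarz_weight (k f : T -> R) :
  measurable_fun [set: T] k -> measurable_fun [set: T] f -> (forall x, 0 <= k x) ->
  mu.-integrable [set: T] (EFin \o k) -> 0 < \int[mu]_x k x ->
  (((\int[mu]_x (k x * f x)) ^+ 2)%:E <=
   (\int[mu]_x k x)%:E * \int[mu]_x (k x * f x ^+ 2)%:E)%E.
Proof.
move=> mk mf k0 ik; set H := \int[mu]_x k x => H0.
have kf0 x : (0 <= (k x * f x ^+ 2)%:E)%E by rewrite lee_fin mulr_ge0 ?sqr_ge0.
have B0 : (0 <= \int[mu]_x (k x * f x ^+ 2)%:E)%E by apply: integral_ge0.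
have [Boo|] := ltP (\int[mu]_x (k x * f x ^+ 2)%:E)%E +oo%E; last first.
  by rewrite leye_eq => /eqP ->; rewrite gt0_muley ?lte_fin// leey.
have ikf2 : mu.-integrable [set: T] (EFin \o (fun x => k x * f x ^+ 2)).
  apply/integrableP; split.
    by apply/measurable_EFinP/measurable_funM => //; exact: measurable_funX.
  by under eq_integral do rewrite gee0_abs ?(kf0 _)//=.
have ikf : mu.-integrable [set: T] (EFin \o (fun x => k x * f x)).
  have iS : mu.-integrable [set: T] (EFin \o (fun x => k x + k x * f x ^+ 2)).
    exact: (integrableD measurableT ik ikf2).
  apply: (integrable_le _ _ iS); first exact: measurable_funM.
  move=> x; rewrite normrM ger0_norm// -[X in _ <= X + _]mulr1 -mulrDr ler_wpM2l//.
  rewrite -(real_normK (num_real (f x))).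
  by have := sqr_ge0 (`|f x| - 1); have := normr_ge0 (f x); nra.
set A := \int[mu]_x (k x * f x); set B := \int[mu]_x (k x * f x ^+ 2).
have -> : (\int[mu]_x (k x * f x ^+ 2)%:E = B%:E)%E.
  by rewrite fineK//; exact: (integrable_fin_num _ ikf2).
rewrite -EFinM lee_fin.
pose a := A / H.
have : 0 <= \int[mu]_x (k x * (f x - a) ^+ 2).
  by apply: Rintegral_ge0 => x _; rewrite mulr_ge0 ?sqr_ge0.
have i1 : mu.-integrable [set: T] (EFin \o (fun x => (2 * a) * (k x * f x))).
  exact: (integrableZl measurableT (2 * a) ikf).
have i2 : mu.-integrable [set: T] (EFin \o (fun x => a ^+ 2 * k x)).
  exact: (integrableZl measurableT (a ^+ 2) ik).
have i3 : mu.-integrable [set: T] (EFin \o (fun x => k x * f x ^+ 2 - (2 * a) * (k x * f x))).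
  exact: (integrableB measurableT ikf2 i1).
have -> : (fun x => k x * (f x - a) ^+ 2) =
    (fun x => k x * f x ^+ 2 - (2 * a) * (k x * f x) + a ^+ 2 * k x).
  by apply/funext => x; ring.
rewrite RintegralD// RintegralB// RintegralZl// RintegralZl// -/A -/B -/H.
have -> : B - 2 * a * A + a ^+ 2 * H = (H * B - A ^+ 2) / H.
  by rewrite /a; field; rewrite gt_eqF.
by rewrite pmulr_lge0 ?invr_gt0// subr_ge0.
Qed.

Lemma Rintegral_mul_le (f g : T -> R) (h : R) : 0 < h -> sqint mu f -> sqint mu g ->
  2 * \int[mu]_x `|f x * g x| <=
  h * (\int[mu]_x (f x ^+ 2)) + h^-1 * (\int[mu]_x (g x ^+ 2)).
Proof.
move=> h0 sf sg.
have ifg := integrable_norm (integrable_mul_sqint sf sg : mu.-integrable setT (EFin \o (fun x => f x * g x))).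
have i1 : mu.-integrable [set: T] (EFin \o (fun x => h * f x ^+ 2)).
  exact: (integrableZl measurableT h (integrable_sqr sf)).
have i2 : mu.-integrable [set: T] (EFin \o (fun x => h^-1 * g x ^+ 2)).
  exact: (integrableZl measurableT h^-1 (integrable_sqr sg)).
rewrite -!RintegralZl//; try exact: integrable_sqr.
rewrite -RintegralD//; apply: le_Rintegral => //.
- exact: (integrableZl measurableT 2 ifg).
- exact: (integrableD measurableT i1 i2).
move=> x _ /=; rewrite normrM -(real_normK (num_real (f x))) -(real_normK (num_real (g x))).
rewrite -subr_ge0 (_ : _ - _ = h^-1 * (h * `|f x| - `|g x|) ^+ 2); last first.
  by field; rewrite gt_eqF.
by rewrite mulr_ge0 ?sqr_ge0// invr_ge0 ltW.
Qed.

End cauchy_schwarz.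

Section translated_tests.
Context {R : realType} {m n : nat}.
Local Notation E := 'M[R]_(m, n).

Lemma Ck_translate k (f : E -> R) (c : E) : Ck k f -> Ck k (fun X => f (X + c)).
Proof.
elim: k f => [|k IH] f Cf; split => //; try (move=> X;
  apply: (@continuous_comp _ _ _ (fun X : E => X + c)); [|exact: (Ck_continuous Cf)];
  exact: (cvgD cvg_id (cvg_cst c))).
move=> ij; have [f' df Cf'] := Cf.2 ij; exists (fun X => f' (X + c)); last exact: IH.
move=> X; apply/is_derive_lineP; have /is_derive_lineP := df (X + c).
by under eq_fun do rewrite addrA.
Qed.

Lemma test_function_translate (phi : E -> R) (c : E) ij : test_function phi ->
  test_function (fun X => phi (X + c)) /\
  partial ij (fun X => phi (X + c)) = fun X => partial ij phi (X + c).
Proof.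
move=> tphi; have [_ sphi [K cK K0]] := test_functionE tphi.
have [dphi _ _] := test_function_partial ij tphi.
split; last first.
  apply: partialE => X; apply/is_derive_lineP; have /is_derive_lineP := dphi (X + c).
  by under eq_fun do rewrite addrA.
apply: (test_functionW (K := (fun X => X - c) @` K)) => [k||X].
- exact: Ck_translate.
- apply: continuous_compact => //; apply: continuous_subspaceT => X.
  exact: (cvgD cvg_id (cvg_cst (- c))).
- move=> /eqP h; exists (X + c); last by rewrite addrK.
  by apply: contrapT => /K0.
Qed.

End translated_tests.

(** * Integrals along segments *)

Section finite_square_integrable.
Context d (T : measurableType d) (R : realType) (mu : {measure set T -> \bar R}).

Lemma integrable_finite_sqr (D : set T) (f : T -> R) : measurable D -> (mu D < +oo)%E ->
  measurable_fun D f -> (\int[mu]_(x in D) (f x ^+ 2)%:E < +oo)%E ->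
  mu.-integrable D (EFin \o f).
Proof.
move=> mD Doo mf foo.
have i1 : mu.-integrable D (EFin \o cst 1).
  apply/integrableP; split; first by apply/measurable_EFinP; exact: measurable_cst.
  under eq_integral do rewrite /= normr1.
  by rewrite integral_cst// mul1e.
have i2 : mu.-integrable D (fun x => (f x ^+ 2)%:E).
  apply/integrableP; split; first by apply/measurable_EFinP; exact: measurable_funX.
  by under eq_integral do rewrite gee0_abs ?lee_fin ?sqr_ge0//.
have i12 := integrableD mD i1 i2; apply: le_integrable i12 => //; first exact/measurable_EFinP.
move=> x _ /=; rewrite lee_fin [leRHS]ger0_norm ?addr_ge0 ?sqr_ge0//.
rewrite -(real_normK (num_real (f x))).
have := sqr_ge0 (`|f x| - 1); have := normr_ge0 (f x); nra.
Qed.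

End finite_square_integrable.

Section increments.
Context {R : realType} {m n : nat}.
Local Notation E := 'M[R]_(m, n).
Local Notation L := (@lebesgue_mx R m n).
Local Notation leb := lebesgue_measure.
Variables (v : E) (h : R).

Let line (Y : E) (t : R) : E := t *: v + Y.

Hypothesis h0 : 0 < h.
Let D : set R := `[0, h]%classic.

Let mD : measurable D. Proof. exact: measurable_itv. Qed.

Let lebD : (leb D = h%:E :> \bar R)%E.
Proof. by rewrite /D lebesgue_measure_itv/= lte_fin h0 oppr0 adde0. Qed.

Lemma measurable_line (Y : E) : measurable_fun [set: R] (fun t : R => t *: v + Y).
Proof.
have mp : measurable_fun [set: R] (fun t : R => (Y, t)) by exact: measurable_fun_pair.
exact: (measurableT_comp (measurable_shift_dir v) mp).
Qed.

Lemma ge0_integral_line (g : E -> \bar R) : measurable_fun [set: E] g ->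
  (forall Y, (0 <= g Y)%E) ->
  (\int[L]_Y \int[leb]_(t in D) g (line Y t) = h%:E * \int[L]_Y g Y)%E.
Proof.
move=> mg g0.
have mG : measurable_fun [set: E * R] (fun z : E * R => g (z.2 *: v + z.1)).
  exact: (measurableT_comp mg (measurable_shift_dir v)).
have mI : measurable_fun [set: E * R] (fun z : E * R => (\1_D z.2)%:E : \bar R).
  apply/measurable_EFinP; apply: (measurableT_comp (f := \1_D : R -> R)); last exact: measurable_snd.
  exact: measurable_indic.
pose G (z : E * R) := (g (line z.1 z.2) * (\1_D z.2)%:E)%E.
have mGG : measurable_fun [set: E * R] G by exact: emeasurable_funM.
have GG0 z : (0 <= G z)%E by rewrite mule_ge0// lee_fin.
have tr (t : R) : (\int[L]_Y g Y = \int[L]_Y g (Y + t *: v)%R)%E.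
  exact/esym/(ge0_integral_translate (t *: v) mg g0).
have mtr (t : R) : measurable_fun [set: E] (fun Y => g (Y + t *: v)).
  exact: (measurableT_comp mg (measurable_addmx _)).
transitivity (\int[L]_Y fubini_F leb G Y)%E.
  by apply: eq_integral => Y _; rewrite integral_mkcond epatch_indic.
rewrite -(fubini_tonelli1 (m1 := L) (m2 := leb) G)//.
rewrite (fubini_tonelli2 (m1 := L) (m2 := leb) G)//.
transitivity (\int[leb]_t ((\1_D t)%:E * \int[L]_Y g Y))%E.
  apply: eq_integral => t _; rewrite /fubini_G (tr t) -ge0_integralZl//.
  by apply: eq_integral => Y _; rewrite /G /line /= muleC [Y + _]addrC.
rewrite ge0_integralZr//; [|by apply/measurable_EFinP; exact: measurable_indic|exact: integral_ge0].
by rewrite integral_indic// setIT [X in (X * _)%E]lebD.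
Qed.

Lemma measurable_integral_line (g : E -> \bar R) : measurable_fun [set: E] g ->
  (forall Y, (0 <= g Y)%E) ->
  measurable_fun [set: E] (fun Y => \int[leb]_(t in D) g (line Y t))%E.
Proof.
move=> mg g0.
have mG : measurable_fun [set: E * R] (fun z : E * R => g (z.2 *: v + z.1)).
  exact: (measurableT_comp mg (measurable_shift_dir v)).
have mI : measurable_fun [set: E * R] (fun z : E * R => (\1_D z.2)%:E : \bar R).
  apply/measurable_EFinP; apply: (measurableT_comp (f := \1_D : R -> R)); last exact: measurable_snd.
  exact: measurable_indic.
pose G (z : E * R) := (g (line z.1 z.2) * (\1_D z.2)%:E)%E.
have mGG : measurable_fun [set: E * R] G by exact: emeasurable_funM.
have GG0 z : (0 <= G z)%E by rewrite mule_ge0// lee_fin.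
rewrite (_ : (fun Y => _) = fubini_F leb G); first exact: measurable_fun_fubini_tonelli_F.
by apply/funext => Y; rewrite integral_mkcond epatch_indic.
Qed.

Variable w : E -> R.
Hypothesis sw : sqint L w.

Definition increment (Y : E) : R := \int[leb]_(t in D) w (line Y t).

Let mwline Y : measurable_fun [set: R] (fun t : R => w (t *: v + Y)).
Proof. exact: (measurableT_comp sw.1 (measurable_line Y)). Qed.

Lemma increment_sqr_le Y : (((increment Y) ^+ 2)%:E <=
  h%:E * \int[leb]_(t in D) (w (line Y t) ^+ 2)%:E)%E.
Proof.
have iD : leb.-integrable [set: R] (EFin \o (\1_D : R -> R)).
  exact: integrable_indic_itv.
have ID : \int[leb]_t \1_D t = h.
  by rewrite /Rintegral integral_indic// setIT [X in fine X]lebD.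
have mI : measurable_fun [set: R] (\1_D : R -> R) by exact: measurable_indic.
have I0 (t : R) : 0 <= \1_D t :> R by [].
have H : 0 < \int[leb]_t \1_D t by rewrite ID.
have := @cauchy_schwarz_weight _ _ _ leb (\1_D : R -> R) (fun t : R => w (line Y t)).
move=> /(_ mI (mwline Y) I0 iD H).
rewrite ID => CS.
rewrite integral_mkcond epatch_indic /increment Rintegral_mkcond patch_indic.
under eq_Rintegral do rewrite /= mulrC.
by under eq_integral do rewrite /= -EFinM mulrC.
Qed.

Lemma measurable_increment : measurable_fun [set: E] increment.
Proof.
have mI : measurable_fun [set: E * R] (fun z : E * R => (\1_D z.2) : R).
  apply: (measurableT_comp (f := \1_D : R -> R)); last exact: measurable_snd.
  exact: measurable_indic.
have mG : measurable_fun [set: E * R] (fun z : E * R => (w (z.2 *: v + z.1) * \1_D z.2)%:E).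
  apply/measurable_EFinP/measurable_funM => //.
  exact: (measurableT_comp sw.1 (measurable_shift_dir v)).
rewrite (_ : increment = fine \o (fun Y =>
   fubini_F leb (fun z : E * R => (w (line z.1 z.2) * \1_D z.2)%R%:E)^\+%E Y -
   fubini_F leb (fun z : E * R => (w (line z.1 z.2) * \1_D z.2)%R%:E)^\-%E Y)%E).
  apply: measurableT_comp => //; apply: emeasurable_funB.
    by apply: measurable_fun_fubini_tonelli_F => //; exact: measurable_funepos.
  by apply: measurable_fun_fubini_tonelli_F => //; exact: measurable_funeneg.
apply/funext => Y; rewrite /increment Rintegral_mkcond patch_indic /Rintegral /=.
by congr fine; rewrite integralE; congr (_ - _)%E; apply: eq_integral => t _; rewrite ?funeposE ?funenegE.
Qed.

(** Cauchy-Schwarz on every segment, then translation invariance. *)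
Lemma integral_increment_sqr :
  (\int[L]_Y (increment Y ^+ 2)%:E <= (h ^+ 2)%:E * \int[L]_Y (w Y ^+ 2)%:E)%E.
Proof.
have mw2 : measurable_fun [set: E] (fun Y => (w Y ^+ 2)%:E).
  by apply/measurable_EFinP; exact: measurable_funX sw.1.
have w20 Y : (0 <= (w Y ^+ 2)%:E)%E by rewrite lee_fin sqr_ge0.
have mI : measurable_fun [set: E] (fun Y => \int[leb]_(t in D) (w (line Y t) ^+ 2)%:E)%E.
  exact: (measurable_integral_line mw2 w20).
have LI : (\int[L]_Y \int[leb]_(t in D) (w (line Y t) ^+ 2)%:E =
    h%:E * \int[L]_Y (w Y ^+ 2)%:E)%E by exact: (ge0_integral_line mw2 w20).
have -> : ((h ^+ 2)%:E * \int[L]_Y (w Y ^+ 2)%:E =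
    \int[L]_Y (h%:E * \int[leb]_(t in D) (w (line Y t) ^+ 2)%:E))%E.
  rewrite ge0_integralZl//; [|by move=> Y _; apply: integral_ge0|by rewrite lee_fin ltW].
  by rewrite LI muleA -EFinM.
apply: ge0_le_integral => //.
- by move=> Y _; rewrite lee_fin sqr_ge0.
- by apply/measurable_EFinP; apply: measurable_funX; exact: measurable_increment.
- by apply: emeasurable_funM => //; exact: mI.
- by move=> Y _; exact: increment_sqr_le.
Qed.

Lemma sqint_increment : sqint L increment.
Proof.
split; first exact: measurable_increment.
apply: le_lt_trans integral_increment_sqr _.
by rewrite lte_mul_pinfty// ?lee_fin ?sqr_ge0//; exact: sw.2.
Qed.

Lemma ae_integrable_line :
  {ae L, forall Y, leb.-integrable D (fun t => (w (line Y t))%:E)}.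
Proof.
have mw2 : measurable_fun [set: E] (fun Y => (w Y ^+ 2)%:E).
  by apply/measurable_EFinP; exact: measurable_funX sw.1.
have w20 Y : (0 <= (w Y ^+ 2)%:E)%E by rewrite lee_fin sqr_ge0.
have mI : measurable_fun [set: E] (fun Y => \int[leb]_(t in D) (w (line Y t) ^+ 2)%:E)%E.
  exact: (measurable_integral_line mw2 w20).
have LI : (\int[L]_Y \int[leb]_(t in D) (w (line Y t) ^+ 2)%:E =
    h%:E * \int[L]_Y (w Y ^+ 2)%:E)%E by exact: (ge0_integral_line mw2 w20).
have : L.-integrable [set: E] (fun Y => \int[leb]_(t in D) (w (line Y t) ^+ 2)%:E)%E.
  apply/integrableP; split => //.
  under eq_integral do rewrite gee0_abs ?integral_ge0//.
  by rewrite LI lte_mul_pinfty ?lee_fin ?(ltW h0)//; exact: sw.2.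
move/(integrable_ae measurableT); apply: filterS => Y /(_ I) fY.
apply: (@integrable_finite_sqr _ _ R leb D (fun t : R => w (line Y t))) => //.
- by rewrite [X in (X < _)%E]lebD ltry.
- by apply: measurable_funTS; exact: mwline.
- by rewrite -ge0_fin_numE//; apply: integral_ge0 => t _; rewrite lee_fin sqr_ge0.
Qed.

Lemma sqint_translate (c : E) : sqint L (fun Y => w (Y + c)) /\
  (\int[L]_Y (w (Y + c)%R ^+ 2)%:E = \int[L]_Y (w Y ^+ 2)%:E)%E.
Proof.
have mw2 : measurable_fun [set: E] (fun Y => (w Y ^+ 2)%:E).
  by apply/measurable_EFinP; exact: measurable_funX sw.1.
have w20 Y : (0 <= (w Y ^+ 2)%:E)%E by rewrite lee_fin sqr_ge0.
have tr := ge0_integral_translate c mw2 w20; split => //; split.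
  exact: (measurableT_comp sw.1 (measurable_addmx _)).
by rewrite tr; exact: sw.2.
Qed.

(** Fubini's theorem, the translates of w being bounded in L2. *)
Lemma increment_dual (psi : E -> R) : sqint L psi ->
  leb.-integrable D (fun t => (\int[L]_Y (w (line Y t) * psi Y))%:E) /\
  (\int[L]_Y (increment Y * psi Y)%:E =
   \int[leb]_(t in D) (\int[L]_Y (w (line Y t) * psi Y))%:E)%E.
Proof.
move=> sp.
have tw (t : R) : sqint L (fun Y => w (line Y t)) /\
    (\int[L]_Y (w (line Y t) ^+ 2)%:E = \int[L]_Y (w Y ^+ 2)%:E)%E.
  have [s1 s2] := sqint_translate (t *: v).
  have lE Y : w (Y + t *: v) = w (line Y t) by rewrite addrC.
  split; first by rewrite -(funext lE).
  by rewrite -s2; apply: eq_integral => Y _; rewrite lE.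
have iwp (t : R) := integrable_mul_sqint (tw t).1 sp.
have wpE (t : R) : (\int[L]_Y (w (line Y t) * psi Y)%:E =
    (\int[L]_Y (w (line Y t) * psi Y))%:E)%E.
  by rewrite fineK//; exact: (integrable_fin_num _ (iwp t)).
have := @fubini_itv _ _ R L 0 h (fun Y t => w (line Y t) * psi Y).
case.
- apply: measurable_funM.
    exact: (measurableT_comp sw.1 (measurable_shift_dir v)).
  exact: (measurableT_comp sp.1 measurable_fst).
- pose B := (\int[L]_Y (w Y ^+ 2)%:E + \int[L]_Y (psi Y ^+ 2)%:E)%E.
  have Boo : (B < +oo)%E by apply: lte_add_pinfty; [exact: sw.2|exact: sp.2].
  have B0 : (0 <= B)%E by apply: adde_ge0; apply: integral_ge0 => Y _; rewrite lee_fin sqr_ge0.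
  apply: (@le_lt_trans _ _ (\int[leb]_(t in D) cst B t)%E); last first.
    by rewrite integral_cst// [X in (_ * X)%E]lebD muleC lte_mul_pinfty ?lee_fin ?(ltW h0).
  apply: ge0_le_integral => //.
  - by move=> t _; apply: integral_ge0.
  - have mA : measurable_fun [set: E * R] (fun z : E * R => `|(w (line z.1 z.2) * psi z.1)%:E|%E).
      apply: measurableT_comp => //; apply/measurable_EFinP; apply: measurable_funM.
        exact: (measurableT_comp sw.1 (measurable_shift_dir v)).
      exact: (measurableT_comp sp.1 measurable_fst).
    apply: measurable_funTS.
    exact: (measurable_fun_fubini_tonelli_G (m1 := L)
      (fun z : E * R => `|(w (line z.1 z.2) * psi z.1)%:E|%E) mA (fun z => abse_ge0 _)).
  move=> t _; rewrite /B -(tw t).2.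
  have mwt : measurable_fun [set: E] (fun Y => w (line Y t)) := (tw t).1.1.
  rewrite -ge0_integralD//; last 4 first.
  - by move=> Y _; rewrite lee_fin sqr_ge0.
  - by apply/measurable_EFinP; exact: measurable_funX.
  - by move=> Y _; rewrite lee_fin sqr_ge0.
  - by apply/measurable_EFinP; exact: measurable_funX sp.1.
  apply: ge0_le_integral => //.
  - by apply: measurableT_comp => //; exact: (measurable_int _ (iwp t)).
  - by apply: emeasurable_funD; apply/measurable_EFinP; apply: measurable_funX; [|exact: sp.1].
  move=> Y _; rewrite lee_fin normrM.
  rewrite -(real_normK (num_real (w _))) -(real_normK (num_real (psi Y))).
  have := sqr_ge0 (`|w (line Y t)| - `|psi Y|); have := normr_ge0 (psi Y).
  have := normr_ge0 (w (line Y t)); nra.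
move=> i1 i2 Ei.
have aE : (fun t : R => (\int[L]_Y (w (line Y t) * psi Y))%:E) =
    (fun t : R => \int[L]_Y (w (line Y t) * psi Y)%:E)%E.
  by apply: funext => t; rewrite wpE.
rewrite aE; split; first exact: i2.
rewrite -Ei; apply: ae_eq_integral => //.
- by apply/measurable_EFinP/measurable_funM; [exact: measurable_increment|exact: sp.1].
- exact: (measurable_int _ i1).
move: ae_integrable_line; apply: filterS => Y iY _.
rewrite /increment /Rintegral.
under [RHS]eq_integral do rewrite EFinM.
rewrite integralZr// EFinM fineK//; exact: (integrable_fin_num _ iY).
Qed.

End increments.

(** * Increments of Sobolev functions *)

Lemma EFin_Rintegral d (T : measurableType d) (R : realType)
    (mu : {measure set T -> \bar R}) (D : set T) (f : T -> R) :
  measurable D -> mu.-integrable D (EFin \o f) ->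
  ((\int[mu]_(x in D) f x)%:E = \int[mu]_(x in D) (f x)%:E)%E.
Proof. by move=> mD intf; rewrite fineK//; exact: integrable_fin_num. Qed.

Section weak_increment.
Context {R : realType} {m n : nat}.
Local Notation E := 'M[R]_(m, n).
Local Notation L := (@lebesgue_mx R m n).

Lemma Rintegral_translate (c : E) (f : E -> R) : L.-integrable [set: E] (EFin \o f) ->
  \int[L]_X f (X + c) = \int[L]_X f X.
Proof. by move=> intf; congr fine; exact: (integral_translate c intf).2. Qed.

Lemma sqint_test (phi : E -> R) (K : set E) : continuous phi -> compact K ->
  (forall X, ~ K X -> phi X = 0) -> sqint L phi.
Proof.
move=> cphi cK K0; have mphi := measurable_continuous cphi; split => //.
have lphi := continuous_locally_integrable cphi.
have := integrable_loc_mul lphi cphi cK K0.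
under eq_fun do rewrite -expr2.
move=> /integrableP[_]; apply: le_lt_trans; apply: ge0_le_integral => //.
- by move=> X _; rewrite lee_fin sqr_ge0.
- by apply/measurable_EFinP; exact: measurable_funX.
- by apply: measurableT_comp => //; apply/measurable_EFinP; exact: measurable_funX.
- by move=> X _; rewrite lee_fin ler_norm.
Qed.

Lemma sqintB (f g : E -> R) : sqint L f -> sqint L g -> sqint L (fun X => f X - g X).
Proof.
move=> [mf f2] [mg g2]; split; first exact: measurable_funB.
apply: (@le_lt_trans _ _ (2%:E * \int[L]_x (f x ^+ 2)%:E + 2%:E * \int[L]_x (g x ^+ 2)%:E)%E).
  have mf2 : measurable_fun [set: E] (fun x => (f x ^+ 2)%:E).
    by apply/measurable_EFinP; exact: measurable_funX.
  have mg2 : measurable_fun [set: E] (fun x => (g x ^+ 2)%:E).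
    by apply/measurable_EFinP; exact: measurable_funX.
  rewrite -!ge0_integralZl//; try by move=> x _; rewrite lee_fin sqr_ge0.
  rewrite -ge0_integralD//; try by move=> x _; rewrite mule_ge0 ?lee_fin ?sqr_ge0.
  2,3: exact: emeasurable_funM.
  apply: ge0_le_integral => //.
  - by move=> x _; rewrite lee_fin sqr_ge0.
  - by apply/measurable_EFinP; apply: measurable_funX; exact: measurable_funB.
  - by apply: emeasurable_funD; exact: emeasurable_funM.
  - move=> x _; rewrite -!EFinM -EFinD lee_fin.
    by have := sqr_ge0 (f x + g x); nra.
by rewrite lte_add_pinfty// lte_mul_pinfty// lee_fin.
Qed.

Variables (ij : 'I_m * 'I_n) (u w : E -> R).
Hypotheses (su : sqint L u) (sw : sqint L w) (uw : is_weak_partial u ij w).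
Local Notation v := (mxdir ij : E).
Variable h : R.
Hypothesis h0 : 0 < h.

(** The fundamental theorem of calculus for weak derivatives. Tested against phi,
    both sides become the integral of u against a difference of translates of
    phi, and phi is a genuine antiderivative of its derivative. *)
Lemma weak_increment : {ae L, forall Y, u (h *: v + Y) - u Y = increment v h w Y}.
Proof.
have sinc := sqint_increment v h0 sw.
have sut : sqint L (fun Y => u (h *: v + Y)).
  have [s _] := sqint_translate su (h *: v).
  by rewrite (_ : (fun Y => _) = fun Y => u (Y + h *: v))//; apply/funext => Y; rewrite addrC.
have lut := sqint_locally_integrable sut; have lu := sqint_locally_integrable su.
have linc := sqint_locally_integrable sinc.
have : {ae L, forall Y, u (h *: v + Y) - u Y - increment v h w Y = 0}.
  apply: (@locally_integrable_ae0 _ _ _ (fun Y => u (h *: v + Y) - u Y - increment v h w Y)).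
    by apply: locally_integrableB => //; exact: locally_integrableB.
  move=> phi tphi.
  have [cphi _ [K cK K0]] := test_functionE tphi.
  have [dphi cdphi [K' cK' K'0]] := test_function_partial ij tphi.
  have sphi := sqint_test cphi cK K0.
  have sdphi : sqint L (partial ij phi) by apply: (sqint_test cdphi cK') => X /K'0[].
  have i1 := integrable_test lut tphi; have i2 := integrable_test lu tphi.
  have i3 := integrable_test linc tphi.
  have [i4 E4] := increment_dual v h0 sw sphi.
  have [i5 E5] := increment_dual (- v) h0 sdphi su.
  (* the weak derivative, against a translate of phi and translated back *)
  have tr (t : R) : \int[L]_Y (partial ij phi (t *: - v + Y) * u Y) =
      - \int[L]_Y (w (t *: v + Y) * phi Y).
    have [tt dt] := test_function_translate (t *: - v) ij tphi.
    have [_ lw /(_ _ tt)] := uw; rewrite dt => H.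
    rewrite (_ : (fun Y => partial ij phi (t *: - v + Y) * u Y) =
       (fun Y => u Y * partial ij phi (Y + t *: - v))); last first.
      by apply/funext => Y; rewrite mulrC addrC.
    rewrite H -(Rintegral_translate (t *: v) (integrable_test lw tt)).
    congr (- _); congr Rintegral; apply/funext => Y.
    by rewrite scalerN addrK [Y + _]addrC.
  have E45 : (\int[L]_Y (increment (- v) h (partial ij phi) Y * u Y)%:E =
      - \int[L]_Y (increment v h w Y * phi Y)%:E)%E.
    rewrite E4 E5 -integralN; last first.
      by rewrite fin_num_adde_defr//; exact: (integrable_pos_fin_num _ i4).
    by apply: eq_integral => t _; rewrite tr.
  have incE Y : increment (- v) h (partial ij phi) Y = phi Y - phi (Y - h *: v).
    have dF (t : R) : is_derive t 1 (fun t : R => - phi (- t *: v + Y))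
        (partial ij phi (t *: - v + Y)).
      have H := is_derive_compR (F := fun s : R => phi (s *: v + Y)) (f := fun t : R => - t)
        (is_derive_along Y dphi (- t)) (is_deriveNid (t : R) 1).
      by apply: (is_derive_eq (is_deriveN H)); rewrite scalerN scaleNr; ring.
    have cF : continuous (fun t : R => partial ij phi (t *: - v + Y)) by exact: continuous_line.
    rewrite /increment /Rintegral (integral_derivative_itv h0 dF cF) /=.
    by rewrite scaleNr oppr0 scale0r add0r opprK addrC [- _ + _]addrC.
  have iu1 : L.-integrable [set: E] (EFin \o (fun Y => u Y * phi (Y - h *: v))).
    have [it _] := integral_translate (- (h *: v)) i1.
    rewrite (_ : EFin \o _ = fun X => (u (h *: v + (X - h *: v)) * phi (X - h *: v))%:E)//.
    by apply/funext => X /=; rewrite addrCA subrr addr0.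
  have T1 : \int[L]_Y (u (h *: v + Y) * phi Y) = \int[L]_Y (u Y * phi (Y - h *: v)).
    rewrite -(Rintegral_translate (- (h *: v)) i1); congr Rintegral; apply/funext => Y.
    by rewrite addrCA subrr addr0.
  have i12 : L.-integrable [set: E] (EFin \o (fun Y => u (h *: v + Y) * phi Y - u Y * phi Y)).
    exact: (integrableB measurableT i1 i2).
  rewrite (_ : (fun Y => _) = (fun Y => (u (h *: v + Y) * phi Y - u Y * phi Y)
      - increment v h w Y * phi Y)); last by apply/funext => Y; ring.
  rewrite RintegralB// RintegralB// T1 -RintegralB//.
  apply/eqP; rewrite subr_eq0; apply/eqP.
  apply: EFin_inj; rewrite !EFin_Rintegral//; last exact: (integrableB measurableT iu1 i2).
  rewrite -[RHS]oppeK -E45 -integralN; last first.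
    have iiu := integrable_mul_sqint (sqint_increment (- v) h0 sdphi) su.
    by rewrite fin_num_adde_defr//; exact: (integrable_pos_fin_num _ iiu).
  by apply: eq_integral => Y _; rewrite incE -EFinN; congr EFin; ring.
by apply: filterS => Y /eqP; rewrite subr_eq0 => /eqP.
Qed.

End weak_increment.

(** * Gaussian transforms of squares *)

Lemma derive_local_bound (R : realType) (F : R -> R) (a : R) : is_derive (0 : R) 1 F a ->
  exists2 r : R, 0 < r & forall e, `|e| < r -> `|F e - F 0| <= (`|a| + 1) * `|e|.
Proof.
move=> [dF Fa]; have : (fun h => h^-1 *: ((F \o shift 0) (h *: 1) - F 0)) @ 0^' --> a.
  by rewrite -Fa; exact: dF.
move=> /cvgrPdist_lt /(_ 1 ltr01).
rewrite near_withinE near_nbhs /= => /nbhs_ballP[r /= r0 H].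
exists r => // e er; have [->|e0] := eqVneq e 0.
  by rewrite subrr !normr0 mulr0.
have := H e; rewrite /ball /= sub0r normrN => /(_ er e0).
rewrite addr0 [e *: 1]mulr1 => h.
have : `|e^-1 *: (F e - F 0)| <= `|a| + 1.
  rewrite -(subrK a (e^-1 *: _)) (le_trans (ler_normD _ _))// addrC lerD2l.
  by rewrite distrC ltW.
by rewrite normrM normfV ler_pdivrMl ?normr_gt0// mulrC.
Qed.

(** A one-sided expansion identifies a derivative that is known to exist. *)
Lemma derive_right_unique (R : realType) (F : R -> R) (a b C r : R) :
  is_derive (0 : R) 1 F a -> 0 < r ->
  (forall h, 0 < h < r -> `|F h - F 0 - h * b| <= C * h ^+ 2) -> a = b.
Proof.
move=> dF r0 HC.
apply/eqP; rewrite -subr_eq0 -normr_eq0; apply/eqP/le_anti; rewrite normr_ge0 andbT.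
have [dF' Fa] := dF.
have : (fun h => h^-1 *: ((F \o shift 0) (h *: 1) - F 0)) @ 0^' --> a.
  by rewrite -Fa; exact: dF'.
move=> /cvgrPdist_le H.
have key e : 0 < e -> `|a - b| <= e.
  move=> e0; have := H (e / 2); rewrite divr_gt0// => /(_ isT).
  rewrite near_withinE near_nbhs /= => /nbhs_ballP[s /= s0 Hs].
  pose h := Num.min (s / 2) (Num.min (r / 2) (e / (2 * (`|C| + 1)))).
  have C0 : 0 < 2 * (`|C| + 1) by rewrite mulr_gt0// ltr_wpDl.
  have h0 : 0 < h by rewrite /h !lt_min !divr_gt0.
  have hs : h < s by rewrite /h gt_min; apply/orP; left; lra.
  have hr : h < r by rewrite /h !gt_min; apply/orP; right; apply/orP; left; lra.
  have he : h * (2 * (`|C| + 1)) <= e.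
    by rewrite -ler_pdivlMr// /h !ge_min lexx !orbT.
  have := Hs h; rewrite /ball /= sub0r normrN (ger0_norm (ltW h0)) => /(_ hs).
  rewrite gt_eqF// addr0 [h *: 1]mulr1 => /(_ isT) h1.
  have := HC h; rewrite h0 hr => /(_ isT) h2.
  have h3 : `|h^-1 * (F h - F 0) - b| <= `|C| * h.
    rewrite (_ : _ - b = h^-1 * (F h - F 0 - h * b)); last by field; rewrite gt_eqF.
    rewrite normrM normfV (ger0_norm (ltW h0)) ler_pdivrMl// (le_trans h2)//.
    rewrite (_ : h * (`|C| * h) = `|C| * h ^+ 2); last by ring.
    by rewrite ler_wpM2r ?sqr_ge0// ler_norm.
  rewrite (_ : a - b = (a - h^-1 *: (F h - F 0)) + (h^-1 * (F h - F 0) - b)); last first.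
    by rewrite addrA subrK.
  rewrite (le_trans (ler_normD _ _))// [leRHS]splitr lerD//.
  rewrite (le_trans h3)//; have := normr_ge0 C; nra.
by apply/ler_addgt0Pl => e e0; rewrite addr0; exact: key.
Qed.

Lemma Rintegral_dist_le d (T : measurableType d) (R : realType) (mu : {measure set T -> \bar R})
    (D : set T) (a : T -> R) (h c k : R) : measurable D -> mu D = h%:E ->
  mu.-integrable D (EFin \o a) -> (forall t, D t -> `|a t - c| <= k) ->
  `|\int[mu]_(t in D) a t - h * c| <= k * h.
Proof.
move=> mD lD ia ak.
have ic (z : R) : mu.-integrable D (EFin \o (fun=> z)).
  apply/integrableP; split; first by apply/measurable_EFinP.
  by rewrite /= integral_cst// lD ltry.
have ik (z : R) : \int[mu]_(t in D) z = h * z.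
  by rewrite Rintegral_cst// mulrC lD.
have -> : \int[mu]_(t in D) a t - h * c = \int[mu]_(t in D) (a t - c).
  by rewrite -(ik c) -RintegralB.
have iac : mu.-integrable D (EFin \o (fun t => a t - c)) by exact: (integrableB mD ia (ic c)).
apply: (le_trans (le_normr_Rintegral mD iac)).
rewrite mulrC -(ik k); apply: le_Rintegral => //; first exact: integrable_norm.
Qed.

Lemma dist_doubled (R : numDomainType) (A B C p c t h : R) :
  `|A - 2 * B| <= p * h -> `|B - C| <= c * t -> t <= h -> 0 <= c ->
  `|A - 2 * C| <= (p + 2 * c) * h.
Proof.
move=> h1 h2 th c0; rewrite (_ : A - 2 * C = (A - 2 * B) + 2 * (B - C)); last by ring.
rewrite (le_trans (ler_normD _ _))// [leRHS]mulrDl lerD//.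
by rewrite normrM ger0_norm// -mulrA ler_pM2l// (le_trans h2)// ler_wpM2l.
Qed.

Section square_derivative.
Context {R : realType} {m n : nat} (eps : {posnum R}).
Local Notation E := 'M[R]_(m, n).
Local Notation L := (@lebesgue_mx R m n).
Local Notation leb := lebesgue_measure.
Variables (ij : 'I_m * 'I_n) (u w : E -> R).
Hypotheses (su : sqint L u) (sw : sqint L w) (uw : is_weak_partial u ij w).
Local Notation v := (mxdir ij : E).

Let W := \int[L]_Y (w Y ^+ 2).

Let W0 : 0 <= W. Proof. by apply: Rintegral_ge0 => Y _; exact: sqr_ge0. Qed.

Let shift_u (s : R) : sqint L (fun Y => u (s *: v + Y)).
Proof.
have [H _] := sqint_translate su (s *: v).
by rewrite (_ : (fun Y => _) = fun Y => u (Y + s *: v))//; apply/funext => Y; rewrite addrC.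
Qed.

Let shift_w (s : R) : sqint L (fun Y => w (s *: v + Y)).
Proof.
have [H _] := sqint_translate sw (s *: v).
by rewrite (_ : (fun Y => _) = fun Y => w (Y + s *: v))//; apply/funext => Y; rewrite addrC.
Qed.

Let shiftE (f : E -> R) (s : R) : L.-integrable [set: E] (EFin \o f) ->
  \int[L]_Y f (s *: v + Y) = \int[L]_Y f Y.
Proof.
move=> intf; rewrite -(Rintegral_translate (s *: v) intf).
by congr Rintegral; apply/funext => Y; rewrite addrC.
Qed.

Lemma difference_sqr_le (s : R) : 0 <= s ->
  \int[L]_Y ((u (s *: v + Y) - u Y) ^+ 2) <= s ^+ 2 * W.
Proof.
rewrite le_eqVlt => /predU1P[<-|s0].
  rewrite expr0n mul0r (_ : (fun Y => _) = fun=> 0) ?Rintegral_cst ?mul0r//.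
  by apply/funext => Y; rewrite scale0r add0r subrr expr0n.
have sd := sqintB (shift_u s) su.
rewrite -lee_fin EFinM !EFin_Rintegral//; [|exact: integrable_sqr..].
apply: le_trans (integral_increment_sqr v s0 sw).
rewrite le_eqVlt; apply/orP; left; apply/eqP; apply: ae_eq_integral => //.
- by apply/measurable_EFinP; exact: measurable_funX sd.1.
- by apply/measurable_EFinP; apply: measurable_funX; exact: measurable_increment.
- by move: (weak_increment su sw uw s0); apply: filterS => Y -> _.
Qed.

Lemma difference_sqr_le2 (s t : R) : 0 <= t <= s ->
  \int[L]_Y ((u (s *: v + Y) - u (t *: v + Y)) ^+ 2) <= s ^+ 2 * W.
Proof.
move=> /andP[t0 ts].
have sd := sqintB (shift_u (s - t)) su.
rewrite (_ : (fun Y => _) = fun Y => (fun Z => (u ((s - t) *: v + Z) - u Z) ^+ 2) (t *: v + Y)).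
  have -> := @shiftE (fun Z => (u ((s - t) *: v + Z) - u Z) ^+ 2) t (integrable_sqr sd).
  apply: (le_trans (difference_sqr_le _)); first by rewrite subr_ge0.
  by rewrite ler_wpM2r// ler_sqr ?nnegrE; lra.
by apply/funext => Y; rewrite addrA -scalerDl subrK.
Qed.

Lemma gint_uw : gint eps L (fun Y => u Y * w Y).
Proof. by apply: gint_integrable; exact: integrable_mul_sqint. Qed.

Lemma gint_usq : gint eps L (fun Y => u Y ^+ 2).
Proof. by apply: gint_integrable; exact: integrable_sqr. Qed.

Lemma gk_translate (c X Y : E) : gk eps (c + X) (c + Y) = gk eps X Y.
Proof. by rewrite !gkE (_ : c + Y - (c + X) = Y - X)// opprD addrACA subrr add0r. Qed.

(** The kernel depends on the difference of its arguments only, so that moving the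
    centre amounts to translating the function. *)
Lemma gtrans_translate f (s : R) X : gint eps L f ->
  gtrans eps L f (s *: v + X) = \int[L]_Y (f (s *: v + Y) * gk eps X Y).
Proof.
move=> gf; rewrite /gtrans -(@shiftE (fun Y => f Y * gk eps (s *: v + X) Y) s (integrable_gtrans _ gf)).
by congr Rintegral; apply/funext => Y; rewrite gk_translate.
Qed.

Let sqint_gk (f : E -> R) X : sqint L f -> sqint L (fun Y => f Y * gk eps X Y).
Proof.
move=> [mf f2]; have mg : measurable_fun [set: E] (fun Y => f Y * gk eps X Y).
  by apply: measurable_funM => //; exact: measurable_gk.
split => //; apply: (@le_lt_trans _ _ ((@gpeak R m n eps ^+ 2)%:E * \int[L]_x (f x ^+ 2)%:E)%E).
  have mf2 : measurable_fun [set: E] (fun x => (f x ^+ 2)%:E).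
    by apply/measurable_EFinP; exact: measurable_funX.
  rewrite -ge0_integralZl//; last 2 first.
  - by move=> x _; rewrite lee_fin sqr_ge0.
  - by rewrite lee_fin sqr_ge0.
  apply: ge0_le_integral => //.
  - by move=> x _; rewrite lee_fin sqr_ge0.
  - by apply/measurable_EFinP; exact: measurable_funX.
  - exact: emeasurable_funM.
  move=> x _; rewrite -EFinM lee_fin exprMn mulrC ler_wpM2r ?sqr_ge0//.
  by rewrite ler_sqr ?nnegrE ?(ltW (gk_gt0 _ _ _)) ?(ltW (gpeak_gt0 _))// gk_le.
by rewrite lte_mul_pinfty// lee_fin sqr_ge0.
Qed.

Let integrable_gk (f g : E -> R) X : sqint L f -> sqint L g ->
  L.-integrable [set: E] (EFin \o (fun Y => f Y * g Y * gk eps X Y)).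
Proof.
move=> sf sg; have := integrable_mul_sqint sf (sqint_gk X sg).
by apply: eq_integrable => // Y _ /=; rewrite mulrA.
Qed.

Let sqintD (f g : E -> R) : sqint L f -> sqint L g -> sqint L (fun Y => f Y + g Y).
Proof.
move=> sf [mg g2]; have sNg : sqint L (fun Y => - g Y).
  by split; [exact: measurableT_comp|under eq_integral do rewrite sqrrN].
by have := sqintB sf sNg; under eq_fun do rewrite opprK.
Qed.

(** Replacing u(hv + Y) + u(Y) by 2 u(tv + Y) costs two increments of u, whose L2
    norms are of order h. *)
Let average_dist X (t h : R) : 0 < h -> 0 <= t <= h ->
  `|\int[L]_Y (w (t *: v + Y) * ((u (h *: v + Y) + u Y) * gk eps X Y))
    - 2 * gtrans eps L (fun Y => u Y * w Y) (t *: v + X)| <= 3 * @gpeak R m n eps * W * h.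
Proof.
move=> h0 /andP[t0 th].
set P := @gpeak R m n eps; have P0 : 0 < P by exact: gpeak_gt0.
pose f Y := w (t *: v + Y); pose ut Y := u (t *: v + Y).
pose d1 Y := u (h *: v + Y) - ut Y; pose d2 Y := u Y - ut Y.
have sf : sqint L f := shift_w t; have sut : sqint L ut := shift_u t.
have sd1 : sqint L d1 by exact: sqintB (shift_u h) sut.
have sd2 : sqint L d2 by exact: sqintB su sut.
pose g Y := d1 Y + d2 Y; have sg : sqint L g := sqintD sd1 sd2.
have iA := integrable_gk X sf (sqintD (shift_u h) su).
have iB := integrable_gk X sf sut.
have -> : \int[L]_Y (w (t *: v + Y) * ((u (h *: v + Y) + u Y) * gk eps X Y))
    - 2 * gtrans eps L (fun Y => u Y * w Y) (t *: v + X) =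
    \int[L]_Y (f Y * g Y * gk eps X Y).
  rewrite (gtrans_translate _ _ gint_uw).
  have iB2 : L.-integrable [set: E] (EFin \o (fun Y => 2 * (f Y * ut Y * gk eps X Y))).
    by have := integrableZl measurableT 2 iB; apply: eq_integrable.
  rewrite -RintegralZl//; last by move: iB; apply: eq_integrable => // Y _ /=; rewrite [f Y * _]mulrC.
  transitivity (\int[L]_Y (f Y * (u (h *: v + Y) + u Y) * gk eps X Y - 2 * (f Y * ut Y * gk eps X Y))).
    rewrite RintegralB//; congr (_ - _); congr Rintegral; apply/funext => Y; rewrite /f /ut; ring.
  by congr Rintegral; apply/funext => Y; rewrite /g /d1 /d2; ring.
have ifg := integrable_mul_sqint sf sg.
have iN : L.-integrable [set: E] (EFin \o (fun Y => P * `|f Y * g Y|)).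
  have := integrableZl measurableT P (integrable_norm ifg).
  by apply: eq_integrable.
apply: (le_trans (le_normr_Rintegral measurableT (integrable_gk X sf sg))).
apply: (@le_trans _ _ (\int[L]_Y (P * `|f Y * g Y|))).
  apply: le_Rintegral => //; first exact: integrable_norm (integrable_gk X sf sg).
  move=> Y _; rewrite normrM mulrC (ger0_norm (ltW (gk_gt0 _ _ _))) ler_wpM2r//.
  exact: gk_le.
rewrite RintegralZl//; last exact: integrable_norm ifg.
have fW : \int[L]_Y (f Y ^+ 2) = W by exact: (@shiftE (fun Y => w Y ^+ 2) t (integrable_sqr sw)).
have gW : \int[L]_Y (g Y ^+ 2) <= 4 * h ^+ 2 * W.
  have i1 : L.-integrable [set: E] (EFin \o (fun Y => 2 * d1 Y ^+ 2)).
    by have := integrableZl measurableT 2 (integrable_sqr sd1); apply: eq_integrable.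
  have i2 : L.-integrable [set: E] (EFin \o (fun Y => 2 * d2 Y ^+ 2)).
    by have := integrableZl measurableT 2 (integrable_sqr sd2); apply: eq_integrable.
  have i12 : L.-integrable [set: E] (EFin \o (fun Y => 2 * d1 Y ^+ 2 + 2 * d2 Y ^+ 2)).
    exact: (integrableD measurableT i1 i2).
  apply: (@le_trans _ _ (\int[L]_Y (2 * d1 Y ^+ 2 + 2 * d2 Y ^+ 2))).
    apply: le_Rintegral => //; first exact: integrable_sqr.
    by move=> Y _; rewrite /g; have := sqr_ge0 (d1 Y - d2 Y); nra.
  rewrite RintegralD// !RintegralZl//; [|exact: integrable_sqr..].
  have D1 : \int[L]_Y (d1 Y ^+ 2) <= h ^+ 2 * W by apply: difference_sqr_le2; rewrite t0.
  have D2 : \int[L]_Y (d2 Y ^+ 2) <= h ^+ 2 * W.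
    rewrite (_ : (fun Y => _) = fun Y => (ut Y - u Y) ^+ 2); last first.
      by apply/funext => Y; rewrite -sqrrN opprB.
    apply: (le_trans (difference_sqr_le t0)); rewrite ler_wpM2r// ler_sqr ?nnegrE//; lra.
  lra.
have := Rintegral_mul_le h0 sf sg; rewrite fW => H.
have H2 : h^-1 * \int[L]_Y g Y ^+ 2 <= 4 * h * W.
  rewrite ler_pdivrMl//; apply: (le_trans gW); rewrite le_eqVlt; apply/orP; left; apply/eqP; ring.
have H3 : \int[L]_Y `|f Y * g Y| <= 3 * W * h by have := W0; nra.
by rewrite (_ : 3 * P * W * h = P * (3 * W * h)); [rewrite ler_pM2l|ring].
Qed.

(** Differentiating a Gaussian transform of the square of a Sobolev function
    moves the derivative from the kernel to the function. The square of u is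
    handled by its difference quotients, whose increments are the line
    integrals of w, so that the error is of second order in the step. *)
Lemma gtrans_sqr_derivative (X : E) :
  gtrans eps L (fun Y => u Y ^+ 2 * ((Y ij.1 ij.2 - X ij.1 ij.2) / eps%:num)) X =
  2 * gtrans eps L (fun Y => u Y * w Y) X.
Proof.
set q := gtrans eps L (fun Y => u Y * w Y).
pose F (t : R) := gtrans eps L (fun Y => u Y ^+ 2) (t *: v + X).
pose Q (t : R) := q (t *: v + X).
pose b := gtrans eps L (fun Y => u Y * w Y * ((Y ij.1 ij.2 - X ij.1 ij.2) / eps%:num)) X.
have dF : is_derive (0 : R) 1 F (gtrans eps L (fun Y => u Y ^+ 2 * ((Y ij.1 ij.2 - X ij.1 ij.2) / eps%:num)) X).
  have H := is_derive_gtrans X ij gint_usq.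
  exact: (iffLR (is_derive_lineP _ _ _ _) H).
have dQ : is_derive (0 : R) 1 Q b.
  have H := is_derive_gtrans X ij gint_uw.
  exact: (iffLR (is_derive_lineP _ _ _ _) H).
have [r r0 QL] := derive_local_bound dQ.
apply: (derive_right_unique (C := 3 * @gpeak R m n eps * W + 2 * (`|b| + 1)) dF r0).
move=> h /andP[h0 hr].
pose psi Y := (u (h *: v + Y) + u Y) * gk eps X Y.
have spsi : sqint L psi := sqint_gk X (sqintD (shift_u h) su).
have [ia Ea] := increment_dual v h0 sw spsi.
have Q0 : Q 0 = q X by rewrite /Q scale0r add0r.
have E1 : F h - F 0 = \int[L]_Y (increment v h w Y * psi Y).
  rewrite /F scale0r add0r (gtrans_translate _ _ gint_usq) /gtrans.
  have i1 := integrable_gk X (shift_u h) (shift_u h).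
  have i2 := integrable_gk X su su.
  have i12 := integrableB measurableT i1 i2.
  transitivity (\int[L]_Y (u (h *: v + Y) * u (h *: v + Y) * gk eps X Y - u Y * u Y * gk eps X Y)).
    by rewrite RintegralB.
  rewrite /Rintegral; congr (fine _).
  apply: ae_eq_integral; first exact: measurableT.
  - exact: (measurable_int _ i12).
  - apply/measurable_EFinP; apply: measurable_funM spsi.1.
    exact: (sqint_increment v h0 sw).1.
  move: (weak_increment su sw uw h0); apply: filterS => Y <- _; rewrite /psi; congr EFin; ring.
have lD : (leb (`[0%R, h]%classic : set R) = h%:E)%E.
  by rewrite lebesgue_measure_itv/= lte_fin h0 oppr0 adde0.
rewrite E1 -/q -Q0.
have -> : \int[L]_Y (increment v h w Y * psi Y) =
    \int[leb]_(t in `[0, h]) (\int[L]_Y (w (t *: v + Y) * psi Y)).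
  exact: (congr1 fine Ea).
have := @Rintegral_dist_le _ _ R leb `[0%R, h]%classic
  (fun t : R => \int[L]_Y (w (t *: v + Y) * psi Y)) h (2 * Q 0)
  ((3 * @gpeak R m n eps * W + 2 * (`|b| + 1)) * h).
rewrite -[_ * h * h]mulrA -expr2; apply; [exact: measurable_itv|exact: lD|exact: ia|].
move=> t; rewrite /= in_itv /= => /andP[t0 th].
have := average_dist X h0; move=> /(_ t); rewrite t0 th => /(_ isT) A1.
have A2 := QL t; rewrite (ger0_norm t0) (le_lt_trans th hr) in A2.
move: (A2 isT) => {}A2.
apply: (dist_doubled A1 A2 th).
by rewrite addr_ge0.
Qed.

End square_derivative.

(** * Densities and energies *)

Lemma measurable_sqrt (R : realType) : measurable_fun [set: R] (@Num.sqrt R).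
Proof. by apply: continuous_measurable_fun; exact: sqrt_continuous. Qed.

Section densities.
Local Open Scope charge_scope.
Context {R : realType} {m n : nat}.
Local Notation E := 'M[R]_(m, n).
Local Notation L := (@lebesgue_mx R m n).
Implicit Types (mu : probability E R) (f u : E -> R).

Definition has_density mu f := [/\ measurable_fun [set: E] f, forall x, 0 <= f x &
  forall A, measurable A -> mu A = (\int[L]_(x in A) (f x)%:E)%E].

Lemma density_ae mu f : has_density mu f ->
  [/\ mu `<< L, measurable_fun [set: E] (density mu) &
      {ae L, forall x, density mu x = f x}].
Proof.
move=> [mf f0 fE].
have muL : mu `<< L.
  apply/null_content_dominatesP => A mA LA; rewrite fE//; apply: null_set_integral => //.
  by apply/measurable_EFinP; exact: measurable_funTS.
have muL' : charge_of_finite_measure mu `<< L by exact: muL.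
have iRN := Radon_Nikodym_integrable muL'; split => //.
  by apply: measurableT_comp => //; exact: (measurable_int _ iRN).
have : ae_eq L [set: E] ('d (charge_of_finite_measure mu) '/d L) (EFin \o f).
  apply: integral_ae_eq => //; first exact/measurable_EFinP.
  by move=> A _ mA; rewrite -Radon_Nikodym_integral// -fE.
by apply: filterS => x /(_ I); rewrite /density => ->.
Qed.

Lemma has_density_sqrt mu : mu `<< L -> has_density mu (fun x => sqrt_density mu x ^+ 2).
Proof.
move=> muL; have muL' : charge_of_finite_measure mu `<< L by exact: muL.
have iRN := Radon_Nikodym_integrable muL'.
have md : measurable_fun [set: E] (density mu).
  by apply: measurableT_comp => //; exact: (measurable_int _ iRN).
have mu2 : measurable_fun [set: E] (fun x => sqrt_density mu x ^+ 2).
  apply: measurable_funX; apply: measurableT_comp => //.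
  exact: measurable_sqrt.
split => // [x|A mA]; first exact: sqr_ge0.
have -> : mu A = (\int[L]_(x in A) ('d (charge_of_finite_measure mu) '/d L) x)%E.
  exact: (Radon_Nikodym_integral muL' mA).
apply: ae_eq_integral => //.
- by apply: measurable_funTS; exact: (measurable_int _ iRN).
- by apply/measurable_EFinP; exact: measurable_funTS.
have := ae_eq_Radon_Nikodym_SigmaFinite muL mA; apply: filterS => x H xA.
have := H xA; rewrite /sqrt_density /density => H'.
have fin := Radon_Nikodym_fin_num x muL'.
rewrite sqr_sqrtr ?fineK// -lee_fin fineK// -H'.
exact: Radon_Nikodym_SigmaFinite.f_ge0.
Qed.

Lemma has_density_sqint mu u : (forall x, 0 <= u x) -> measurable_fun [set: E] u ->
  has_density mu (fun x => u x ^+ 2) -> sqint L u.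
Proof.
move=> u0 mu_ [_ _ H]; split => //.
have := H setT measurableT; rewrite probability_setT => <-.
exact: ltry.
Qed.

Lemma integral_sum_sqr (g : 'I_m * 'I_n -> E -> R) : (forall ij, measurable_fun [set: E] (g ij)) ->
  (\int[L]_x (\sum_ij g ij x ^+ 2)%:E = \sum_ij \int[L]_x (g ij x ^+ 2)%:E)%E.
Proof.
move=> mg; under eq_integral do rewrite -sumEFin.
rewrite ge0_integral_sum// => [ij|ij x _]; last by rewrite lee_fin sqr_ge0.
by apply/measurable_EFinP; exact: measurable_funX.
Qed.

(** Densities and weak derivatives are unique up to null sets, so that the energy can
    be computed from any choice of them. *)
Lemma energyE mu u (g : 'I_m * 'I_n -> E -> R) :
  (forall x, 0 <= u x) -> measurable_fun [set: E] u -> has_density mu (fun x => u x ^+ 2) ->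
  (forall ij, is_weak_partial u ij (g ij)) -> (forall ij, sqint L (g ij)) ->
  P12 mu /\ energy mu = (\sum_ij \int[L]_x (g ij x ^+ 2)%:E)%E.
Proof.
move=> u0 mu_ du wg sg.
have [muL md dE] := density_ae du.
have ms : measurable_fun [set: E] (sqrt_density mu).
  by apply: measurableT_comp => //; exact: measurable_sqrt.
have sE : {ae L, forall x, u x = sqrt_density mu x}.
  by apply: filterS dE => x; rewrite /sqrt_density => ->; rewrite sqrtr_sqr ger0_norm.
have wsg ij : is_weak_partial (sqrt_density mu) ij (g ij) by exact: (eq_ae_weak_partial ms sE (wg ij)).
have P : P12 mu.
  split => //; split; last by move=> ij; exists (g ij) => //; apply/Lfun2P.
  apply/Lfun2P; split => //.
  have [_ su] := has_density_sqint u0 mu_ du.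
  rewrite (_ : (\int[L]_x _ = \int[L]_x (u x ^+ 2)%:E)%E)//.
  apply: ae_eq_integral; first exact: measurableT.
  - by apply/measurable_EFinP; exact: measurable_funX.
  - by apply/measurable_EFinP; exact: measurable_funX.
  - by apply: filterS sE => x ->.
split => //; rewrite /energy asboolT// -integral_sum_sqr; last by move=> ij; exact: (sg ij).1.
have mw ij : measurable_fun [set: E] (weak_partial (sqrt_density mu) ij).
  by have [[_ [] //]] := weak_partial_spec (wsg ij).
apply: ae_eq_integral; first exact: measurableT.
- by apply/measurable_EFinP; apply: measurable_sum => ij; exact: measurable_funX.
- by apply/measurable_EFinP; apply: measurable_sum => ij; apply: measurable_funX; exact: (sg ij).1.
have : {ae L, forall x, forall ij, weak_partial (sqrt_density mu) ij x = g ij x}.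
  apply: filter_forall => ij; exact: (weak_partial_spec (wsg ij)).2.
by apply: filterS => x H _; congr EFin; apply: eq_bigr => ij _; rewrite H.
Qed.

Lemma P12E mu : P12 mu -> exists (g : 'I_m * 'I_n -> E -> R),
  [/\ has_density mu (fun x => sqrt_density mu x ^+ 2), measurable_fun [set: E] (sqrt_density mu),
   (forall ij, is_weak_partial (sqrt_density mu) ij (g ij)),
   (forall ij, sqint L (g ij)) &
   energy mu = (\sum_ij \int[L]_x (g ij x ^+ 2)%:E)%E].
Proof.
move=> P; have [muL [/Lfun2P[ms s2] wg]] := P.
have hd := has_density_sqrt muL.
have /choice[g gP] : forall ij, exists g, sqint L g /\ is_weak_partial (sqrt_density mu) ij g.
  by move=> ij; have [g /Lfun2P ? ?] := wg ij; exists g.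
exists g; split => // [ij|ij|]; [exact: (gP ij).2|exact: (gP ij).1|].
have s0 x : 0 <= sqrt_density mu x by exact: sqrtr_ge0.
exact: (energyE s0 ms hd (fun ij => (gP ij).2) (fun ij => (gP ij).1)).2.
Qed.

End densities.

(** * Products of densities over the rows *)

Lemma ge0_integral_density (R : realType) m n (mu : probability 'M[R]_(m, n) R) f g :
  has_density mu f -> measurable_fun [set: 'M[R]_(m, n)] g -> (forall x, (0 <= g x)%E) ->
  (\int[mu]_x g x = \int[lebesgue_mx]_x (g x * (f x)%:E))%E.
Proof.
move=> hd mg g0; have [muL _ dE] := density_ae hd; have [mf f0 fE] := hd.
rewrite -(Radon_Nikodym_SigmaFinite.change_of_variables muL)//.
have iRN := Radon_Nikodym_SigmaFinite.f_integrable muL.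
apply: ae_eq_integral; first exact: measurableT.
- by apply: emeasurable_funM => //; exact: (measurable_int _ iRN).
- by apply: emeasurable_funM => //; exact/measurable_EFinP.
have := ae_eq_Radon_Nikodym_SigmaFinite muL measurableT.
apply: filterS2 dE => x dE H _; rewrite (H I) -dE /density fineK//.
exact: Radon_Nikodym_fin_num.
Qed.

Section row_products.
Context {R : realType} (N d : nat).
Local Notation E := 'M[R]_(N, d).
Local Notation V := 'rV[R]_d.
Local Notation L := (@lebesgue_mx R N d).
Variable nu : 'I_N -> probability V R.

Lemma prod_rows_setT : prod_rows nu [set: E] = 1%E.
Proof.
have := @integral_rows_prod R N d nu (fun _ _ => 1%E).
move=> /(_ (fun=> measurable_cst _) (fun _ _ => lee01)).
have -> : (\prod_(k < N) \int[nu k]_x 1 = 1)%E.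
  by rewrite big1// => k _; rewrite integral_cst// mul1e; exact: probability_setT.
move=> <-; transitivity (\int[prod_rows nu]_X (cst 1%E X : \bar R))%E.
  by rewrite integral_cst// mul1e.
by apply: eq_integral => X _; rewrite big1.
Qed.

HB.instance Definition _ := Measure_isProbability.Build _ _ _ (prod_rows nu) prod_rows_setT.

Variable f : 'I_N -> V -> R.
Hypothesis hd : forall k, has_density (nu k) (f k).

Lemma measurable_row_prod (g : 'I_N -> V -> R) (P : pred 'I_N) :
  (forall k, measurable_fun [set: V] (g k)) ->
  measurable_fun [set: E] (fun X => \prod_(k | P k) g k (row k X)).
Proof.
move=> mg; rewrite (_ : (fun X => _) = fun X => \prod_k (if P k then g k (row k X) else 1)).
  apply: measurable_prod => k _; case: (P k) => //.
  exact: (measurableT_comp (mg k) (measurable_row k)).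
by apply/funext => X; rewrite big_mkcond.
Qed.

(** Both measures take the same values on boxes. *)
Lemma prod_rows_density : has_density (prod_rows nu) (fun X => \prod_k f k (row k X)).
Proof.
have mF : measurable_fun [set: E] (fun X => \prod_k f k (row k X)).
  by apply: (@measurable_row_prod f xpredT) => k; have [] := hd k.
have F0 X : 0 <= \prod_k f k (row k X).
  by apply: prodr_ge0 => k _; have [_ + _] := hd k; exact.
split => // A mA.
have mF' : measurable_fun [set: E] (EFin \o (fun X => \prod_k f k (row k X))) by exact/measurable_EFinP.
have F0' X : (0 <= (EFin \o (fun X => \prod_k f k (row k X))%R) X)%E by rewrite lee_fin.
rewrite (measure_eq_box (m1 := prod_rows nu) (m2 := weighted L mF' F0'))//; last first.
  by move=> a b; rewrite (le_lt_trans (probability_le1 _ (measurable_box a b)))// ltry.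
move=> a b; transitivity (\prod_k nu k (box (row k a) (row k b)))%E.
  exact: (@rows_prod_box R N d (fun k => nu k) a b).
rewrite /= /weighted.
rewrite integral_mkcond epatch_indic.
transitivity (\int[L]_X \prod_k
  ((f k (row k X))%:E * (\1_(box (row k a) (row k b)) (row k X))%:E))%E; last first.
  apply: eq_integral => X _ /=.
  by rewrite indic_box_rows -prodEFin -big_split.
rewrite (integral_lebesgue_rows_prod
  (f := fun k x => ((f k x)%:E * (\1_(box (row k a) (row k b)) x)%:E)%E)).
- apply: eq_bigr => k _; have [mf f0 ->] := hd k; last exact: measurable_box.
  by rewrite integral_mkcond epatch_indic.
- move=> k; have [mf _ _] := hd k.
  by apply: emeasurable_funM; [exact/measurable_EFinP|exact: measurable_indic_box].
- by move=> k x; have [_ f0 _] := hd k; rewrite mule_ge0 ?lee_fin.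
Qed.

End row_products.

(** * The ratio of the smoothing to the product of its marginals *)

Lemma measurable_funV_gt0 d (T : measurableType d) (R : realType) (f : T -> R) :
  measurable_fun [set: T] f -> (forall x, 0 < f x) -> measurable_fun [set: T] (fun x => (f x)^-1).
Proof.
move=> mf f0; rewrite (_ : (fun x => _) = fun x => expR (- ln (f x))).
  apply: measurableT_comp; first exact: measurable_expR.
  apply: measurable_funN.
  by apply: measurableT_comp => //; exact: measurable_ln.
by apply/funext => x; rewrite expRN lnK ?posrE.
Qed.

Section transforms.
Context {R : realType} (eps : {posnum R}).
Local Notation e := (eps%:num).

Lemma probability_neq0 d (T : measurableType d) (nu : probability T R) : nu [set: T] != 0%E.
Proof. by have -> : nu [set: T] = 1%E := probability_setT nu. Qed.

Lemma sqnormB_le m n (s : R) (X Y : 'M[R]_(m, n)) : 0 < s ->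
  sqnorm (X - Y) <= (1 + s^-1) * sqnorm X + (1 + s) * sqnorm Y.
Proof.
move=> s0; rewrite /sqnorm !mulr_sumr -big_split /=; apply: ler_sum => i _.
rewrite !mulr_sumr -big_split /=; apply: ler_sum => j _; rewrite !mxE.
rewrite -subr_ge0 (_ : _ - _ = s^-1 * (X i j + s * Y i j) ^+ 2).
  by rewrite mulr_ge0 ?sqr_ge0// invr_ge0 ltW.
by field; rewrite gt_eqF.
Qed.

Lemma gint_probability m n (nu : probability 'M[R]_(m, n) R) : gint eps nu (fun=> 1).
Proof.
apply: gint_integrable; apply/integrableP; split; first exact/measurable_EFinP.
under eq_integral do rewrite /= normr1.
rewrite integral_cst// mul1e (le_lt_trans (probability_le1 nu measurableT))//; exact: ltry.
Qed.

Lemma smoothing_gtrans m n (nu : probability 'M[R]_(m, n) R) Y :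
  smoothing_pdf eps nu Y = gtrans eps nu (fun=> 1) Y.
Proof. by congr Rintegral; apply/funext => X; rewrite mul1r gkC. Qed.

Lemma smoothing_pdf_gt0 m n (nu : probability 'M[R]_(m, n) R) Y : 0 < smoothing_pdf eps nu Y.
Proof.
rewrite smoothing_gtrans; apply: gtrans_gt0 => //; last exact: gint_probability.
exact: probability_neq0.
Qed.

Lemma heat_conv_smoothing d (nu : probability 'rV[R]_d R) y :
  heat_conv_pdf eps nu y = smoothing_pdf eps nu y.
Proof. by congr Rintegral; apply/funext => x; rewrite big_ord1 !row_id. Qed.

Lemma gtrans_density m n (nu : probability 'M[R]_(m, n) R) (f : 'M[R]_(m, n) -> R) Y :
  has_density nu f -> smoothing_pdf eps nu Y = gtrans eps lebesgue_mx f Y.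
Proof.
move=> hd; have [mf f0 _] := hd; rewrite smoothing_gtrans /gtrans /Rintegral; congr fine.
have mK : measurable_fun [set: 'M[R]_(m, n)] (fun X => (gk eps Y X)%:E : \bar R).
  by apply/measurable_EFinP; exact: measurable_gk.
have K0 X : (0 <= (gk eps Y X)%:E)%E by rewrite lee_fin ltW// gk_gt0.
under eq_integral do rewrite mul1r.
rewrite (ge0_integral_density hd mK K0).
by apply: eq_integral => X _; rewrite -EFinM mulrC.
Qed.

Lemma gint_density m n (nu : probability 'M[R]_(m, n) R) (f : 'M[R]_(m, n) -> R) :
  has_density nu f -> gint eps lebesgue_mx f.
Proof.
move=> [mf f0 H]; apply: gint_integrable; apply/integrableP; split; first exact/measurable_EFinP.
under eq_integral do rewrite gee0_abs ?lee_fin//.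
by rewrite -H// probability_setT ltry.
Qed.

(** Moving the centre of the kernel to the origin costs a factor 1 + s in the
    exponent, for any s > 0. *)
Lemma smoothing_lower m n (nu : probability 'M[R]_(m, n) R) (s : R) : 0 < s ->
  exists2 c : R, 0 < c & forall Y,
    c * expR (- (1 + s) * sqnorm Y / (2 * e)) <= smoothing_pdf eps nu Y.
Proof.
move=> s0; have P0 := gpeak_gt0 (m := m) (n := n) eps.
pose a := - (1 + s^-1) / (2 * e).
have mf : measurable_fun [set: 'M[R]_(m, n)] (fun X => @gpeak R m n eps * expR (a * sqnorm X)).
  apply: measurable_funM => //; apply: measurable_expR_fun; apply: measurable_funM => //.
  exact: measurable_sqnorm.
have a0 : a <= 0.
  by rewrite /a mulNr oppr_le0 divr_ge0 ?mulr_ge0// addr_ge0// invr_ge0 ltW.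
have i1 : nu.-integrable setT (EFin \o (fun X : 'M[R]_(m, n) => @gpeak R m n eps * expR (a * sqnorm X))).
  apply: (@integrable_le _ _ _ _ _ (fun=> @gpeak R m n eps)); [exact: mf| |].
    move=> X; rewrite ger0_norm ?mulr_ge0 ?expR_ge0 ?(ltW P0)//.
    by rewrite ler_piMr ?(ltW P0)// -expR0 ler_expR mulr_le0_ge0// sqnorm_ge0.
  apply/integrableP; split; first exact/measurable_EFinP.
  under eq_integral do rewrite /= ger0_norm ?(ltW P0)//.
  rewrite integral_cst// lte_mul_pinfty ?lee_fin ?(ltW P0)//.
  by rewrite (le_lt_trans (probability_le1 nu measurableT))// ltry.
exists (\int[nu]_X (@gpeak R m n eps * expR (a * sqnorm X))).
  apply: Rintegral_gt0 => // [X|]; first by rewrite mulr_gt0// expR_gt0.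
  exact: probability_neq0.
move=> Y; rewrite smoothing_gtrans /gtrans -RintegralZr//.
apply: le_Rintegral => //.
- by apply: (integrableZr measurableT _ i1).
- exact: integrable_gtrans (gint_probability nu).
move=> X _; rewrite mul1r gkE -mulrA -expRD ler_wpM2l ?(ltW P0)// ler_expR.
have D0 : 0 < 2 * e by rewrite mulr_gt0.
rewrite /a !mulNr mulrAC -opprD -mulrDl lerN2 ler_pM2r ?invr_gt0//.
exact: sqnormB_le.
Qed.
End transforms.

Section likelihood_ratio.
Context {R : realType} (N d : nat) (eps : {posnum R}) (mu : probability 'M[R]_(N, d) R).
Local Notation e := (eps%:num).
Local Notation E := 'M[R]_(N, d).
Local Notation V := 'rV[R]_d.
Local Notation m k := (heat_conv_pdf eps (marginal mu k)).
Local Notation Lam := (smoothing_pdf eps mu).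

Lemma heat_conv_pdf_gt0 (nu : probability V R) y : 0 < heat_conv_pdf eps nu y.
Proof. by rewrite heat_conv_smoothing smoothing_pdf_gt0. Qed.

Definition likelihood_ratio (Y : E) : R := Lam Y / \prod_k m k (row k Y).

Lemma prod_heat_conv_gt0 (P : pred 'I_N) Y : 0 < \prod_(k | P k) m k (row k Y).
Proof. by apply: prodr_gt0 => k _; exact: heat_conv_pdf_gt0. Qed.

Lemma likelihood_ratio_gt0 Y : 0 < likelihood_ratio Y.
Proof. by rewrite divr_gt0 ?smoothing_pdf_gt0// prod_heat_conv_gt0. Qed.

Lemma measurable_likelihood_ratio : measurable_fun [set: E] likelihood_ratio.
Proof.
apply: measurable_funM; first exact: measurable_smoothing_pdf.
rewrite (_ : (fun Y => _) = fun Y : E => \prod_k (m k (row k Y))^-1).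
  apply: (@measurable_row_prod R N d (fun k y => (m k y)^-1) xpredT) => k.
  apply: measurable_funV_gt0; first exact: measurable_heat_conv_pdf.
  exact: heat_conv_pdf_gt0.
by apply/funext => Y; rewrite prodfV.
Qed.

Let pk : R := (2 * pi * e) `^ (- (d%:R / 2)).

Lemma heat_conv_pdfE k Y :
  ((m k (row k Y))%:E = \int[mu]_X (heat_kernel e (row k Y - row k X))%:E)%E.
Proof.
have mH : measurable_fun [set: V] (fun x => (heat_kernel e (row k Y - x))%:E : \bar R).
  apply/measurable_EFinP; rewrite (_ : (fun x => _) = gk eps (row k Y)).
    exact: measurable_gk.
  by apply/funext => x; rewrite gkC /gk big_ord1 !row_id.
have H0 x : (0 <= (heat_kernel e (row k Y - x))%:E)%E by rewrite lee_fin heat_kernel_ge0.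
rewrite -(ge0_integral_image (m2 := marginal mu k) (measurable_row k) (fun _ _ => erefl) mH H0).
rewrite EFin_Rintegral//.
have := integrable_gtrans (row k Y) (gint_probability eps (marginal mu k)).
by apply: eq_integrable => // x _ /=; rewrite mul1r gkC /gk big_ord1 !row_id.
Qed.

(** All factors of the kernel but one are bounded by their peak. *)
Lemma smoothing_pdf_le k Y : Lam Y <= (\prod_(l < N | l != k) pk) * m k (row k Y).
Proof.
rewrite -lee_fin EFinM heat_conv_pdfE smoothing_gtrans EFin_Rintegral//; last first.
  exact: integrable_gtrans (gint_probability eps mu).
have mH : measurable_fun [set: E] (fun X => (heat_kernel e (row k Y - row k X))%:E : \bar R).
  have mH : measurable_fun [set: V] (fun x => (heat_kernel e (row k Y - x))%:E : \bar R).
    apply/measurable_EFinP; rewrite (_ : (fun x => _) = gk eps (row k Y)).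
      exact: measurable_gk.
    by apply/funext => x; rewrite gkC /gk big_ord1 !row_id.
  exact: (measurableT_comp mH (measurable_row k)).
have C0 : 0 <= \prod_(l < N | l != k) pk by apply: prodr_ge0 => l _; exact: powR_ge0.
rewrite -ge0_integralZl//; last by move=> X _; rewrite lee_fin heat_kernel_ge0.
apply: ge0_le_integral => //.
- by move=> X _; rewrite lee_fin mul1r ltW// gk_gt0.
- apply/measurable_EFinP; under eq_fun do rewrite mul1r; exact: measurable_gk.
- exact: emeasurable_funM.
- move=> X _; rewrite -EFinM lee_fin mul1r gkC /gk (bigD1 k)//= mulrC.
  rewrite ler_wpM2r ?heat_kernel_ge0//; apply: ler_prod => l _.
  by rewrite heat_kernel_ge0 heat_kernel_le.
Qed.

Lemma sqnorm_rows (Y : E) : sqnorm Y = \sum_k sqnorm (row k Y).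
Proof.
by apply: eq_bigr => k _; rewrite /sqnorm big_ord1; apply: eq_bigr => i _; rewrite mxE.
Qed.

(** The smoothing is dominated by each of the smoothed marginals, hence by their
    geometric mean, while each smoothed marginal is bounded below by a Gaussian
    that is only slightly narrower than the kernel. Hence the ratio grows more
    slowly than the inverse of the kernel, and its Gaussian transform exists. *)
Lemma likelihood_ratio_le : (0 < N)%N -> exists A a : R,
  a < (2 * e)^-1 /\ forall Y, likelihood_ratio Y <= A * expR (a * sqnorm Y).
Proof.
move=> N0; have N0R : 0 < N%:R :> R by rewrite ltr0n.
pose s : R := N%:R^-1; have s0 : 0 < s by rewrite invr_gt0.
have /choice[c cP] : forall k, exists c : R, 0 < c /\ forall y,
    c * expR (- (1 + s) * sqnorm y / (2 * e)) <= m k y.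
  move=> k; have [c c0 H] := smoothing_lower eps (marginal mu k) s0; exists c; split => // y.
  by rewrite heat_conv_smoothing.
pose C := \prod_k ((\prod_(l < N | l != k) pk) / c k ^+ N.-1).
pose A := Num.max 1 C.
(* for s = 1/N this is 1 - 1/N^2 times the rate of decay of the kernel *)
pose a := (N.-1)%:R / N%:R * (1 + s) / (2 * e).
have D0 : 0 < 2 * e by rewrite mulr_gt0.
exists A, a; split.
  rewrite /a -[ltRHS]mul1r ltr_pM2r ?invr_gt0// /s -subr_gt0.
  rewrite (_ : _ - _ = N%:R^-1 ^+ 2) ?exprn_gt0 ?invr_gt0//.
  rewrite -[in N.-1](prednK N0) /= -(prednK N0) /= [N.-1.+1%:R]mulrS.
  by field; rewrite gt_eqF// -mulrS ltr0n.
move=> Y; have A1 : 1 <= A by rewrite /A le_max lexx.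
have A0 : 0 <= A by exact: le_trans A1.
rewrite -(ler_pXn2r N0) ?nnegrE ?(ltW (likelihood_ratio_gt0 _))//; last by rewrite mulr_ge0 ?expR_ge0.
have pk0 : 0 <= pk by exact: powR_ge0.
have step : likelihood_ratio Y ^+ N <=
    \prod_k ((\prod_(l < N | l != k) pk) / m k (row k Y) ^+ N.-1).
  have LN : Lam Y ^+ N = \prod_(k < N) Lam Y by rewrite prodr_const card_ord.
  rewrite /likelihood_ratio expr_div_n -prodrXl LN -prodf_div.
  apply: ler_prod => k _; rewrite divr_ge0 ?smoothing_pdf_ge0 ?exprn_ge0 ?heat_conv_pdf_ge0//=.
  have mN : m k (row k Y) ^+ N = m k (row k Y) * m k (row k Y) ^+ N.-1 by rewrite -exprS prednK.
  rewrite mN invfM mulrA ler_wpM2r ?invr_ge0 ?exprn_ge0 ?heat_conv_pdf_ge0//.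
  by rewrite ler_pdivrMr ?heat_conv_pdf_gt0// smoothing_pdf_le.
apply: (le_trans step).
apply: (@le_trans _ _ (C * expR (a * sqnorm Y) ^+ N)); last first.
  rewrite exprMn ler_wpM2r ?exprn_ge0 ?expR_ge0// (@le_trans _ _ A)//; first by rewrite /A le_max lexx orbT.
  by rewrite -[leLHS]expr1 ler_weXn2l.
rewrite -expRM_natl mulrA [N%:R * a](_ : _ = (N.-1)%:R * ((1 + s) / (2 * e))); last first.
  by rewrite /a; field; rewrite !gt_eqF.
rewrite sqnorm_rows !mulr_sumr expR_sum -big_split /=.
apply: ler_prod => k _; have [c0 H] := cP k.
rewrite divr_ge0 ?prodr_ge0 ?exprn_ge0 ?heat_conv_pdf_ge0//=.
rewrite -[leRHS]mulrA ler_wpM2l ?prodr_ge0//.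
rewrite -[leRHS]invrK lef_pV2 ?posrE ?invr_gt0 ?mulr_gt0 ?invr_gt0 ?exprn_gt0 ?expR_gt0 ?heat_conv_pdf_gt0//.
rewrite invfM invrK -expRN.
rewrite (_ : - _ = N.-1%:R * (- (1 + s) * sqnorm (row k Y) / (2 * e))); last by ring.
by rewrite expRM_natl -exprMn lerXn2r ?nnegrE ?mulr_ge0 ?expR_ge0 ?heat_conv_pdf_ge0 ?(ltW c0).
Qed.

End likelihood_ratio.

(** * Averaging over the smoothed configuration *)

Section mixing.
Context {R : realType} (N d : nat) (eps : {posnum R}) (mu : probability 'M[R]_(N, d) R).
Local Notation E := 'M[R]_(N, d).
Local Notation V := 'rV[R]_d.
Local Notation L := (@lebesgue_mx R N d).
Local Notation L1 := (@lebesgue_mx R 1 d).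
Local Notation m k := (heat_conv_pdf eps (marginal mu k)).
Local Notation Lam := (smoothing_pdf eps mu).
Local Notation G := (likelihood_ratio eps mu).
Hypothesis N0 : (0 < N)%N.

Lemma gint_ratio : gint eps L G.
Proof.
have [A [a [aH H]]] := likelihood_ratio_le eps mu N0.
apply: (gint_lebesgue (measurable_likelihood_ratio eps mu) aH (A := A)) => Y.
by rewrite ger0_norm// ltW// likelihood_ratio_gt0.
Qed.

(** The density of Theta with respect to the product of the marginals. *)
Definition mixing : E -> R := gtrans eps L G.

Lemma mixing_gt0 X : 0 < mixing X.
Proof.
by apply: gtrans_gt0; [exact: lebesgue_mx_neq0|exact: gint_ratio|exact: likelihood_ratio_gt0].
Qed.

Lemma Ck_mixing k : Ck k mixing.
Proof. exact: Ck_gtrans gint_ratio. Qed.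

Lemma measurable_mixing : measurable_fun [set: E] mixing.
Proof. exact: measurable_continuous (Ck_continuous (Ck_mixing 0)). Qed.

Lemma EFin_mixing X : ((mixing X)%:E = \int[L]_Y (gk eps X Y * G Y)%:E)%E.
Proof.
rewrite /mixing /gtrans (EFin_Rintegral measurableT (integrable_gtrans X gint_ratio)).
by apply: eq_integral => Y _; rewrite mulrC.
Qed.

Variable f : 'I_N -> V -> R.
Hypothesis hd : forall k, has_density (marginal mu k) (f k).

Let mf k : measurable_fun [set: V] (f k). Proof. by have [] := hd k. Qed.
Let f0 k x : 0 <= f k x. Proof. by have [_ + _] := hd k; exact. Qed.

Lemma EFin_heat_conv k y :
  ((m k y)%:E = \int[L1]_x (f k x * gk eps x y)%:E)%E.
Proof.
rewrite heat_conv_smoothing (gtrans_density eps y (hd k)) /gtrans.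
rewrite (EFin_Rintegral measurableT (integrable_gtrans y (gint_density eps (hd k)))).
by apply: eq_integral => x _; rewrite gkC.
Qed.

Lemma gk_rows (X Y : E) : gk eps X Y = \prod_k gk eps (row k X) (row k Y).
Proof. by rewrite /gk; apply: eq_bigr => k _; rewrite big_ord1 !row_id. Qed.

Lemma measurable_kernel_ratio2 : measurable_fun [set: E * E] (fun z : E * E => gk eps z.1 z.2 * G z.2).
Proof.
apply: measurable_funM; first exact: measurable_gk2.
exact: (measurableT_comp (measurable_likelihood_ratio eps mu) measurable_snd).
Qed.

(** Integrating out all rows but the j-th one leaves the conditional law of that
    row given the smoothed configuration Y, whose law is the smoothing of mu. *)
Lemma tonelli_kernel (j : 'I_N) (F : V -> E -> \bar R) :
  measurable_fun [set: V * E] (fun z => F z.1 z.2) -> (forall x Y, (0 <= F x Y)%E) ->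
  (\int[L]_X ((\prod_(k < N | k != j) f k (row k X))%:E *
     \int[L]_Y ((gk eps X Y * G Y)%:E * F (row j X) Y)) =
   \int[L]_Y ((Lam Y / m j (row j Y))%:E *
     \int[L1]_x ((gk eps x (row j Y))%:E * F x Y)))%E.
Proof.
move=> mF F0; pose p X := \prod_(k < N | k != j) f k (row k X).
have p0 X : 0 <= p X by apply: prodr_ge0 => k _.
have mp : measurable_fun [set: E] p by exact: measurable_row_prod.
have KG0 X Y : 0 <= gk eps X Y * G Y.
  by rewrite mulr_ge0 ?(ltW (gk_gt0 _ _ _))// ltW// likelihood_ratio_gt0.
have mFX : measurable_fun [set: E * E] (fun z : E * E => F (row j z.1) z.2).
  have mr : measurable_fun [set: E * E] (fun z : E * E => (row j z.1, z.2)).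
    apply: measurable_fun_pair; last exact: measurable_snd.
    exact: (measurableT_comp (measurable_row j) measurable_fst).
  exact: (measurableT_comp mF mr).
pose Q (z : E * E) := ((p z.1 * (gk eps z.1 z.2 * G z.2))%:E * F (row j z.1) z.2)%E.
have mQ : measurable_fun [set: E * E] Q.
  apply: emeasurable_funM => //; apply/measurable_EFinP.
  apply: measurable_funM; last exact: measurable_kernel_ratio2.
  exact: (measurableT_comp mp measurable_fst).
have Q0 z : (0 <= Q z)%E by rewrite mule_ge0// lee_fin mulr_ge0.
transitivity (\int[L]_X \int[L]_Y Q (X, Y))%E.
  apply: eq_integral => X _; rewrite -ge0_integralZl.
  - by apply: eq_integral => Y _; rewrite /Q EFinM muleA.
  - exact: measurableT.
  - have mp2 : measurable_fun [set: E] (fun Y : E => (X, Y)) by exact: measurable_fun_pair.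
    apply: emeasurable_funM; last exact: (measurableT_comp mFX mp2).
    apply/measurable_EFinP; apply: measurable_funM; first exact: measurable_gk.
    exact: measurable_likelihood_ratio.
  - by move=> Y _; rewrite mule_ge0// lee_fin.
  - by rewrite lee_fin; exact: p0.
rewrite (fubini_tonelli Q)//; apply: eq_integral => Y _.
have mFY : measurable_fun [set: V] (fun x => F x Y).
  have mp2 : measurable_fun [set: V] (fun x : V => (x, Y)) by exact: measurable_fun_pair.
  exact: (measurableT_comp mF mp2).
have mgk y : measurable_fun [set: V] (fun x : V => (gk eps x y)%:E : \bar R).
  by apply/measurable_EFinP; under eq_fun do rewrite gkC; exact: measurable_gk.
have gk0 (x y : V) : (0 <= (gk eps x y)%:E)%E by rewrite lee_fin ltW// gk_gt0.
pose q k x := if k == j then ((gk eps x (row j Y))%:E * F x Y)%E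
              else ((f k x)%:E * (gk eps x (row k Y))%:E)%E.
have mq k : measurable_fun [set: V] (q k).
  rewrite /q; case: (k == j); first exact: emeasurable_funM.
  by apply: emeasurable_funM => //; exact/measurable_EFinP.
have q0 k x : (0 <= q k x)%E by rewrite /q; case: (k == j); rewrite mule_ge0// lee_fin f0.
transitivity (\int[L]_X ((G Y)%:E * \prod_k q k (row k X)))%E.
  apply: eq_integral => X _; rewrite /Q /= [in RHS](bigD1 j)//= /q eqxx.
  rewrite (eq_bigr (fun k => (f k (row k X) * gk eps (row k X) (row k Y))%:E)); last first.
    by move=> k /negbTE ->.
  rewrite prodEFin big_split /= gk_rows (bigD1 j)//=.
  rewrite [X in (_ = _ * X)%E]muleAC -EFinM muleA -EFinM; congr (_%:E * _)%E.
  by rewrite -/(p X); ring.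
rewrite ge0_integralZl//; last 3 first.
- apply: emeasurable_prod => k.
  exact: (measurableT_comp (mq k) (measurable_row k)).
- by move=> X _; exact: prode_ge0.
- by rewrite lee_fin ltW// likelihood_ratio_gt0.
rewrite (integral_lebesgue_rows_prod mq q0).
rewrite (bigD1 j)//= {1}/q eqxx (eq_bigr (fun k => (m k (row k Y))%:E)); last first.
  move=> k /negbTE kj; rewrite EFin_heat_conv; apply: eq_integral => x _.
  by rewrite /q kj EFinM.
rewrite prodEFin [X in (_ * X)%E]muleC muleA -EFinM; congr (_%:E * _)%E.
rewrite /likelihood_ratio (bigD1 j)//= invfM mulrA mulfVK//.
by rewrite gt_eqF// prod_heat_conv_gt0.
Qed.

End mixing.

(** * The density of Theta *)

Lemma integral_density (R : realType) m n (mu : probability 'M[R]_(m, n) R) f (psi : 'M[R]_(m, n) -> R) :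
  has_density mu f -> measurable_fun [set: 'M[R]_(m, n)] psi ->
  (\int[mu]_x (psi x)%:E = \int[lebesgue_mx]_x (psi x * f x)%:E)%E.
Proof.
move=> hd mpsi; have [mf f0 _] := hd.
have mpsiE : measurable_fun [set: 'M[R]_(m, n)] (fun x => (psi x)%:E) by exact/measurable_EFinP.
have H1 := ge0_integral_density hd (measurable_funepos mpsiE) (fun x => funepos_ge0 _ x).
have H2 := ge0_integral_density hd (measurable_funeneg mpsiE) (fun x => funeneg_ge0 _ x).
rewrite integralE [RHS]integralE H1 H2; congr (_ - _)%E; apply: eq_integral => x _.
  by rewrite !funeposE /= -!EFin_max -EFinM maxr_pMl// mul0r.
by rewrite !funenegE /= -!EFin_max -EFinM maxr_pMl// mul0r mulNr.
Qed.

(** Bumps converge to indicator functions of boxes, and boxes determine a measure. *)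
Lemma probability_eq_continuous (R : realType) m n (mu nu : probability 'M[R]_(m, n) R) :
  (forall psi : 'M[R]_(m, n) -> R, continuous psi -> bounded_fun psi ->
     (\int[mu]_X (psi X)%:E = \int[nu]_X (psi X)%:E)%E) ->
  forall A, measurable A -> mu A = nu A.
Proof.
move=> H; apply: measure_eq_box => a b; last first.
  by rewrite (le_lt_trans (probability_le1 _ (measurable_box a b)))// ltry.
have [ab|/existsNP[i /existsNP[j abij]]] := pselect (forall i j, a i j < b i j); last first.
  have -> : box a b = set0.
    apply/seteqP; split => // X /(_ i j) /andP[aX Xb]; apply: abij.
    exact: lt_trans aX Xb.
  by rewrite !measure0.
have lim_bump (P : probability 'M[R]_(m, n) R) :
    (\int[P]_X (bump a b k X)%:E @[k --> \oo] --> P (box a b))%E.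
  have mbump k : measurable_fun [set: 'M[R]_(m, n)] (fun X => (bump a b k X)%:E).
    by apply/measurable_EFinP; exact: measurable_continuous (Ck_continuous (Ck_bump a b k 0)).
  have -> : P (box a b) = (\int[P]_X (\1_(box a b) X)%:E)%E.
    by rewrite integral_indic ?setIT//; exact: measurable_box.
  apply: (dominated_cvg measurableT (g := fun=> 1%E)) => //.
  - by move=> X _; apply: cvg_EFin; [exact: nearW|exact: cvg_bump].
  - apply/integrableP; split => //.
    under eq_integral do rewrite abse1.
    rewrite integral_cst// mul1e (le_lt_trans (probability_le1 P measurableT))//; exact: ltry.
  - by move=> k X _; rewrite gee0_abs lee_fin ?bump_ge0 ?bump_le1.
have E : (fun k => \int[mu]_X (bump a b k X)%:E)%E = (fun k => \int[nu]_X (bump a b k X)%:E)%E.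
  apply/funext => k; apply: H; first exact: Ck_continuous (Ck_bump a b k 0).
  exists 1; split => // M M1 X _ /=.
  by rewrite ger0_norm ?bump_ge0// (le_trans (bump_le1 _ _ _ _))// ltW.
by move: (lim_bump mu); rewrite E => L1; exact: (cvg_unique _ L1 (lim_bump nu)).
Qed.

Section theta.
Context {R : realType} (N d : nat) (eps : {posnum R}) (mu : probability 'M[R]_(N, d) R).
Local Notation e := (eps%:num).
Local Notation E := 'M[R]_(N, d).
Local Notation V := 'rV[R]_d.
Local Notation L := (@lebesgue_mx R N d).
Local Notation m k := (heat_conv_pdf eps (marginal mu k)).
Local Notation Lam := (smoothing_pdf eps mu).
Local Notation G := (likelihood_ratio eps mu).
Local Notation H := (mixing eps mu).
Hypothesis N0 : (0 < N)%N.
Variable f : 'I_N -> V -> R.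
Hypothesis hd : forall k, has_density (marginal mu k) (f k).

Let mf k : measurable_fun [set: V] (f k). Proof. by have [] := hd k. Qed.
Let f0 k x : 0 <= f k x. Proof. by have [_ + _] := hd k; exact. Qed.

Definition theta_pdf (X : E) : R := (\prod_k f k (row k X)) * H X.

Lemma measurable_theta_pdf : measurable_fun [set: E] theta_pdf.
Proof.
apply: measurable_funM; last exact: measurable_mixing.
exact: (@measurable_row_prod R N d f xpredT mf).
Qed.

Lemma theta_pdf_ge0 X : 0 <= theta_pdf X.
Proof. by rewrite mulr_ge0 ?(ltW (mixing_gt0 eps mu N0 X))// prodr_ge0. Qed.

(** Integrating out x first leaves the total mass of the smoothing. *)
Lemma integral_theta_pdf : (\int[L]_X (theta_pdf X)%:E = 1)%E.
Proof.
pose j := Ordinal N0.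
have mF : measurable_fun [set: V * E] (fun z : V * E => (f j z.1)%:E : \bar R).
  by apply/measurable_EFinP; exact: (measurableT_comp (mf j) measurable_fst).
have := @tonelli_kernel _ _ _ eps mu f hd j (fun x _ => (f j x)%:E) mF.
have F0 (x : V) (_ : E) : (0 <= (f j x)%:E)%E by rewrite lee_fin.
move=> /(_ F0) T.
rewrite -(integral_smoothing_pdf eps mu); transitivity (
  \int[L]_X ((\prod_(k < N | k != j) f k (row k X))%:E *
     \int[L]_Y ((gk eps X Y * G Y)%:E * (f j (row j X))%:E)))%E.
  apply: eq_integral => X _; rewrite ge0_integralZr//; last 3 first.
  - apply/measurable_EFinP; apply: measurable_funM; first exact: measurable_gk.
    exact: measurable_likelihood_ratio.
  - by move=> Y _; rewrite lee_fin mulr_ge0// ?(ltW (gk_gt0 _ _ _))// ltW// likelihood_ratio_gt0.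
  - by rewrite lee_fin.
  rewrite -EFin_mixing// -!EFinM; congr EFin.
  by rewrite /theta_pdf (bigD1 j)//=; ring.
rewrite T; apply: eq_integral => Y _.
transitivity ((Lam Y / m j (row j Y))%:E * (m j (row j Y))%:E)%E.
  by rewrite (EFin_heat_conv eps hd); congr (_ * _)%E; apply: eq_integral => x _; rewrite -EFinM mulrC.
by rewrite -EFinM mulfVK// gt_eqF// heat_conv_pdf_gt0.
Qed.

Let theta0 : probability E R :=
  density_measure measurable_theta_pdf theta_pdf_ge0 integral_theta_pdf.

Let theta0_density : has_density theta0 theta_pdf.
Proof. by split; [exact: measurable_theta_pdf|exact: theta_pdf_ge0|]. Qed.

Let smoothing_density : has_density (smoothing eps mu) Lam.
Proof. by split; [exact: measurable_smoothing_pdf|exact: smoothing_pdf_ge0|]. Qed.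

Let k (X Y : E) : R := \prod_k (heat_kernel e (row k Y - row k X) / m k (row k Y)).

Let kE X Y : k X Y = gk eps X Y / \prod_k m k (row k Y).
Proof. by rewrite /k prodf_div. Qed.

Let k_ge0 X Y : 0 <= k X Y.
Proof. by rewrite kE divr_ge0 ?(ltW (gk_gt0 _ _ _))// ltW// prod_heat_conv_gt0. Qed.

Let measurable_k : measurable_fun [set: E * E] (fun z : E * E => k z.1 z.2).
Proof.
rewrite (_ : (fun z => _) = fun z : E * E => gk eps z.1 z.2 * (\prod_k m k (row k z.2))^-1); last first.
  by apply/funext => z; rewrite kE.
apply: measurable_funM; first exact: measurable_gk2.
have mp : measurable_fun [set: E] (fun Y : E => \prod_k m k (row k Y)).
  apply: (@measurable_row_prod R N d (fun k => m k) xpredT) => l; exact: measurable_heat_conv_pdf.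
have := measurable_funV_gt0 mp (fun Y => prod_heat_conv_gt0 eps mu xpredT Y).
by move=> mp'; exact: (measurableT_comp mp' measurable_snd).
Qed.

Let measurable_k2 X : measurable_fun [set: E] (k X).
Proof.
have mp : measurable_fun [set: E] (fun Y : E => (X, Y)) by exact: measurable_fun_pair.
exact: (measurableT_comp measurable_k mp).
Qed.

Let integral_k X : (\int[smoothing eps mu]_Y (k X Y)%:E = (H X)%:E)%E.
Proof.
rewrite (ge0_integral_density smoothing_density); last 2 first.
- by apply/measurable_EFinP; exact: measurable_k2.
- by move=> Y; rewrite lee_fin.
rewrite EFin_mixing//; apply: eq_integral => Y _.
by rewrite -EFinM kE /likelihood_ratio mulrAC mulrA.
Qed.

Let integrable_k X : (smoothing eps mu).-integrable [set: E] (fun Y => (k X Y)%:E).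
Proof.
apply/integrableP; split; first by apply/measurable_EFinP; exact: measurable_k2.
under eq_integral do rewrite gee0_abs ?lee_fin//.
by rewrite integral_k ltry.
Qed.

(** Fubini's theorem: up to a bound on psi, the integrand is a probability density in
    both variables. *)
Lemma Theta_spec_density : Theta_spec eps mu theta0.
Proof.
move=> psi cpsi [M [_ Mpsi]].
have mpsi := measurable_continuous cpsi.
pose B := `|M| + 1; have psiB X : `|psi X| <= B.
  by apply: (Mpsi B) => //; rewrite /B ltr_pwDr// ler_norm.
have B0 : 0 <= B by rewrite addr_ge0.
pose nu : probability E R := prod_rows (marginal mu).
have nu_density : has_density nu (fun X => \prod_k f k (row k X)) by exact: prod_rows_density.
pose F (z : E * E) := (psi z.2 * k z.2 z.1)%:E.
have mF : measurable_fun [set: E * E] F.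
  apply/measurable_EFinP; apply: measurable_funM; first exact: (measurableT_comp mpsi measurable_snd).
  have ms : measurable_fun [set: E * E] (fun z : E * E => (z.2, z.1)) by exact: measurable_fun_pair.
  exact: (measurableT_comp measurable_k ms).
have iF : ((smoothing eps mu) \x nu)%E.-integrable [set: E * E] F.
  apply/(integrable21ltyP (smoothing eps mu) nu mF).
  apply: (@le_lt_trans _ _ (\int[nu]_X (B * H X)%:E)%E).
    apply: ge0_le_integral => //.
    - by move=> X _; apply: integral_ge0.
    - have mA : measurable_fun [set: E * E] (fun z => `|F z|%E) by exact: measurableT_comp.
      exact: (measurable_fun_fubini_tonelli_G (m1 := smoothing eps mu)
        (fun z => `|F z|%E) mA (fun z => abse_ge0 _)).
    - apply/measurable_EFinP; apply: measurable_funM => //; exact: measurable_mixing.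
    move=> X _; rewrite EFinM -integral_k -ge0_integralZl.
    2: exact: measurableT.
    2: by apply/measurable_EFinP; exact: measurable_k2.
    2: by move=> Y _; rewrite lee_fin.
    2: by rewrite lee_fin.
    apply: ge0_le_integral; first exact: measurableT.
    - by move=> Y _; exact: abse_ge0.
    - have mkX : measurable_fun [set: E] (fun Y => psi X * k X Y).
        by apply: measurable_funM; [exact: measurable_cst|exact: measurable_k2].
      by move/measurable_EFinP : mkX; exact: measurableT_comp.
    - by apply: emeasurable_funM => //; apply/measurable_EFinP; exact: measurable_k2.
    - by move=> Y _; rewrite -EFinM lee_fin normrM (ger0_norm (k_ge0 _ _)) ler_wpM2r.
  under eq_integral do rewrite EFinM.
  rewrite ge0_integralZl.
  2: exact: measurableT.
  2: by apply/measurable_EFinP; exact: measurable_mixing.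
  2: by move=> X _; rewrite lee_fin ltW// mixing_gt0.
  2: by rewrite lee_fin.
  rewrite lte_mul_pinfty ?lee_fin//.
  rewrite (ge0_integral_density nu_density); last 2 first.
  - by apply/measurable_EFinP; exact: measurable_mixing.
  - by move=> X; rewrite lee_fin ltW// mixing_gt0.
  rewrite (eq_integral (fun X => (theta_pdf X)%:E)); last by move=> X _; rewrite -EFinM mulrC.
  by rewrite integral_theta_pdf ltry.
transitivity (\int[smoothing eps mu]_Y \int[nu]_X F (Y, X))%E; last by [].
rewrite (Fubini iF) (integral_density theta0_density mpsi).
transitivity (\int[nu]_X (psi X * H X)%:E)%E; last first.
  apply: eq_integral => X _; rewrite /F /=.
  under eq_integral do rewrite EFinM.
  by rewrite integralZl// integral_k.
rewrite (integral_density nu_density); last first.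
  by apply: measurable_funM => //; exact: measurable_mixing.
by apply: eq_integral => X _; rewrite /theta_pdf; congr EFin; ring.
Qed.

(** The defining relation of Theta has the solution with density [theta_pdf], and
    no other, so that this is the measure that it picks. *)
Lemma Theta_density : has_density (Theta eps mu) theta_pdf.
Proof.
have TS : Theta_spec eps mu (Theta eps mu) by exact: (getPex (ex_intro _ _ Theta_spec_density)).
split; [exact: measurable_theta_pdf|exact: theta_pdf_ge0|] => A mA.
rewrite (probability_eq_continuous (nu := theta0))// => psi cpsi bpsi.
by rewrite TS// Theta_spec_density.
Qed.

End theta.

(** * Weak derivatives of products over the rows *)

Section slices.
Context {R : realType} {N d : nat}.
Local Notation E := 'M[R]_(N, d).
Local Notation V := 'rV[R]_d.
Local Notation L1 := (@lebesgue_mx R 1 d).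
Variable (j : 'I_N).

Lemma set_row_shift (X : E) (i : 'I_d) (t : R) (z : V) :
  set_row X j (t *: mxdir (ord0, i) + z) = t *: mxdir (j, i) + set_row X j z.
Proof.
apply/matrixP => k l; rewrite !mxE /=; case: eqVneq => //= kj.
by rewrite mulr0 add0r.
Qed.

Lemma continuous_set_row (X : E) : continuous (set_row X j).
Proof.
move=> z; apply: (@cvg_mxP _ _ _ _ (nbhs z) (nbhs_filter z)) => k l; rewrite mxE.
rewrite (_ : (fun t => _) = fun t : V => if k == j then t ord0 l else X k l); last first.
  by apply/funext => t; rewrite mxE.
by case: (k == j); [exact: coord_continuous|exact: cvg_cst].
Qed.

Lemma is_derive_slice (f : E -> R) (X : E) (z : V) (i : 'I_d) (df : R) :
  is_derive (set_row X j z) (mxdir (j, i)) f df ->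
  is_derive z (mxdir (ord0, i)) (fun z => f (set_row X j z)) df.
Proof.
move=> /is_derive_lineP H; apply/is_derive_lineP.
by rewrite (_ : (fun t : R => _) = fun t : R => f (t *: mxdir (j, i) + set_row X j z))//;
  apply/funext => t; rewrite set_row_shift.
Qed.

Lemma Ck_slice k (f : E -> R) (X : E) : Ck k f -> Ck k (fun z : V => f (set_row X j z)).
Proof.
have cs := @continuous_set_row X.
elim: k f => [|k IH] f /= [cf df]; split => //; try by move=> z; apply: continuous_comp; [exact: cs|exact: cf].
move=> [z0 i]; rewrite (ord1 z0); have [f' ff' Cf'] := df (j, i).
exists (fun z => f' (set_row X j z)); last exact: IH.
by move=> z; apply: is_derive_slice; exact: ff'.
Qed.

(** Fixing the other rows preserves smoothness and compactness of the support. *)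
Lemma test_function_slice (phi : E -> R) (X : E) : test_function phi ->
  test_function (fun z : V => phi (set_row X j z)) /\
  forall i z, partial (ord0, i) (fun z : V => phi (set_row X j z)) z = partial (j, i) phi (set_row X j z).
Proof.
move=> tphi; have [_ Cphi [K cK K0]] := test_functionE tphi; split; last first.
  move=> i z; have [dphi _ _] := test_function_partial (j, i) tphi.
  have H := @partialE _ _ _ (ord0, i) (fun z => phi (set_row X j z))
    (fun z => partial (j, i) phi (set_row X j z)) (fun y => is_derive_slice (dphi _)).
  by rewrite H.
have [a [b [_ Kab]]] := compact_subset_box cK.
apply: (@test_functionW _ _ _ _ [set z : V | forall l i, row j a l i <= z l i <= row j b l i]).
- by move=> k; exact: Ck_slice.
- exact: (@compact_box R 1 d (row j a) (row j b)).
move=> z; apply: contra_neqP => nz; apply: K0 => /Kab abz; apply: nz => l i.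
have := abz j i; rewrite !mxE eqxx (ord1 l) => /andP[H1 H2].
by rewrite !ltW.
Qed.

Variables (u : 'I_N -> V -> R) (w : 'I_d -> V -> R) (S : E -> R).
Hypotheses (uw : forall i, is_weak_partial (u j) (ord0, i) (w i)) (CS : forall k, Ck k S).

(** The product rule, checked on slices parallel to the j-th row: there the
    product of the other factors is constant, and multiplying a test function by
    the smooth function S gives a test function. *)
Lemma is_weak_partial_row_prod (i : 'I_d) (S' g : E -> R) :
  (forall X, is_derive X (mxdir (j, i)) S (S' X)) ->
  (forall X, g X = (\prod_(k < N | k != j) u k (row k X)) *
     (w i (row j X) * S X + u j (row j X) * S' X)) ->
  mx_locally_integrable (fun X => (\prod_k u k (row k X)) * S X) ->
  mx_locally_integrable g ->
  is_weak_partial (fun X => (\prod_k u k (row k X)) * S X) (j, i) g.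
Proof.
move=> dS gE lU lg; split => // phi tphi.
have i1 := integrable_test_partial (j, i) lU tphi; have i2 := integrable_test lg tphi.
have [_ Cphi [K cK K0]] := test_functionE tphi.
have tS : test_function (fun X => S X * phi X).
  apply: (@test_functionW _ _ _ _ K) => //; first by move=> k; exact: Ck_mul.
  by move=> X; apply: contra_neqP => nK; rewrite K0// mulr0.
have dSphi X : partial (j, i) (fun X => S X * phi X) X = S X * partial (j, i) phi X + phi X * S' X.
  have [dphi _ _] := test_function_partial (j, i) tphi.
  have H := @partialE _ _ _ (j, i) (fun X => S X * phi X)
    (fun X => S X * partial (j, i) phi X + phi X * S' X) (fun Y => is_derive_mul (dS Y) (dphi Y)).
  by rewrite H.
apply/eqP; rewrite -subr_eq0 opprK -RintegralD//; apply/eqP.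
rewrite /Rintegral (_ : (fun X => _) = fun X => (
  (\prod_(k < N | k != j) u k (row k X)) *
   (u j (row j X) * partial (j, i) (fun X => S X * phi X) X +
    w i (row j X) * (S X * phi X)))%:E); last first.
  by apply/funext => X; congr EFin; rewrite gE dSphi (bigD1 j)//=; ring.
set F := fun X => _.
rewrite (@integral_slices_eq0 _ _ _ j (fun X => fine (F X)))//.
- have := integrableD measurableT i1 i2; apply: eq_integrable => // X _.
  by rewrite /F /= gE dSphi (bigD1 j)//= -EFinD; congr EFin; ring.
move=> X; have [ts ps] := test_function_slice X tS.
have [lu lw /(_ _ ts)] := uw i => H.
have j1 := integrable_test_partial (ord0, i) lu ts; have j2 := integrable_test lw ts.
have j12 := integrableD measurableT j1 j2.
have j12' : L1.-integrable setT (EFin \o (fun z => u j z * partial (ord0, i) (fun z => S (set_row X j z) * phi (set_row X j z)) z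
   + w i z * (S (set_row X j z) * phi (set_row X j z)))) by [].
rewrite (eq_integral (fun z => ((\prod_(k < N | k != j) u k (row k X)) *
   (u j z * partial (ord0, i) (fun z => S (set_row X j z) * phi (set_row X j z)) z +
    w i z * (S (set_row X j z) * phi (set_row X j z))))%:E)); last first.
  move=> z _; rewrite /F /= row_set_row_id ps; congr (_ * _)%:E.
  by apply: eq_bigr => k /negbTE kj; rewrite row_set_row kj.
under eq_integral do rewrite EFinM.
rewrite integralZl// -EFin_Rintegral// RintegralD// H addNr mule0.
by [].
Qed.

End slices.

(** * Marginals of the smoothing *)

Section smoothing_marginal.
Context {R : realType} (N d : nat) (eps : {posnum R}) (mu : probability 'M[R]_(N, d) R).
Local Notation E := 'M[R]_(N, d).
Local Notation V := 'rV[R]_d.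
Local Notation L := (@lebesgue_mx R N d).
Local Notation L1 := (@lebesgue_mx R 1 d).

Lemma EFin_smoothing m n (nu : probability 'M[R]_(m, n) R) Y :
  ((smoothing_pdf eps nu Y)%:E = \int[nu]_X (gk eps X Y)%:E)%E.
Proof.
rewrite smoothing_gtrans /gtrans.
rewrite (EFin_Rintegral measurableT (integrable_gtrans Y (gint_probability eps nu))).
by apply: eq_integral => X _; rewrite mul1r gkC.
Qed.

Lemma measurable_gkl m n (Y : 'M[R]_(m, n)) : measurable_fun [set: 'M[R]_(m, n)] (fun X => gk eps X Y).
Proof. by under eq_fun do rewrite gkC; exact: measurable_gk. Qed.

(** Smoothing commutes with taking marginals, the kernel being a product over the
    rows. *)
Lemma integral_smoothing_row (j : 'I_N) (phi : V -> \bar R) :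
  measurable_fun [set: V] phi -> (forall y, (0 <= phi y)%E) ->
  (\int[L]_Y ((smoothing_pdf eps mu Y)%:E * phi (row j Y)) =
   \int[L1]_y ((heat_conv_pdf eps (marginal mu j) y)%:E * phi y))%E.
Proof.
move=> mphi phi0.
have K0 m n (X Y : 'M[R]_(m, n)) : (0 <= (gk eps X Y)%:E)%E by rewrite lee_fin ltW// gk_gt0.
have mphir : measurable_fun [set: E] (fun Y => phi (row j Y)).
  exact: (measurableT_comp mphi (measurable_row j)).
pose Q (z : E * E) := ((gk eps z.1 z.2)%:E * phi (row j z.2))%E.
have mQ : measurable_fun [set: E * E] Q.
  apply: emeasurable_funM; first by apply/measurable_EFinP; exact: measurable_gk2.
  exact: (measurableT_comp mphir measurable_snd).
have Q0 z : (0 <= Q z)%E by rewrite mule_ge0.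
pose q (z : V * V) := ((gk eps z.1 z.2)%:E * phi z.2)%E.
have mq : measurable_fun [set: V * V] q.
  apply: emeasurable_funM; first by apply/measurable_EFinP; exact: measurable_gk2.
  exact: (measurableT_comp mphi measurable_snd).
have q0 z : (0 <= q z)%E by rewrite mule_ge0.
transitivity (\int[L]_Y \int[mu]_X Q (X, Y))%E.
  apply: eq_integral => Y _; rewrite EFin_smoothing -ge0_integralZr//.
  by apply/measurable_EFinP; exact: measurable_gkl.
rewrite -(fubini_tonelli Q mQ Q0).
transitivity (\int[mu]_X \int[L1]_y q (row j X, y))%E.
  apply: eq_integral => X _.
  pose r k y := if k == j then q (row j X, y) else (gk eps (row k X) y)%:E.
  have mgk x : measurable_fun [set: V] (fun y : V => (gk eps x y)%:E : \bar R).
    by apply/measurable_EFinP; exact: measurable_gk.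
  have mr k : measurable_fun [set: V] (r k).
    by rewrite /r; case: (k == j); [exact: emeasurable_funM (mgk _) mphi|exact: mgk].
  have r0 k y : (0 <= r k y)%E by rewrite /r; case: (k == j); [exact: q0|exact: K0].
  transitivity (\int[L]_Y \prod_k r k (row k Y))%E.
    apply: eq_integral => Y _; rewrite (bigD1 j)//= /r eqxx /Q /q /=.
    rewrite (eq_bigr (fun k => (gk eps (row k X) (row k Y))%:E)); last by move=> k /negbTE ->.
    by rewrite prodEFin muleAC -EFinM gk_rows (bigD1 j).
  rewrite (integral_lebesgue_rows_prod mr r0) (bigD1 j)//= big1 ?mule1.
    by apply: eq_integral => y _; rewrite /r eqxx.
  move=> k /negbTE kj; rewrite -(integral_gk eps (row k X)).
  by apply: eq_integral => y _; rewrite /r kj.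
have mI : measurable_fun [set: V] (fun x => \int[L1]_y q (x, y))%E.
  exact: (measurable_fun_fubini_tonelli_F (m2 := L1) q mq q0).
have I0 x : (0 <= \int[L1]_y q (x, y))%E by apply: integral_ge0.
rewrite -(ge0_integral_image (m2 := marginal mu j) (measurable_row j) (fun _ _ => erefl) mI I0).
rewrite (fubini_tonelli q mq q0); apply: eq_integral => y _.
rewrite heat_conv_smoothing EFin_smoothing -ge0_integralZr//.
by apply/measurable_EFinP; exact: measurable_gkl.
Qed.

End smoothing_marginal.

(** * The derivative of the root of the density *)

Section root_derivative.
Context {R : realType} (N d : nat) (eps : {posnum R}) (mu : probability 'M[R]_(N, d) R).
Local Notation e := (eps%:num).
Local Notation E := 'M[R]_(N, d).
Local Notation V := 'rV[R]_d.
Local Notation L := (@lebesgue_mx R N d).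
Local Notation m k := (heat_conv_pdf eps (marginal mu k)).
Local Notation G := (likelihood_ratio eps mu).
Local Notation H := (mixing eps mu).
Hypothesis N0 : (0 < N)%N.
Variables (u : 'I_N -> V -> R) (w : 'I_N -> 'I_d -> V -> R).
Hypotheses (mu_ : forall k, measurable_fun [set: V] (u k))
  (mw : forall k i, measurable_fun [set: V] (w k i)).

Definition mixing' (ij : 'I_N * 'I_d) (X : E) : R :=
  gtrans eps L (fun Y => G Y * ((Y ij.1 ij.2 - X ij.1 ij.2) / e)) X.

Lemma is_derive_mixing (X : E) ij : is_derive X (mxdir ij) H (mixing' ij X).
Proof. exact: is_derive_gtrans (gint_ratio eps mu N0). Qed.

Definition root_mixing (X : E) : R := Num.sqrt (H X).

Definition root_mixing' ij (X : E) : R := (2 * root_mixing X)^-1 * mixing' ij X.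

Lemma is_derive_root_mixing (X : E) ij : is_derive X (mxdir ij) root_mixing (root_mixing' ij X).
Proof. exact: is_derive_compR (is_derive_sqrt (mixing_gt0 eps mu N0 X)) (is_derive_mixing X ij). Qed.

Lemma Ck_root_mixing k : Ck k root_mixing.
Proof. by apply: Ck_sqrt; [exact: mixing_gt0|exact: Ck_mixing]. Qed.

Definition root_theta (X : E) : R := (\prod_k u k (row k X)) * root_mixing X.

Lemma root_theta_sqr X : root_theta X ^+ 2 = theta_pdf eps mu (fun k x => u k x ^+ 2) X.
Proof. by rewrite exprMn -prodrXl sqr_sqrtr// ltW// mixing_gt0. Qed.

(** The product rule in the direction (j, i), which only moves the j-th row. *)
Definition root_theta' j i (X : E) : R := (\prod_(k < N | k != j) u k (row k X)) *
  (w j i (row j X) * root_mixing X + u j (row j X) * root_mixing' (j, i) X).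

Lemma measurable_root_mixing : measurable_fun [set: E] root_mixing.
Proof. exact: measurable_continuous (Ck_continuous (Ck_root_mixing 0)). Qed.

Lemma measurable_root_mixing' ij : measurable_fun [set: E] (root_mixing' ij).
Proof.
have [_ /(_ ij)[f df [cf _]]] := Ck_root_mixing 1.
rewrite (_ : root_mixing' ij = f); first exact: measurable_continuous cf.
rewrite -(partialE df); apply/esym/partialE => X; exact: is_derive_root_mixing.
Qed.

Lemma measurable_root_theta : measurable_fun [set: E] root_theta.
Proof.
apply: measurable_funM; last exact: measurable_root_mixing.
exact: (@measurable_row_prod R N d u xpredT mu_).
Qed.

Lemma measurable_root_theta' j i : measurable_fun [set: E] (root_theta' j i).
Proof.
apply: measurable_funM; first exact: measurable_row_prod.
apply: measurable_funD; apply: measurable_funM.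
- exact: (measurableT_comp (mw j i) (measurable_row j)).
- exact: measurable_root_mixing.
- exact: (measurableT_comp (mu_ j) (measurable_row j)).
- exact: measurable_root_mixing'.
Qed.

Lemma measurable_kernel_ratio (X : E) : measurable_fun [set: E] (fun Y => gk eps X Y * G Y).
Proof.
by apply: measurable_funM; [exact: measurable_gk|exact: measurable_likelihood_ratio].
Qed.

Lemma kernel_ratio_ge0 (X : E) Y : 0 <= gk eps X Y * G Y.
Proof. by rewrite mulr_ge0 ?(ltW (gk_gt0 _ _ _))// ltW// likelihood_ratio_gt0. Qed.

Lemma integrable_kernel_ratio (X : E) : L.-integrable [set: E] (EFin \o (fun Y => gk eps X Y * G Y)).
Proof.
have := integrable_gtrans X (gint_ratio eps mu N0).
by apply: eq_integrable => // Y _ /=; rewrite mulrC.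
Qed.

Lemma Rintegral_kernel_ratio (X : E) : \int[L]_Y (gk eps X Y * G Y) = H X.
Proof. by rewrite /mixing /gtrans; congr Rintegral; apply/funext => Y; rewrite mulrC. Qed.

(** The derivative of the root is a conditional mean divided by the root of the
    normalisation H; its square is bounded by the conditional second moment. *)
Lemma root_theta'_sqr_le j i (X : E) (Phi : E -> R) : measurable_fun [set: E] Phi ->
  \int[L]_Y (gk eps X Y * G Y * Phi Y) =
    w j i (row j X) * H X + u j (row j X) * mixing' (j, i) X / 2 ->
  ((root_theta' j i X ^+ 2)%:E <= (\prod_(k < N | k != j) u k (row k X) ^+ 2)%:E *
    \int[L]_Y ((gk eps X Y * G Y)%:E * (Phi Y ^+ 2)%:E))%E.
Proof.
move=> mPhi PhiE.
have HX := mixing_gt0 eps mu N0 X.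
have SX : 0 < root_mixing X by rewrite sqrtr_gt0.
have S2 : root_mixing X ^+ 2 = H X by rewrite sqr_sqrtr// ltW.
have gE : root_theta' j i X = (\prod_(k < N | k != j) u k (row k X)) *
    (\int[L]_Y (gk eps X Y * G Y * Phi Y) / root_mixing X).
  rewrite PhiE -S2 /root_theta' /root_mixing'; congr (_ * _); field; rewrite gt_eqF//.
rewrite gE exprMn -prodrXl EFinM; apply: lee_wpmul2l.
  by rewrite lee_fin prodr_ge0// => k _; exact: sqr_ge0.
rewrite expr_div_n S2.
have ik := integrable_kernel_ratio X.
have := cauchy_schwarz_weight (measurable_kernel_ratio X) mPhi (kernel_ratio_ge0 X) ik.
rewrite Rintegral_kernel_ratio => /(_ HX) CS.
have -> : (\int[L]_Y (gk eps X Y * G Y * Phi Y)) ^+ 2 / H X =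
   (H X)^-1 * (\int[L]_Y (gk eps X Y * G Y * Phi Y)) ^+ 2 by rewrite mulrC.
rewrite EFinM -(@lee_pmul2l _ (H X)%:E) ?lte_fin// muleA -EFinM divff ?gt_eqF// mul1r.
apply: (le_trans CS); rewrite le_eqVlt; apply/orP; left; apply/eqP; congr (_ * _)%E.
Qed.

End root_derivative.

(** * The bound by Gaussian moments *)

(** The cross term vanishes since the kernel is centred. *)
Lemma gk_quadratic (R : realType) m n (eps : {posnum R}) (X : 'M[R]_(m, n)) i j (a b : R) :
  (\int[lebesgue_mx]_Y ((gk eps X Y)%:E * ((a + b * ((Y i j - X i j) / eps%:num)) ^+ 2)%:E) =
   (a ^+ 2 + b ^+ 2 / eps%:num)%:E)%E.
Proof.
pose z (Y : 'M[R]_(m, n)) := (Y i j - X i j) / eps%:num.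
have g0 := gint_cst_lebesgue (m := m) (n := n) eps (1 : R).
have g1 := gint_score X i j g0; have g2 := gint_score X i j g1.
have i0 := integrable_gtrans X g0; have i1 := integrable_gtrans X g1.
have i2 := integrable_gtrans X g2.
have e0 : \int[lebesgue_mx]_Y (1 * gk eps X Y) = 1 by exact: gtrans_lebesgue1.
have e1 : \int[lebesgue_mx]_Y (1 * z Y * gk eps X Y) = 0.
  by rewrite -(gk_mean eps X i j); congr Rintegral; apply/funext => Y; rewrite mul1r.
have e2 : \int[lebesgue_mx]_Y (1 * z Y * z Y * gk eps X Y) = eps%:num^-1.
  have i3 : lebesgue_mx.-integrable [set: 'M[R]_(m, n)]
      (EFin \o (fun Y : 'M[R]_(m, n) => (Y i j - X i j) ^+ 2 * gk eps X Y)).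
    have := integrableZl measurableT (eps%:num ^+ 2) i2; apply: eq_integrable => // Y _ /=.
    by rewrite -EFinM; congr EFin; field.
  have -> : (fun Y : 'M[R]_(m, n) => 1 * z Y * z Y * gk eps X Y) =
      (fun Y : 'M[R]_(m, n) => eps%:num^-1 ^+ 2 * ((Y i j - X i j) ^+ 2 * gk eps X Y)).
    by apply/funext => Y; rewrite /z; field.
  by rewrite RintegralZl// gk_second_moment; field.
have j0 := integrableZl measurableT (a ^+ 2) i0.
have j1 := integrableZl measurableT (2 * a * b) i1.
have j2 := integrableZl measurableT (b ^+ 2) i2.
have j01 := integrableD measurableT j0 j1.
rewrite (eq_integral (fun Y : 'M[R]_(m, n) => ((a ^+ 2)%:E * (1 * gk eps X Y)%:E +
   (2 * a * b)%:E * (1 * z Y * gk eps X Y)%:E) + (b ^+ 2)%:E * (1 * z Y * z Y * gk eps X Y)%:E)%E).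
  rewrite (integralD measurableT j01 j2) (integralD measurableT j0 j1).
  rewrite (integralZl measurableT i0) (integralZl measurableT i1) (integralZl measurableT i2).
  rewrite -(EFin_Rintegral measurableT i0) -(EFin_Rintegral measurableT i1) -(EFin_Rintegral measurableT i2).
  by rewrite e0 e1 e2 -!EFinM -!EFinD mulr0 addr0 mulr1.
by move=> Y _; rewrite -!EFinM -!EFinD; congr EFin; rewrite /z; ring.
Qed.

Section first_bound.
Context {R : realType} (N d : nat) (eps : {posnum R}) (mu : probability 'M[R]_(N, d) R).
Local Notation e := (eps%:num).
Local Notation E := 'M[R]_(N, d).
Local Notation V := 'rV[R]_d.
Local Notation L := (@lebesgue_mx R N d).
Local Notation L1 := (@lebesgue_mx R 1 d).
Local Notation m k := (heat_conv_pdf eps (marginal mu k)).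
Local Notation Lam := (smoothing_pdf eps mu).
Local Notation G := (likelihood_ratio eps mu).
Hypothesis N0 : (0 < N)%N.
Variables (u : 'I_N -> V -> R) (w : 'I_N -> 'I_d -> V -> R).
Hypotheses (mu_ : forall k, measurable_fun [set: V] (u k))
  (mw : forall k i, measurable_fun [set: V] (w k i)).
Hypothesis hd : forall k, has_density (marginal mu k) (fun x => u k x ^+ 2).

(** When F only depends on Y through its j-th row, the smoothing may be replaced by
    its marginal m_j, which cancels. *)
Lemma integral_conditional_row j (F : V -> V -> \bar R) :
  measurable_fun [set: V * V] (fun z => F z.1 z.2) -> (forall x y, (0 <= F x y)%E) ->
  (\int[L]_Y ((Lam Y / m j (row j Y))%:E *
     \int[L1]_x ((gk eps x (row j Y))%:E * F x (row j Y))) =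
   \int[L1]_y \int[L1]_x ((gk eps x y)%:E * F x y))%E.
Proof.
move=> mF F0.
pose q (z : V * V) := ((gk eps z.1 z.2)%:E * F z.1 z.2)%E.
have mq : measurable_fun [set: V * V] q.
  by apply: emeasurable_funM => //; apply/measurable_EFinP; exact: measurable_gk2.
have q0 z : (0 <= q z)%E by rewrite mule_ge0// lee_fin ltW// gk_gt0.
have mI : measurable_fun [set: V] (fun y => \int[L1]_x q (x, y))%E.
  exact: (measurable_fun_fubini_tonelli_G (m1 := L1) q mq q0).
have I0 y : (0 <= \int[L1]_x q (x, y))%E by apply: integral_ge0.
pose phi y := ((m j y)^-1%:E * \int[L1]_x q (x, y))%E.
have mphi : measurable_fun [set: V] phi.
  apply: emeasurable_funM => //; apply/measurable_EFinP; apply: measurable_funV_gt0.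
    exact: measurable_heat_conv_pdf.
  exact: heat_conv_pdf_gt0.
have phi0 y : (0 <= phi y)%E by rewrite mule_ge0// lee_fin invr_ge0 heat_conv_pdf_ge0.
have := integral_smoothing_row eps mu j mphi phi0 => IS.
transitivity (\int[L]_Y ((Lam Y)%:E * phi (row j Y)))%E.
  by apply: eq_integral => Y _; rewrite /phi muleA -EFinM.
rewrite IS; apply: eq_integral => y _.
by rewrite /phi muleA -EFinM divff ?mul1e// gt_eqF// heat_conv_pdf_gt0.
Qed.

Lemma integral_root_theta'_le j i (F : V -> E -> \bar R) :
  measurable_fun [set: V * E] (fun z => F z.1 z.2) -> (forall x Y, (0 <= F x Y)%E) ->
  (forall X, ((root_theta' eps mu u w j i X ^+ 2)%:E <=
     (\prod_(k < N | k != j) u k (row k X) ^+ 2)%:E *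
     \int[L]_Y ((gk eps X Y * G Y)%:E * F (row j X) Y))%E) ->
  (\int[L]_X (root_theta' eps mu u w j i X ^+ 2)%:E <=
   \int[L]_Y ((Lam Y / m j (row j Y))%:E *
     \int[L1]_x ((gk eps x (row j Y))%:E * F x Y)))%E.
Proof.
move=> mF F0 FX.
rewrite -(@tonelli_kernel _ _ _ eps mu (fun k x => u k x ^+ 2) hd j F mF F0).
have mrt := @measurable_root_theta' _ _ _ eps mu N0 u w mu_ mw j i.
apply: ge0_le_integral; first exact: measurableT.
- by move=> X _; rewrite lee_fin sqr_ge0.
- by apply/measurable_EFinP; exact: measurable_funX.
- apply: emeasurable_funM.
    apply/measurable_EFinP; apply: (@measurable_row_prod R N d (fun k x => u k x ^+ 2) (fun k => k != j)) => k.
    exact: measurable_funX.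
  pose Q (z : E * E) := ((gk eps z.1 z.2 * G z.2)%:E * F (row j z.1) z.2)%E.
  have mr : measurable_fun [set: E * E] (fun z : E * E => (row j z.1, z.2)).
    apply: measurable_fun_pair; last exact: measurable_snd.
    exact: (measurableT_comp (measurable_row j) measurable_fst).
  have mQ : measurable_fun [set: E * E] Q.
    apply: emeasurable_funM; last exact: (measurableT_comp mF mr).
    by apply/measurable_EFinP; exact: measurable_kernel_ratio2.
  have Q0 z : (0 <= Q z)%E by rewrite mule_ge0// lee_fin kernel_ratio_ge0.
  exact: (measurable_fun_fubini_tonelli_F (m2 := L) Q mQ Q0).
- by move=> X _; exact: FX.
Qed.

(** Differentiating the kernel produces the factor (y - x)/eps, of mean 0 and variance
    1/eps for given x. *)
Lemma integral_root_theta'_le1 j i :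
  (\int[L]_X (root_theta' eps mu u w j i X ^+ 2)%:E <=
   \int[L1]_x (w j i x ^+ 2)%:E + ((4 * e)^-1)%:E)%E.
Proof.
pose F (x y : V) := w j i x + u j x / 2 * ((y ord0 i - x ord0 i) / e).
have mF : measurable_fun [set: V * V] (fun z => F z.1 z.2).
  apply: measurable_funD; first exact: (measurableT_comp (mw j i) measurable_fst).
  apply: measurable_funM; apply: measurable_funM => //.
    exact: (measurableT_comp (mu_ j) measurable_fst).
  apply: measurable_funB.
    exact: (measurableT_comp (measurable_mx_coord ord0 i) measurable_snd).
  exact: (measurableT_comp (measurable_mx_coord ord0 i) measurable_fst).
have mF' : measurable_fun [set: V * E] (fun z => F z.1 (row j z.2)).
  have mr : measurable_fun [set: V * E] (fun z : V * E => (z.1, row j z.2)).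
    apply: measurable_fun_pair; first exact: measurable_fst.
    exact: (measurableT_comp (measurable_row j) measurable_snd).
  exact: (measurableT_comp mF mr).
have mF2 : measurable_fun [set: V * V] (fun z => (F z.1 z.2 ^+ 2)%:E).
  by apply/measurable_EFinP; exact: measurable_funX.
have F20 x y : (0 <= (F x y ^+ 2)%:E)%E by rewrite lee_fin sqr_ge0.
have mF2' : measurable_fun [set: V * E] (fun z => (F z.1 (row j z.2) ^+ 2)%:E).
  by apply/measurable_EFinP; exact: measurable_funX.
have F20' (x : V) (Y : E) : (0 <= (F x (row j Y) ^+ 2)%:E)%E by rewrite lee_fin sqr_ge0.
apply: (le_trans (@integral_root_theta'_le j i (fun x Y => (F x (row j Y) ^+ 2)%:E) mF2' F20' _)).
  move=> X; apply: (root_theta'_sqr_le N0 (Phi := fun Y => F (row j X) (row j Y))).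
    have mp2 : measurable_fun [set: E] (fun Y : E => (row j X, Y)) by exact: measurable_fun_pair.
    exact: (measurableT_comp mF' mp2).
  have g1 := gint_ratio eps mu N0; have g2 := gint_score X j i g1.
  have i1 := integrable_gtrans X g1; have i2 := integrable_gtrans X g2.
  have j1 := integrableZl measurableT (w j i (row j X)) i1.
  have j2 := integrableZl measurableT (u j (row j X) / 2) i2.
  rewrite (_ : (fun Y => _) = (fun Y => w j i (row j X) * (G Y * gk eps X Y) +
     u j (row j X) / 2 * (G Y * ((Y j i - X j i) / e) * gk eps X Y))).
    rewrite (RintegralD measurableT j1 j2) (RintegralZl _ measurableT i1) (RintegralZl _ measurableT i2).
    by rewrite /mixing' /mixing /gtrans /=; congr (_ + _); ring.
  by apply/funext => Y; rewrite /F !mxE; ring.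
rewrite (@integral_conditional_row j (fun x y => (F x y ^+ 2)%:E) mF2 F20).
pose q (z : V * V) := ((gk eps z.1 z.2)%:E * (F z.1 z.2 ^+ 2)%:E)%E.
have mq : measurable_fun [set: V * V] q.
  by apply: emeasurable_funM => //; apply/measurable_EFinP; exact: measurable_gk2.
have q0 z : (0 <= q z)%E by rewrite mule_ge0// lee_fin ltW// gk_gt0.
rewrite -(fubini_tonelli q mq q0) /q /=.
have mw2 : measurable_fun [set: V] (fun x => (w j i x ^+ 2)%:E).
  by apply/measurable_EFinP; exact: measurable_funX.
have mu2 : measurable_fun [set: V] (fun x => (u j x ^+ 2)%:E).
  by apply/measurable_EFinP; exact: measurable_funX.
rewrite (eq_integral (fun x => (w j i x ^+ 2)%:E + ((4 * e)^-1)%:E * (u j x ^+ 2)%:E)%E); last first.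
  by move=> x _; rewrite /F gk_quadratic -EFinM -EFinD; congr EFin; field.
rewrite ge0_integralD.
2: exact: measurableT.
2: by move=> x _; rewrite lee_fin sqr_ge0.
2: exact: mw2.
2: by move=> x _; rewrite -EFinM lee_fin mulr_ge0 ?sqr_ge0// invr_ge0 mulr_ge0.
2: exact: emeasurable_funM.
rewrite ge0_integralZl.
2: exact: measurableT.
2: exact: mu2.
2: by move=> x _; rewrite lee_fin sqr_ge0.
2: by rewrite lee_fin invr_ge0 mulr_ge0.
have [_ _ H1] := hd j; have := H1 setT measurableT.
by rewrite probability_setT => <-; rewrite mule1.
Qed.

End first_bound.

(** * Scores and integration by parts *)

Lemma is_derive_ratio (R : realType) (V : normedModType R) (f g : V -> R) (x v : V) (df dg : R) :
  0 < f x -> 0 < g x -> is_derive x v f df -> is_derive x v g dg ->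
  is_derive x v (fun y => f y / g y) (f x / g x * (df / f x - dg / g x)).
Proof.
move=> f0 g0 Hf Hg.
have dV : is_derive (g x) 1 (fun t : R => t^-1) (- g x ^- 2).
  have nz : g x != 0 by rewrite gt_eqF.
  have H := @is_deriveV R id (g x) 1 1 nz (is_derive_id (g x) (1 : R)).
  by apply: (is_derive_eq H); rewrite /GRing.scale /= mulr1.
have H := is_derive_mul Hf (is_derive_compR dV Hg).
by apply: (is_derive_eq H); field; rewrite !gt_eqF.
Qed.

Section row_functions.
Context {R : realType} {N d : nat}.
Local Notation E := 'M[R]_(N, d).
Local Notation V := 'rV[R]_d.

Lemma row_shift (j k : 'I_N) (i : 'I_d) (t : R) (Y : E) :
  row k (t *: mxdir (j, i) + Y) = if k == j then t *: mxdir (ord0, i) + row k Y else row k Y.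
Proof.
by apply/rowP => l; case: eqVneq => [->|kj]; rewrite !mxE /= ?eqxx //= (negbTE kj) mulr0 add0r.
Qed.

Lemma continuous_row (k : 'I_N) : continuous (row k : E -> V).
Proof.
move=> z; apply: (@cvg_mxP _ _ _ _ (nbhs z) (nbhs_filter z)) => l i; rewrite mxE.
rewrite (_ : (fun t => _) = fun t : E => t k i); first exact: coord_continuous.
by apply/funext => t; rewrite mxE.
Qed.

Lemma is_derive_row_prod (h : 'I_N -> V -> R) (j : 'I_N) (i : 'I_d) (Y : E) (dh : R) :
  is_derive (row j Y) (mxdir (ord0, i)) (h j) dh ->
  is_derive Y (mxdir (j, i)) (fun Y => \prod_k h k (row k Y))
    ((\prod_(k < N | k != j) h k (row k Y)) * dh).
Proof.
move=> /is_derive_lineP /(is_derive_cmul (\prod_(k < N | k != j) h k (row k Y))) H.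
apply/is_derive_lineP; move: H; congr is_derive; apply/funext => t.
rewrite [RHS](bigD1 j)//= row_shift eqxx mulrC; congr (_ * _).
by apply: eq_bigr => k /negbTE kj; rewrite row_shift kj.
Qed.

End row_functions.

Section kernel_derivative.
Context {R : realType} {m n : nat} (eps : {posnum R}).
Local Notation E := 'M[R]_(m, n).

Lemma gk_expR (X Z : E) :
  gk eps X Z = @gpeak R m n eps * expR (- (2 * eps%:num)^-1 * sqnorm (Z - X)).
Proof. by rewrite gkE; congr (_ * expR _); rewrite !mulNr mulrC. Qed.

Lemma is_derive_gk (X Y : E) ij :
  is_derive Y (mxdir ij) (gk eps X) (gk eps X Y * ((X ij.1 ij.2 - Y ij.1 ij.2) / eps%:num)).
Proof.
have := is_derive_sqnorm_exp (- (2 * eps%:num)^-1) (Y - X) ij.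
move=> /(is_derive_cmul (@gpeak R m n eps)) /is_derive_lineP H.
apply/is_derive_lineP.
have -> : (fun t : R => gk eps X (t *: mxdir ij + Y)) =
    (fun t : R => @gpeak R m n eps * expR (- (2 * eps%:num)^-1 * sqnorm (t *: mxdir ij + (Y - X)))).
  by apply/funext => t; rewrite gk_expR addrA.
by apply: (is_derive_eq H); rewrite gk_expR !mxE; field.
Qed.

Lemma continuous_gk (X : E) : continuous (gk eps X).
Proof.
have Cq := Ck_translate (- X) (@Ck_sqnorm_exp R m n 0 (- (2 * eps%:num)^-1)).
have [cg _] := Ck_mul (Ck_cst 0 (@gpeak R m n eps)) Cq.
by rewrite (_ : gk eps X = fun Y : E => @gpeak R m n eps * expR (- (2 * eps%:num)^-1 * sqnorm (Y - X)))//;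
  apply/funext => Y; exact: gk_expR.
Qed.

End kernel_derivative.

Section integration_by_parts_kernel.
Context {R : realType} (N d : nat) (eps : {posnum R}) (mu : probability 'M[R]_(N, d) R).
Local Notation e := (eps%:num).
Local Notation E := 'M[R]_(N, d).
Local Notation L := (@lebesgue_mx R N d).
Local Notation m k := (heat_conv_pdf eps (marginal mu k)).
Local Notation G := (likelihood_ratio eps mu).
Hypothesis N0 : (0 < N)%N.

Definition smoothing' p q (nu : probability 'M[R]_(p, q) R) ij (Y : 'M[R]_(p, q)) : R :=
  gtrans eps nu (fun X => 1 * ((X ij.1 ij.2 - Y ij.1 ij.2) / e)) Y.

(** Half of the logarithmic derivative; multiplied by the root of the smoothing it is
    the derivative of that root. *)
Definition half_score p q (nu : probability 'M[R]_(p, q) R) ij (Y : 'M[R]_(p, q)) : R :=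
  smoothing' nu ij Y / (2 * smoothing_pdf eps nu Y).

Section one_measure.
Context p q (nu : probability 'M[R]_(p, q) R).

Lemma is_derive_smoothing ij Y :
  is_derive Y (mxdir ij) (smoothing_pdf eps nu) (smoothing' nu ij Y).
Proof.
rewrite (_ : smoothing_pdf eps nu = gtrans eps nu (fun=> 1)).
  exact: is_derive_gtrans (gint_probability eps nu).
by apply/funext => X; exact: smoothing_gtrans.
Qed.

Lemma Ck_smoothing k : Ck k (smoothing_pdf eps nu).
Proof.
rewrite (_ : smoothing_pdf eps nu = gtrans eps nu (fun=> 1)).
  exact: Ck_gtrans (gint_probability eps nu).
by apply/funext => X; exact: smoothing_gtrans.
Qed.

Lemma continuous_smoothing' ij : continuous (smoothing' nu ij).
Proof.
have [_ /(_ ij)[f df [cf _]]] := Ck_smoothing 1.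
rewrite (_ : smoothing' nu ij = f)//.
rewrite -(partialE df); apply/esym/partialE => X; exact: is_derive_smoothing.
Qed.

Lemma continuous_half_score ij : continuous (half_score nu ij).
Proof.
move=> Y; apply: continuousM; first exact: continuous_smoothing'.
have p0 := smoothing_pdf_gt0 eps nu Y.
apply: continuousV; first by rewrite mulf_neq0 ?gt_eqF.
apply: continuousM; first exact: cst_continuous.
exact: (Ck_continuous (Ck_smoothing 0)).
Qed.

Lemma measurable_half_score ij : measurable_fun [set: 'M[R]_(p, q)] (half_score nu ij).
Proof. by apply: measurable_continuous; exact: continuous_half_score. Qed.

End one_measure.

Let K (X Y : E) : R := gk eps X Y * G Y.

Let K' j i (X Y : E) : R := K X Y * ((X j i - Y j i) / e +
  2 * half_score mu (j, i) Y - 2 * half_score (marginal mu j) (ord0, i) (row j Y)).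

Let is_derive_K j i (X Y : E) : is_derive Y (mxdir (j, i)) (K X) (K' j i X Y).
Proof.
have M0 := prod_heat_conv_gt0 eps mu xpredT Y.
have L0 := smoothing_pdf_gt0 eps mu Y.
have mj0 := heat_conv_pdf_gt0 eps (marginal mu j) (row j Y).
have dm : is_derive (row j Y) (mxdir (ord0, i)) (m j) (smoothing' (marginal mu j) (ord0, i) (row j Y)).
  rewrite (_ : m j = smoothing_pdf eps (marginal mu j)); first exact: is_derive_smoothing.
  by apply/funext => y; exact: heat_conv_smoothing.
have dG := is_derive_ratio L0 M0 (is_derive_smoothing mu (j, i) Y)
  (is_derive_row_prod (h := fun k => m k) dm).
apply: (is_derive_eq (is_derive_mul (is_derive_gk eps X Y (j, i)) dG)).
rewrite /K' /K /half_score -heat_conv_smoothing /likelihood_ratio [\prod_k _](bigD1 j)//=.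
have Q0 := prod_heat_conv_gt0 eps mu (fun k => k != j) Y.
by field; rewrite !gt_eqF.
Qed.

Let continuous_G : continuous G.
Proof.
move=> Y; apply: continuousM; first exact: (Ck_continuous (Ck_smoothing mu 0)).
apply: continuousV; first by rewrite gt_eqF// prod_heat_conv_gt0.
have cm k : continuous (m k).
  rewrite (_ : m k = smoothing_pdf eps (marginal mu k)).
    exact: (Ck_continuous (Ck_smoothing (marginal mu k) 0)).
  by apply/funext => y; exact: heat_conv_smoothing.
have cmr k : continuous (fun Y : E => m k (row k Y)).
  by move=> Z; apply: continuous_comp; [exact: continuous_row|exact: cm].
have [cp _] := @Ck_prod R N d 0 'I_N (index_enum 'I_N) (fun k Y => m k (row k Y)) (fun k => conj (cmr k) I).
exact: cp.
Qed.

(** The derivative of the kernel in X is opposite to its derivative in Y, which an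
    integration by parts moves to the ratio G. *)
Lemma mixing'_half_scores j i (X : E) :
  L.-integrable [set: E] (EFin \o (fun Y => K X Y * half_score mu (j, i) Y)) ->
  L.-integrable [set: E] (EFin \o (fun Y => K X Y * half_score (marginal mu j) (ord0, i) (row j Y))) ->
  mixing' eps mu (j, i) X / 2 = \int[L]_Y (K X Y * half_score mu (j, i) Y) -
    \int[L]_Y (K X Y * half_score (marginal mu j) (ord0, i) (row j Y)).
Proof.
move=> ia ib.
have g1 := gint_ratio eps mu N0; have g2 := gint_score X j i g1.
have i0 := integrable_kernel_ratio eps mu N0 X.
have i1 := integrable_gtrans X g2.
have i2 := integrableZl measurableT 2 (integrableB measurableT ia ib).
have i3 := integrableB measurableT i2 i1.
have i4 : L.-integrable [set: E] (EFin \o K' j i X).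
  move: i3; apply: eq_integrable => // Y _ /=.
  by rewrite -!EFinM; congr EFin; rewrite /K' /K; ring.
have cK' (Y : E) : continuous (fun t : R => K' j i X (t *: mxdir (j, i) + Y)).
  apply: continuous_line => {}Y.
  apply: continuousM; first by apply: continuousM; [exact: continuous_gk|exact: continuous_G].
  apply: continuousB; first apply: continuousD.
  - apply: continuousM; last exact: cst_continuous.
    by apply: continuousB; [exact: cst_continuous|exact: coord_continuous].
  - by apply: continuousM; [exact: cst_continuous|exact: continuous_half_score].
  - apply: continuousM; first exact: cst_continuous.
    apply: continuous_comp; first exact: continuous_row.
    exact: continuous_half_score.
have Z := integral_derivative_eq0 (is_derive_K j i X) cK' i0 i4.
have Z2 : \int[L]_Y K' j i X Y = 0 by rewrite /Rintegral Z.
move: Z2; rewrite (_ : K' j i X = fun Y => 2 * (K X Y * half_score mu (j, i) Y -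
   K X Y * half_score (marginal mu j) (ord0, i) (row j Y)) - G Y * ((Y j i - X j i) / e) * gk eps X Y).
  rewrite (RintegralB measurableT i2 i1) (RintegralZl _ measurableT (integrableB measurableT ia ib)).
  rewrite (RintegralB measurableT ia ib) /mixing' /gtrans /= => /eqP; rewrite subr_eq0 => /eqP <-.
  by rewrite mulrC mulKf.
by apply/funext => Y; rewrite /K' /K; ring.
Qed.

End integration_by_parts_kernel.

(** * The pointwise bound by scores *)

Lemma sqrD_le (R : realFieldType) (a b t : R) : 0 < t ->
  (a + b) ^+ 2 <= (1 + t) * a ^+ 2 + (1 + t^-1) * b ^+ 2.
Proof.
move=> t0; rewrite -subr_ge0 (_ : _ - _ = t^-1 * (t * a - b) ^+ 2).
  by rewrite mulr_ge0 ?sqr_ge0// invr_ge0 ltW.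
by field; rewrite gt_eqF.
Qed.

Lemma integrable_weight_sqr d (T : measurableType d) (R : realType) (mu : {measure set T -> \bar R})
    (k f h : T -> R) : measurable_fun [set: T] k -> measurable_fun [set: T] f ->
  measurable_fun [set: T] h -> (forall x, 0 <= k x) -> (forall x, f x ^+ 2 <= h x) ->
  mu.-integrable [set: T] (EFin \o k) ->
  (\int[mu]_x ((k x)%:E * (h x)%:E) < +oo)%E ->
  mu.-integrable [set: T] (EFin \o (fun x => k x * f x)).
Proof.
move=> mk mf mh k0 fh ik koo.
have h0 x : 0 <= h x by exact: le_trans (sqr_ge0 _) (fh x).
have ikh : mu.-integrable [set: T] (EFin \o (fun x => k x * h x)).
  apply/integrableP; split; first by apply/measurable_EFinP; exact: measurable_funM.
  rewrite (eq_integral (fun x => (k x)%:E * (h x)%:E)%E)// => x _.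
  by rewrite /= ger0_norm ?mulr_ge0// EFinM.
apply: (integrable_le _ _ (integrableD measurableT ik ikh)); first exact: measurable_funM.
move=> x /=; rewrite normrM (ger0_norm (k0 x)) -[X in _ <= X + _]mulr1 -mulrDr ler_wpM2l//.
apply: (le_trans _ (lerD (lexx 1) (fh x))).
rewrite -(real_normK (num_real (f x))); have := sqr_ge0 (`|f x| - 1); have := normr_ge0 (f x); nra.
Qed.

Section second_bound.
Context {R : realType} (N d : nat) (eps : {posnum R}) (mu : probability 'M[R]_(N, d) R).
Local Notation E := 'M[R]_(N, d).
Local Notation V := 'rV[R]_d.
Local Notation L := (@lebesgue_mx R N d).
Local Notation m k := (heat_conv_pdf eps (marginal mu k)).
Local Notation G := (likelihood_ratio eps mu).
Local Notation H := (mixing eps mu).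
Hypothesis N0 : (0 < N)%N.
Variables (u : 'I_N -> V -> R) (w : 'I_N -> 'I_d -> V -> R).
Hypotheses (mu_ : forall k, measurable_fun [set: V] (u k))
  (mw : forall k i, measurable_fun [set: V] (w k i)).

Let alpha j i (Y : E) := half_score eps mu (j, i) Y.
Let beta j i (y : V) := half_score eps (marginal mu j) (ord0, i) y.
Let Psi j i (t : R) (x : V) (Y : E) : R := (1 + t) * (u j x * alpha j i Y) ^+ 2 +
  (1 + t^-1) * (w j i x - u j x * beta j i (row j Y)) ^+ 2.

Lemma measurable_row_score j i : measurable_fun [set: E] (fun Y => beta j i (row j Y)).
Proof. exact: (measurableT_comp (measurable_half_score eps (marginal mu j) (ord0, i)) (measurable_row j)). Qed.

(** The conditional mean is rewritten, by an integration by parts, so that it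
    involves the scores of the smoothing and of the smoothed marginal. This
    requires these scores to be integrable, which follows from the finiteness of
    the right-hand side where u does not vanish. Where u vanishes, the constant w
    is averaged and nothing is to be integrated by parts. *)
Lemma root_theta'_sqr_le2 j i (t : R) (X : E) : 0 < t ->
  ((root_theta' eps mu u w j i X ^+ 2)%:E <=
     (\prod_(k < N | k != j) u k (row k X) ^+ 2)%:E *
     \int[L]_Y ((gk eps X Y * G Y)%:E * (Psi j i t (row j X) Y)%:E))%E.
Proof.
move=> t0; set U := u j (row j X); set W := w j i (row j X).
pose K Y := gk eps X Y * G Y.
have mK : measurable_fun [set: E] K := measurable_kernel_ratio eps mu X.
have K0 Y : 0 <= K Y := kernel_ratio_ge0 eps mu X Y.
have iK : L.-integrable setT (EFin \o K) := integrable_kernel_ratio eps mu N0 X.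
have IK : \int[L]_Y K Y = H X := Rintegral_kernel_ratio eps mu X.
pose A Y := U * alpha j i Y; pose B Y := W - U * beta j i (row j Y).
pose h Y := (1 + t) * A Y ^+ 2 + (1 + t^-1) * B Y ^+ 2.
have mA : measurable_fun [set: E] A.
  by apply: measurable_funM => //; exact: measurable_half_score.
have mB : measurable_fun [set: E] B.
  by apply: measurable_funB => //; apply: measurable_funM => //; exact: measurable_row_score.
have mh : measurable_fun [set: E] h.
  by apply: measurable_funD; apply: measurable_funM => //; exact: measurable_funX.
have t1 : 0 <= t^-1 by rewrite invr_ge0 ltW.
have Ah Y : A Y ^+ 2 <= h Y.
  by rewrite /h; have := sqr_ge0 (A Y); have := mulr_ge0 t1 (sqr_ge0 (B Y)); have := sqr_ge0 (B Y); nra.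
have Bh Y : B Y ^+ 2 <= h Y.
  by rewrite /h; have := sqr_ge0 (A Y); have := mulr_ge0 t1 (sqr_ge0 (B Y)); nra.
have ABh Y : (A Y + B Y) ^+ 2 <= h Y by exact: sqrD_le.
have h0 Y : 0 <= h Y by exact: le_trans (sqr_ge0 _) (Ah Y).
have CS (Phi : E -> R) : measurable_fun [set: E] Phi -> (forall Y, Phi Y ^+ 2 <= h Y) ->
    \int[L]_Y (K Y * Phi Y) = W * H X + U * mixing' eps mu (j, i) X / 2 ->
    ((root_theta' eps mu u w j i X ^+ 2)%:E <=
     (\prod_(k < N | k != j) u k (row k X) ^+ 2)%:E * \int[L]_Y ((K Y)%:E * (h Y)%:E))%E.
  move=> mPhi Phih PhiE; apply: (le_trans (root_theta'_sqr_le N0 mPhi PhiE)).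
  apply: lee_wpmul2l; first by rewrite lee_fin prodr_ge0// => k _; exact: sqr_ge0.
  apply: ge0_le_integral; first exact: measurableT.
  - by move=> Y _; rewrite -EFinM lee_fin mulr_ge0 ?sqr_ge0 ?K0.
  - by apply: emeasurable_funM; apply/measurable_EFinP => //; exact: measurable_funX.
  - by apply: emeasurable_funM; exact/measurable_EFinP.
  - by move=> Y _; rewrite -!EFinM lee_fin ler_wpM2l ?K0 ?Phih.
have [U0|U0] := eqVneq U 0.
  apply: (CS (fun=> W)) => // [Y|].
    by apply: (le_trans _ (Bh Y)); rewrite /B U0 mul0r subr0.
  have -> : (fun Y => K Y * W) = (fun Y => W * K Y) by apply/funext => Y; rewrite mulrC.
  by rewrite U0 !mul0r addr0 (RintegralZl _ measurableT iK) IK.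
have [P0|P0] := eqVneq (\prod_(k < N | k != j) u k (row k X)) 0.
  rewrite /root_theta' P0 mul0r expr0n /= mule_ge0//.
    by rewrite lee_fin prodr_ge0// => k _; exact: sqr_ge0.
  by apply: integral_ge0 => Y _; rewrite -EFinM lee_fin mulr_ge0 ?K0 ?h0.
have [|Ioo] := leP (+oo)%E (\int[L]_Y ((K Y)%:E * (h Y)%:E))%E.
  rewrite leye_eq => /eqP Ioo; rewrite [X in (_ <= _ * X)%E](_ : _ = +oo)%E//.
  rewrite gt0_muley ?leey// lte_fin prodrXl lt_neqAle sqr_ge0 andbT eq_sym.
  by rewrite expf_neq0.
have iA := integrable_weight_sqr mK mA mh K0 Ah iK Ioo.
have iB := integrable_weight_sqr mK mB mh K0 Bh iK Ioo.
have ia : L.-integrable [set: E] (EFin \o (fun Y => K Y * alpha j i Y)).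
  have := integrableZl measurableT U^-1 iA; apply: eq_integrable => // Y _ /=.
  by rewrite -EFinM; congr EFin; rewrite /A; field.
have ib : L.-integrable [set: E] (EFin \o (fun Y => K Y * beta j i (row j Y))).
  have iWK := integrableZl measurableT W iK.
  have := integrableZl measurableT U^-1 (integrableB measurableT iWK iB).
  apply: eq_integrable => // Y _ /=.
  by rewrite -!EFinM; congr EFin; rewrite /B; field.
have IBP := mixing'_half_scores N0 ia ib.
apply: (CS (fun Y => A Y + B Y)); [exact: measurable_funD|exact: ABh|].
have iWK := integrableZl measurableT W iK.
have iD := integrableZl measurableT U (integrableB measurableT ia ib).
have -> : (fun Y => K Y * (A Y + B Y)) =
   (fun Y => W * K Y + U * (K Y * alpha j i Y - K Y * beta j i (row j Y))).
  by apply/funext => Y; rewrite /A /B; ring.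
rewrite (RintegralD measurableT iWK iD) (RintegralZl _ measurableT iK) IK.
rewrite (RintegralZl _ measurableT (integrableB measurableT ia ib)) (RintegralB measurableT ia ib).
by rewrite -mulrA IBP.
Qed.

End second_bound.

(** * The score of a smoothed square *)

Section density_score.
Context {R : realType} {d : nat} (eps : {posnum R}) (nu : probability 'rV[R]_d R).
Local Notation V := 'rV[R]_d.
Local Notation L1 := (@lebesgue_mx R 1 d).
Variables (u w : V -> R) (ij : 'I_1 * 'I_d).
Hypotheses (su : sqint L1 u) (sw : sqint L1 w) (uw : is_weak_partial u ij w).
Hypothesis hd : has_density nu (fun x => u x ^+ 2).

Local Notation m := (smoothing_pdf eps nu).
Local Notation beta := (half_score eps nu ij).

Lemma smoothing_density_gtrans y : m y = gtrans eps L1 (fun x => u x ^+ 2) y.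
Proof. exact: gtrans_density. Qed.

(** Both sides are half of the derivative of the smoothing. *)
Lemma gtrans_mul_weak_partial y : gtrans eps L1 (fun x => u x * w x) y = m y * beta y.
Proof.
have := gtrans_sqr_derivative eps su sw uw y => D.
have d1 := is_derive_smoothing eps nu ij y.
have g2 : gint eps L1 (fun x => u x ^+ 2) by apply: gint_integrable; exact: integrable_sqr.
have d2 := is_derive_gtrans y ij g2.
have mE : m = gtrans eps L1 (fun x => u x ^+ 2) by apply/funext => z; exact: smoothing_density_gtrans.
rewrite -mE in d2.
have E : smoothing' eps nu ij y = 2 * gtrans eps L1 (fun x => u x * w x) y.
  by rewrite -D; have [_ <-] := d1; have [_ <-] := d2.
have m0 := smoothing_pdf_gt0 eps nu y.
by rewrite /half_score E; field; rewrite gt_eqF.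
Qed.

(** Up to the factor m(y), the conditional variance of w/u given y. *)
Definition conditional_gap y : \bar R :=
  (\int[L1]_x ((gk eps x y)%:E * ((w x - u x * beta y) ^+ 2)%:E))%E.

(** The half score is the conditional mean of w/u, so this is the decomposition
    of a second moment into a variance and a squared mean. *)
Lemma conditional_gapE y : (conditional_gap y + (m y * beta y ^+ 2)%:E =
  \int[L1]_x ((gk eps x y)%:E * (w x ^+ 2)%:E))%E.
Proof.
have i0 := integrable_gtrans y (gint_integrable eps (integrable_sqr su)).
have i1 := integrable_gtrans y (gint_integrable eps (integrable_mul_sqint su sw)).
have i2 := integrable_gtrans y (gint_integrable eps (integrable_sqr sw)).
have j1 := integrableZl measurableT (- (2 * beta y)) i1.
have j0 := integrableZl measurableT (beta y ^+ 2) i0.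
have j01 := integrableD measurableT j1 j0.
have E0 : \int[L1]_x (u x ^+ 2 * gk eps y x) = m y by rewrite smoothing_density_gtrans.
have E1 : \int[L1]_x (u x * w x * gk eps y x) = m y * beta y by exact: gtrans_mul_weak_partial.
rewrite /conditional_gap.
rewrite (eq_integral (fun x => (w x ^+ 2 * gk eps y x)%:E +
   ((- (2 * beta y))%:E * (u x * w x * gk eps y x)%:E + (beta y ^+ 2)%:E * (u x ^+ 2 * gk eps y x)%:E))%E); last first.
  by move=> x _; rewrite -!EFinM -!EFinD gkC; congr EFin; ring.
rewrite (integralD measurableT i2 j01) (integralD measurableT j1 j0).
rewrite (integralZl measurableT i1) (integralZl measurableT i0).
rewrite -(EFin_Rintegral measurableT i0) -(EFin_Rintegral measurableT i1) -(EFin_Rintegral measurableT i2).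
rewrite E0 E1 -!EFinM -!EFinD (_ : _ + _ = \int[L1]_x (w x ^+ 2 * gk eps y x)); last by ring.
rewrite (EFin_Rintegral measurableT i2); apply: eq_integral => x _.
by rewrite -EFinM mulrC gkC.
Qed.

Lemma measurable_conditional_gap : measurable_fun [set: V] conditional_gap.
Proof.
pose q (z : V * V) := ((gk eps z.1 z.2)%:E * ((w z.1 - u z.1 * beta z.2) ^+ 2)%:E)%E.
have mq : measurable_fun [set: V * V] q.
  apply: emeasurable_funM; apply/measurable_EFinP; first exact: measurable_gk2.
  apply: measurable_funX; apply: measurable_funB.
    exact: (measurableT_comp sw.1 measurable_fst).
  apply: measurable_funM; first exact: (measurableT_comp su.1 measurable_fst).
  exact: (measurableT_comp (measurable_half_score eps nu ij) measurable_snd).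
have q0 z : (0 <= q z)%E by rewrite /q -EFinM lee_fin mulr_ge0 ?sqr_ge0// ltW// gk_gt0.
exact: (measurable_fun_fubini_tonelli_G (m1 := L1) q mq q0).
Qed.

Lemma conditional_gap_ge0 y : (0 <= conditional_gap y)%E.
Proof.
by apply: integral_ge0 => x _; rewrite -EFinM lee_fin mulr_ge0 ?sqr_ge0// ltW// gk_gt0.
Qed.

Lemma integral_conditional_gap :
  (\int[L1]_y conditional_gap y + \int[L1]_y (m y * beta y ^+ 2)%:E =
   \int[L1]_x (w x ^+ 2)%:E)%E.
Proof.
have mw2 : measurable_fun [set: V] (fun x => (w x ^+ 2)%:E).
  by apply/measurable_EFinP; exact: measurable_funX sw.1.
pose q (z : V * V) := ((gk eps z.1 z.2)%:E * (w z.1 ^+ 2)%:E)%E.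
have mq : measurable_fun [set: V * V] q.
  apply: emeasurable_funM; first by apply/measurable_EFinP; exact: measurable_gk2.
  exact: (measurableT_comp mw2 measurable_fst).
have q0 z : (0 <= q z)%E by rewrite /q -EFinM lee_fin mulr_ge0 ?sqr_ge0// ltW// gk_gt0.
have mmb : measurable_fun [set: V] (fun y => (m y * beta y ^+ 2)%:E).
  apply/measurable_EFinP; apply: measurable_funM; first exact: measurable_smoothing_pdf.
  by apply: measurable_funX; exact: measurable_half_score.
rewrite -ge0_integralD.
2: exact: measurableT.
2: by move=> y _; exact: conditional_gap_ge0.
2: exact: measurable_conditional_gap.
2: by move=> y _; rewrite lee_fin mulr_ge0 ?sqr_ge0// smoothing_pdf_ge0.
2: exact: mmb.
under eq_integral do rewrite conditional_gapE.
rewrite -(fubini_tonelli q mq q0); apply: eq_integral => x _.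
rewrite /q /= ge0_integralZr.
2: exact: measurableT.
2: by apply/measurable_EFinP; exact: measurable_gk.
2: by move=> y _; rewrite lee_fin ltW// gk_gt0.
2: by rewrite lee_fin sqr_ge0.
by rewrite integral_gk mul1e.
Qed.

End density_score.

(** * The integrated bound by scores *)

(** The square of a sum of square roots is the infimum of these upper bounds. *)
Lemma le_sqr_sqrteD (R : realType) (x a b : \bar R) : (0 <= a)%E -> (0 <= b)%E -> (b < +oo)%E ->
  (forall t : R, 0 < t -> (x <= (1 + t)%:E * a + (1 + t^-1)%:E * b)%E) ->
  (x <= (sqrte a + sqrte b) ^+ 2)%E.
Proof.
case: a => [a||]//; last first.
  case: b => [b||]// _ b0 _ _; rewrite expe2 /=.
  by rewrite addye// mulyy leey.
case: b => [b||]// a0 b0 _ H; rewrite !lee_fin in a0 b0.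
rewrite expe2 /= -EFinD -EFinM -expr2.
set p := Num.sqrt a; set q := Num.sqrt b.
have p0 : 0 <= p by exact: sqrtr_ge0. have q0 : 0 <= q by exact: sqrtr_ge0.
have aE : a = p ^+ 2 by rewrite sqr_sqrtr. have bE : b = q ^+ 2 by rewrite sqr_sqrtr.
apply/lee_addgt0Pr => r r0.
(* the optimal t is q / p; the shift by s handles the vanishing of p or q *)
pose s := r / (p + q + 1).
have D0 : 0 < p + q + 1 by rewrite ltr_wpDl// addr_ge0.
have s0 : 0 < s by rewrite divr_gt0.
have ps : 0 < p + s by rewrite ltr_wpDl. have qs : 0 < q + s by rewrite ltr_wpDl.
apply: (le_trans (H ((q + s) / (p + s)) _)); first by rewrite divr_gt0.
rewrite -!EFinM -!EFinD lee_fin aE bE invf_div.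
have h1 : p ^+ 2 * ((q + s) / (p + s)) <= p * (q + s).
  rewrite mulrA ler_pdivrMr// [leLHS](_ : _ = p * (q + s) * p); last by ring.
  by rewrite ler_wpM2l ?mulr_ge0 ?(ltW qs)// lerDl ltW.
have h2 : q ^+ 2 * ((p + s) / (q + s)) <= q * (p + s).
  rewrite mulrA ler_pdivrMr// [leLHS](_ : _ = q * (p + s) * q); last by ring.
  by rewrite ler_wpM2l ?mulr_ge0 ?(ltW ps)// lerDl ltW.
have h3 : s * (p + q) <= r.
  rewrite /s mulrAC ler_pdivrMr// ler_pM2l//; lra.
nra.
Qed.

Section sqrt_smoothing.
Context {R : realType} {m n : nat} (eps : {posnum R}) (nu : probability 'M[R]_(m, n) R).
Local Notation E := 'M[R]_(m, n).
Local Notation p := (smoothing_pdf eps nu).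

Lemma is_weak_partial_sqrt_smoothing ij :
  is_weak_partial (fun Y => Num.sqrt (p Y)) ij (fun Y => Num.sqrt (p Y) * half_score eps nu ij Y).
Proof.
have p0 Y := smoothing_pdf_gt0 eps nu Y.
have cs : continuous (fun Y => Num.sqrt (p Y)).
  exact: (Ck_continuous (Ck_sqrt p0 (Ck_smoothing eps nu 0))).
have ch : continuous (half_score eps nu ij) by exact: continuous_half_score.
apply: is_weak_partial_classical; first exact: cs.
  by move=> Y; exact: (continuousM (cs Y) (ch Y)).
move=> Y; have H := is_derive_compR (is_derive_sqrt (p0 Y)) (is_derive_smoothing eps nu ij Y).
have s0 : 0 < Num.sqrt (p Y) by rewrite sqrtr_gt0.
have pE : p Y = Num.sqrt (p Y) ^+ 2 by rewrite sqr_sqrtr// ltW.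
apply: (is_derive_eq H); rewrite /half_score; move: s0 pE; move: (Num.sqrt _) => s s0 ->.
by field; rewrite gt_eqF.
Qed.

Lemma sqrt_smoothing_score_sqr ij Y :
  (Num.sqrt (p Y) * half_score eps nu ij Y) ^+ 2 = p Y * half_score eps nu ij Y ^+ 2.
Proof. by rewrite exprMn sqr_sqrtr// smoothing_pdf_ge0. Qed.

Lemma measurable_sqrt_smoothing_score ij :
  measurable_fun [set: E] (fun Y => Num.sqrt (p Y) * half_score eps nu ij Y).
Proof.
apply: measurable_funM; last exact: measurable_half_score.
apply: measurableT_comp; first exact: measurable_sqrt.
exact: measurable_smoothing_pdf.
Qed.

End sqrt_smoothing.

Section energy_heat_conv.
Context {R : realType} {d : nat} (eps : {posnum R}) (nu : probability 'rV[R]_d R).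
Local Notation V := 'rV[R]_d.
Local Notation L1 := (@lebesgue_mx R 1 d).
Variables (u : V -> R) (w : 'I_1 * 'I_d -> V -> R).
Hypotheses (su : sqint L1 u) (sw : forall ij, sqint L1 (w ij))
  (uw : forall ij, is_weak_partial u ij (w ij)).
Hypothesis hd : has_density nu (fun x => u x ^+ 2).

Lemma integral_score_sqr_lty ij :
  (\int[L1]_y (smoothing_pdf eps nu y * half_score eps nu ij y ^+ 2)%:E < +oo)%E.
Proof.
apply: le_lt_trans (sw ij).2.
rewrite -(integral_conditional_gap eps su (sw ij) (uw ij) hd) leeDr//.
by apply: integral_ge0 => y _; exact: conditional_gap_ge0.
Qed.

Lemma energy_heat_conv : energy (heat_conv eps nu) =
  (\sum_ij \int[L1]_y (smoothing_pdf eps nu y * half_score eps nu ij y ^+ 2)%:E)%E.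
Proof.
have hs : has_density (heat_conv eps nu) (fun y => Num.sqrt (smoothing_pdf eps nu y) ^+ 2).
  rewrite (_ : (fun y => _) = heat_conv_pdf eps nu).
    by split; [exact: measurable_heat_conv_pdf|exact: heat_conv_pdf_ge0|].
  by apply/funext => y; rewrite sqr_sqrtr ?smoothing_pdf_ge0// heat_conv_smoothing.
have ms : measurable_fun [set: V] (fun y => Num.sqrt (smoothing_pdf eps nu y)).
  apply: measurableT_comp; first exact: measurable_sqrt.
  exact: measurable_smoothing_pdf.
have [|_ ->] := energyE (fun y => sqrtr_ge0 _) ms hs (is_weak_partial_sqrt_smoothing eps nu).
  move=> ij; split; first exact: measurable_sqrt_smoothing_score.
  under eq_integral do rewrite sqrt_smoothing_score_sqr.
  exact: integral_score_sqr_lty.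
by apply: eq_bigr => ij _; under eq_integral do rewrite sqrt_smoothing_score_sqr.
Qed.

End energy_heat_conv.

Section second_integral_bound.
Context {R : realType} (N d : nat) (eps : {posnum R}) (mu : probability 'M[R]_(N, d) R).
Local Notation E := 'M[R]_(N, d).
Local Notation V := 'rV[R]_d.
Local Notation L := (@lebesgue_mx R N d).
Local Notation L1 := (@lebesgue_mx R 1 d).
Local Notation m k := (heat_conv_pdf eps (marginal mu k)).
Local Notation Lam := (smoothing_pdf eps mu).
Hypothesis N0 : (0 < N)%N.
Variables (u : 'I_N -> V -> R) (w : 'I_N -> 'I_d -> V -> R).
Hypotheses (mu_ : forall k, measurable_fun [set: V] (u k))
  (mw : forall k i, measurable_fun [set: V] (w k i)).
Hypothesis hd : forall k, has_density (marginal mu k) (fun x => u k x ^+ 2).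

(** The weights 1 + t and 1 + 1/t absorb the cross term of the two summands. *)
Lemma integral_root_theta'_le2 j i (t : R) : 0 < t ->
  (\int[L]_X (root_theta' eps mu u w j i X ^+ 2)%:E <=
   (1 + t)%:E * \int[L]_Y (Lam Y * half_score eps mu (j, i) Y ^+ 2)%:E +
   (1 + t^-1)%:E * \int[L1]_y
      conditional_gap eps (marginal mu j) (u j) (w j i) (ord0, i) y)%E.
Proof.
move=> t0.
pose alpha (Y : E) := half_score eps mu (j, i) Y.
pose beta (y : V) := half_score eps (marginal mu j) (ord0, i) y.
have ma : measurable_fun [set: E] alpha by exact: measurable_half_score.
have mb : measurable_fun [set: V] beta by exact: measurable_half_score.
pose F (x y : V) : \bar R := ((w j i x - u j x * beta y) ^+ 2)%:E.
have mF : measurable_fun [set: V * V] (fun z => F z.1 z.2).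
  apply/measurable_EFinP; apply: measurable_funX; apply: measurable_funB.
    exact: (measurableT_comp (mw j i) measurable_fst).
  apply: measurable_funM; first exact: (measurableT_comp (mu_ j) measurable_fst).
  exact: (measurableT_comp mb measurable_snd).
have F0 x y : (0 <= F x y)%E by rewrite lee_fin sqr_ge0.
pose P (x : V) (Y : E) : R := (1 + t) * (u j x * alpha Y) ^+ 2 +
  (1 + t^-1) * (w j i x - u j x * beta (row j Y)) ^+ 2.
have t1 : 0 <= 1 + t by rewrite addr_ge0// ltW.
have t2 : 0 <= 1 + t^-1 by rewrite addr_ge0// invr_ge0 ltW.
have mP : measurable_fun [set: V * E] (fun z => (P z.1 z.2)%:E).
  apply/measurable_EFinP; apply: measurable_funD; apply: measurable_funM => //; apply: measurable_funX.
    apply: measurable_funM; first exact: (measurableT_comp (mu_ j) measurable_fst).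
    exact: (measurableT_comp ma measurable_snd).
  apply: measurable_funB; first exact: (measurableT_comp (mw j i) measurable_fst).
  apply: measurable_funM; first exact: (measurableT_comp (mu_ j) measurable_fst).
  exact: (measurableT_comp (measurable_row_score eps mu j i) measurable_snd).
have P0 x Y : (0 <= (P x Y)%:E)%E by rewrite lee_fin addr_ge0// mulr_ge0// sqr_ge0.
have H := @integral_root_theta'_le _ _ _ eps mu N0 u w mu_ mw hd j i (fun x Y => (P x Y)%:E) mP P0.
apply: (le_trans (H _)) => [X|]; first exact: root_theta'_sqr_le2.
have m0 y : 0 < m j y by exact: heat_conv_pdf_gt0.
have mu2 : measurable_fun [set: V] (fun x => u j x ^+ 2) by exact: measurable_funX.
have gk0 (x y : V) : (0 <= (gk eps x y)%:E)%E by rewrite lee_fin ltW// gk_gt0.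
have mgk y : measurable_fun [set: V] (fun x : V => (gk eps x y)%:E) .
  by apply/measurable_EFinP; exact: measurable_gkl.
have mFy y : measurable_fun [set: V] (F^~ y).
  apply/measurable_EFinP; apply: measurable_funX; apply: measurable_funB; first exact: mw.
  exact: (measurable_funM (mu_ j) (measurable_cst (beta y))).
pose gap y := (\int[L1]_x ((gk eps x y)%:E * F x y))%E.
have gap0 y : (0 <= gap y)%E by apply: integral_ge0 => x _; exact: mule_ge0.
have mgap : measurable_fun [set: V] gap.
  pose q (z : V * V) := ((gk eps z.1 z.2)%:E * F z.1 z.2)%E.
  have mq : measurable_fun [set: V * V] q.
    by apply: emeasurable_funM => //; apply/measurable_EFinP; exact: measurable_gk2.
  have q0 z : (0 <= q z)%E by exact: mule_ge0.
  exact: (measurable_fun_fubini_tonelli_G (m1 := L1) q mq q0).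
have inner Y : (\int[L1]_x ((gk eps x (row j Y))%:E * (P x Y)%:E) =
    ((1 + t) * alpha Y ^+ 2 * m j (row j Y))%:E + (1 + t^-1)%:E * gap (row j Y))%E.
  set y := row j Y.
  have mfu : measurable_fun [set: V] (fun x => (u j x ^+ 2 * gk eps x y)%:E).
    by apply/measurable_EFinP; apply: measurable_funM => //; exact: measurable_gkl.
  have fu0 x : (0 <= (u j x ^+ 2 * gk eps x y)%:E)%E.
    by rewrite lee_fin mulr_ge0 ?sqr_ge0// ltW// gk_gt0.
  rewrite (eq_integral (fun x => ((1 + t) * alpha Y ^+ 2)%:E * (u j x ^+ 2 * gk eps x y)%:E +
      (1 + t^-1)%:E * ((gk eps x y)%:E * F x y))%E); last first.
    by move=> x _; rewrite /F /P -/y -!EFinM -!EFinD; congr EFin; ring.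
  have c0 : (0 <= ((1 + t) * alpha Y ^+ 2)%:E)%E by rewrite lee_fin mulr_ge0// sqr_ge0.
  have mF' : measurable_fun [set: V] (fun x => (gk eps x y)%:E * F x y)%E by exact: emeasurable_funM.
  have F0' x : (0 <= (gk eps x y)%:E * F x y)%E by exact: mule_ge0.
  rewrite ge0_integralD.
  2: exact: measurableT.
  2: by move=> x _; exact: mule_ge0.
  2: by apply: emeasurable_funM.
  2: by move=> x _; rewrite mule_ge0// lee_fin.
  2: by apply: emeasurable_funM.
  rewrite (ge0_integralZl L1 measurableT mfu (fun x _ => fu0 x) c0).
  rewrite (ge0_integralZl L1 measurableT mF' (fun x _ => F0' x)); last by rewrite lee_fin.
  by rewrite -(EFin_heat_conv eps hd) -EFinM.
have c0 Y : 0 <= Lam Y / m j (row j Y) by rewrite divr_ge0 ?smoothing_pdf_ge0// ltW.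
rewrite (eq_integral (fun Y => (1 + t)%:E * (Lam Y * alpha Y ^+ 2)%:E +
   (1 + t^-1)%:E * ((Lam Y / m j (row j Y))%:E * gap (row j Y)))%E); last first.
  move=> Y _; rewrite inner ge0_muleDr ?lee_fin; last 2 first.
  - by rewrite ?lee_fin mulr_ge0 ?(ltW (m0 _))// mulr_ge0// sqr_ge0.
  - by rewrite mule_ge0 ?lee_fin ?gap0.
  rewrite muleCA -!EFinM; congr (_%:E + _)%E.
  by field; rewrite gt_eqF.
have mA : measurable_fun [set: E] (fun Y => (Lam Y * alpha Y ^+ 2)%:E).
  apply/measurable_EFinP; apply: measurable_funM; first exact: measurable_smoothing_pdf.
  exact: measurable_funX.
have A0 Y : (0 <= (Lam Y * alpha Y ^+ 2)%:E)%E by rewrite lee_fin mulr_ge0 ?sqr_ge0 ?smoothing_pdf_ge0.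
have mB : measurable_fun [set: E] (fun Y => (Lam Y / m j (row j Y))%:E * gap (row j Y))%E.
  apply: emeasurable_funM; last exact: (measurableT_comp mgap (measurable_row j)).
  apply/measurable_EFinP; apply: measurable_funM; first exact: measurable_smoothing_pdf.
  have mV : measurable_fun [set: V] (fun y => (m j y)^-1).
    by apply: measurable_funV_gt0 => //; exact: measurable_heat_conv_pdf.
  exact: (measurableT_comp mV (measurable_row j)).
have B0 Y : (0 <= (Lam Y / m j (row j Y))%:E * gap (row j Y))%E by rewrite mule_ge0 ?lee_fin.
rewrite ge0_integralD.
2: exact: measurableT.
2: by move=> Y _; apply: mule_ge0; [rewrite lee_fin|exact: A0].
2: exact: emeasurable_funM.
2: by move=> Y _; apply: mule_ge0; [rewrite lee_fin|exact: B0].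
2: exact: emeasurable_funM.
have t1E : (0 <= (1 + t)%:E)%E by rewrite lee_fin.
have t2E : (0 <= (1 + t^-1)%:E)%E by rewrite lee_fin.
rewrite (ge0_integralZl L measurableT mA (fun Y _ => A0 Y) t1E).
rewrite (ge0_integralZl L measurableT mB (fun Y _ => B0 Y) t2E).
rewrite /gap (integral_conditional_row eps mu j mF F0).
by rewrite le_eqVlt eqxx.
Qed.

End second_integral_bound.

(** * The energy inequalities *)

Lemma sum_ord1_pair (R : realType) d (F : 'I_1 * 'I_d -> \bar R) :
  (\sum_ij F ij = \sum_i F (ord0, i))%E.
Proof.
rewrite (eq_bigr (fun ij => F (ij.1, ij.2))); last by case.
by rewrite -(pair_bigA _ (fun i j => F (i, j))) /= big_ord1.
Qed.

Section energy_Theta.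
Context {R : realType} (N d : nat) (eps : {posnum R}) (mu : probability 'M[R]_(N, d) R).
Local Notation e := (eps%:num).
Local Notation E := 'M[R]_(N, d).
Local Notation V := 'rV[R]_d.
Local Notation L := (@lebesgue_mx R N d).
Local Notation L1 := (@lebesgue_mx R 1 d).
Hypothesis N0 : (0 < N)%N.
Variables (u : 'I_N -> V -> R) (w : 'I_N -> 'I_1 * 'I_d -> V -> R).
Hypotheses (u0 : forall k x, 0 <= u k x) (mu_ : forall k, measurable_fun [set: V] (u k))
  (sw : forall k ij, sqint L1 (w k ij)) (uw : forall k ij, is_weak_partial (u k) ij (w k ij)).
Hypothesis hd : forall k, has_density (marginal mu k) (fun x => u k x ^+ 2).

Let w1 k i := w k (ord0, i).
Let mw k i : measurable_fun [set: V] (w1 k i). Proof. exact: (sw k (ord0, i)).1. Qed.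

Lemma energy_marginal j : energy (marginal mu j) = (\sum_i \int[L1]_x (w1 j i x ^+ 2)%:E)%E.
Proof. by rewrite (energyE (u0 j) (mu_ j) (hd j) (uw j) (sw j)).2 sum_ord1_pair. Qed.

Lemma energy_Theta : energy (Theta eps mu) =
  (\sum_j \sum_i \int[L]_X (root_theta' eps mu u w1 j i X ^+ 2)%:E)%E.
Proof.
have hT : has_density (Theta eps mu) (fun X => root_theta eps mu u X ^+ 2).
  rewrite (_ : (fun X => _) = theta_pdf eps mu (fun k x => u k x ^+ 2)); first exact: Theta_density.
  by apply/funext => X; exact: root_theta_sqr.
have r0 X : 0 <= root_theta eps mu u X by rewrite mulr_ge0 ?sqrtr_ge0// prodr_ge0.
have mr := measurable_root_theta eps mu N0 mu_.
have sr := has_density_sqint r0 mr hT.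
have sg (ji : 'I_N * 'I_d) : sqint L (root_theta' eps mu u w1 ji.1 ji.2).
  split; first exact: measurable_root_theta'.
  apply: (le_lt_trans (integral_root_theta'_le1 eps N0 mu_ mw hd ji.1 ji.2)).
  by rewrite lte_add_pinfty ?ltry//; exact: (sw ji.1 (ord0, ji.2)).2.
have wg (ji : 'I_N * 'I_d) : is_weak_partial (root_theta eps mu u) ji (root_theta' eps mu u w1 ji.1 ji.2).
  case: ji sg => j i sg.
  apply: (@is_weak_partial_row_prod R N d j u (w1 j) (root_mixing eps mu)
     (fun i => uw j (ord0, i)) (Ck_root_mixing eps mu N0) i (root_mixing' eps mu (j, i))) => //.
  - by move=> X; exact: is_derive_root_mixing.
  - exact: (sqint_locally_integrable sr).
  - exact: (sqint_locally_integrable (sg (j, i))).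
rewrite (energyE r0 mr hT wg sg).2.
by rewrite -(pair_bigA _ (fun j i => \int[L]_X (root_theta' eps mu u w1 j i X ^+ 2)%:E)%E).
Qed.

Lemma energy_Theta_le : (energy (Theta eps mu) <=
  (\sum_(j < N) energy (marginal mu j)) + (N%:R * (d%:R / 4) / e)%R%:E)%E.
Proof.
(* each of the N d directions contributes 1 / (4 eps) *)
have cE : ((N%:R * (d%:R / 4) / e)%R%:E = \sum_(j < N) \sum_(i < d) ((4 * e)^-1)%:E :> \bar R)%E.
  rewrite !sumEFin; congr EFin; rewrite !sumr_const !card_ord -[_ *+ d]mulr_natl -[_ *+ N]mulr_natl.
  by rewrite invfM; ring.
rewrite energy_Theta cE -big_split /=; apply: lee_sum => j _.
rewrite energy_marginal -big_split /=; apply: lee_sum => i _.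
exact: integral_root_theta'_le1.
Qed.

(** The norm and Delta are the roots of the two integrals in the bound by scores,
    summed over i. *)
Lemma energy_Theta_le_scores : (energy (Theta eps mu) <= \sum_(j < N)
  ('N[L]_2%:E [EFin \o row_grad_norm (fun Y => Num.sqrt (smoothing_pdf eps mu Y)) j]
   + Delta eps mu j) ^+ 2)%E.
Proof.
rewrite energy_Theta; apply: lee_sum => j _.
have su := has_density_sqint (u0 j) (mu_ j) (hd j).
pose A i := (\int[L]_Y (smoothing_pdf eps mu Y * half_score eps mu (j, i) Y ^+ 2)%:E)%E.
pose B i := (\int[L1]_y conditional_gap eps (marginal mu j) (u j) (w1 j i) (ord0, i) y)%E.
pose C i := (\int[L1]_y (smoothing_pdf eps (marginal mu j) y *
  half_score eps (marginal mu j) (ord0, i) y ^+ 2)%:E)%E.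
have A0 i : (0 <= A i)%E.
  by apply: integral_ge0 => Y _; rewrite lee_fin mulr_ge0 ?sqr_ge0// smoothing_pdf_ge0.
have B0 i : (0 <= B i)%E by apply: integral_ge0 => y _; exact: conditional_gap_ge0.
have C0 i : (0 <= C i)%E.
  by apply: integral_ge0 => Y _; rewrite lee_fin mulr_ge0 ?sqr_ge0// smoothing_pdf_ge0.
have BC i : (B i + C i = \int[L1]_x (w1 j i x ^+ 2)%:E)%E.
  exact: (integral_conditional_gap eps su (sw j (ord0, i)) (uw j (ord0, i)) (hd j)).
have Coo i : (C i < +oo)%E by exact: (integral_score_sqr_lty eps su (sw j) (uw j) (hd j)).
have Boo i : (B i < +oo)%E.
  by apply: le_lt_trans (sw j (ord0, i)).2; rewrite -/(w1 j i) -BC leeDl.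
have AE : ('N[L]_2%:E [EFin \o row_grad_norm (fun Y => Num.sqrt (smoothing_pdf eps mu Y)) j] =
    sqrte (\sum_i A i))%E.
  rewrite Lnorm2E; congr sqrte.
  have W i := weak_partial_spec (is_weak_partial_sqrt_smoothing eps mu (j, i)).
  have mW i : measurable_fun [set: E] (weak_partial (fun Y => Num.sqrt (smoothing_pdf eps mu Y)) (j, i)).
    by have [[_ [] //]] := W i.
  rewrite -ge0_integral_sum//; last 2 first.
  - move=> i; apply/measurable_EFinP; apply: measurable_funM; first exact: measurable_smoothing_pdf.
    by apply: measurable_funX; exact: measurable_half_score.
  - by move=> i Y _; rewrite lee_fin mulr_ge0 ?sqr_ge0// smoothing_pdf_ge0.
  have S0 Y : 0 <= \sum_(i < d) weak_partial (fun Y => Num.sqrt (smoothing_pdf eps mu Y)) (j, i) Y ^+ 2.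
    by apply: sumr_ge0 => i _; exact: sqr_ge0.
  under eq_integral do rewrite /row_grad_norm sqr_sqrtr//.
  apply: ae_eq_integral; first exact: measurableT.
  - by apply/measurable_EFinP; apply: measurable_sum => i; exact: measurable_funX.
  - apply: emeasurable_sum => i; apply/measurable_EFinP; apply: measurable_funM.
      exact: measurable_smoothing_pdf.
    by apply: measurable_funX; exact: measurable_half_score.
  have : {ae L, forall Y, forall i, weak_partial (fun Y => Num.sqrt (smoothing_pdf eps mu Y)) (j, i) Y
     = Num.sqrt (smoothing_pdf eps mu Y) * half_score eps mu (j, i) Y}.
    by apply: filter_forall => i; exact: (W i).2.
  apply: filterS => Y HY _; rewrite sumEFin; congr EFin; apply: eq_bigr => i _.
  by rewrite HY sqrt_smoothing_score_sqr.
have BE : (Delta eps mu j = sqrte (\sum_i B i))%E.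
  rewrite /Delta energy_marginal (energy_heat_conv eps su (sw j) (uw j) (hd j)) sum_ord1_pair.
  congr sqrte; rewrite -/(C _) (eq_bigr (fun i => B i + C i)%E); last by move=> i _; rewrite BC.
  rewrite big_split /= -addeA subee ?adde0//.
  rewrite ge0_fin_numE; last exact: sume_ge0.
  by apply: lte_sum_pinfty => i _; exact: Coo.
rewrite AE BE; apply: le_sqr_sqrteD.
- exact: sume_ge0.
- exact: sume_ge0.
- by apply: lte_sum_pinfty => i _; exact: Boo.
move=> t t0; rewrite !ge0_sume_distrr//.
rewrite -big_split /=; apply: lee_sum => i _.
exact: integral_root_theta'_le2.
Qed.

End energy_Theta.

Local Open Scope ereal_scope.

Theorem theorem6p3 (R : realType) (d : nat) (d_gt0 : (0 < d)%N) :
  exists c : R, forall (N : nat) (N_gt0 : (0 < N)%N) (eps : {posnum R})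
    (mu : probability 'M[R]_(N, d) R),
    (forall j : 'I_N, P12 (marginal mu j)) ->
    energy (Theta eps mu) <=
      (\sum_(j < N) energy (marginal mu j)) + (N%:R * c / eps%:num)%R%:E
    /\
    (P12 mu ->
     energy (Theta eps mu) <=
       \sum_(j < N)
         ('N[lebesgue_mx]_2%:E [EFin \o
            row_grad_norm (fun Y => Num.sqrt (smoothing_pdf eps mu Y)) j]
          + Delta eps mu j) ^+ 2).
Proof.
exists (d%:R / 4)%R => N N0 eps mu mu12.
have /choice[w wP] : forall j, exists w, _ := fun j => P12E (mu12 j).
pose u j := sqrt_density (marginal mu j).
have u0 j x : (0 <= u j x)%R by exact: sqrtr_ge0.
have hu j : has_density (marginal mu j) (fun x => u j x ^+ 2)%R by have [] := wP j.
have mu_ j : measurable_fun [set: _] (u j) by have [] := wP j.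
have uw j ij : is_weak_partial (u j) ij (w j ij) by have [] := wP j.
have sw j ij : sqint lebesgue_mx (w j ij) by have [] := wP j.
split; first exact: (energy_Theta_le eps N0 u0 mu_ sw uw hu).
by move=> _; exact: (energy_Theta_le_scores eps N0 u0 mu_ sw uw hu).
Qed.
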